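(* Let $\overline{M}$ be a generic extension-lifting, with respect to $(f,g)$, of an oriented matroid $M$ on a finite set $E$. (1) For every bounded region $-_A\overline{M}$ of $\overline{M}$ with respect to $(f,g)$, there exists a unique basis $B$ of $\overline{M}$ containing $g$ but not $f$ such that, in $-_A\overline{M}$, $C^*(B;g)\setminus f$ is positive and $C(B;f)\setminus g$ is positive. Conversely, for every basis $B$ of $\overline{M}$ containing $g$ but not $f$, the reorientation $-_A\overline{M}$ (with $f,g\notin A$) such that $C^*(B;g)\setminus f$ is positive in $-_A\overline{M}$ and $C(B;f)\setminus g$ is positive in $-_A\overline{M}$ is a bounded region of $\overline{M}$ with respect to $(f,g)$. One thus obtains a bijection between bounded regions of $\overline{M}$ with respect to $(f,g)$ and bases of $\overline{M}$ containing $g$ but not $f$. (2) Furthermore, the basis $B$ associated with a bounded region $-_A\overline{M}$ is the unique optimal basis of the oriented matroid program $(-_A\overline{M},g,f)$. (3) When the extension-lifting $\overline{M}$ is compliant, this basis $B$ is the fully optimal basis of the bounded region $-_A\overline{M}$, and the bijection $-_A\overline{M}\mapsto B$ between bounded regions of $\overline{M}$ with respect to $(f,g)$ and bases of $\overline{M}$ containing $g$ but not $f$ (where $B$ is the unique basis of $\overline{M}$ containing $g$ but not $f$ such that $C^*(B;g)\setminus f$ and $C(B;f)\setminus g$ are positive in $-_A\overline{M}$) is the same as the active bijection for bounded regions of $\overline{M}$ (which maps a bounded region to its fully optimal basis), with respect to any linear ordering of $E\cup\{f,g\}$ in which $g$ is the smallest element and $f$ is the second smallest. (When $\overline{M}$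 is not compliant, one can consider a compliant generic extension-lifting $\overline{M}'$ of $M$ with respect to $(f',g)$, where $f$ is replaced with $f'$ such that $\overline{M}'\setminus f'=\overline{M}\setminus f$ and $\overline{M}'/g$ is $\overline{M}/g$ with $f$ renamed $f'$, and obtain the bijection for $\overline{M}$ from the one for $\overline{M}'$ by replacing $f'$ with $f$.)
   Context: All oriented matroids are on finite ground sets. An extension of an oriented matroid $N$ on $S$ with respect to $f\notin S$ is an oriented matroid $\overline{N}$ on $S\cup\{f\}$ with $\overline{N}\setminus f=N$ (deletion); it is generic if every circuit of $\overline{N}$ containing $f$ is spanning, that is, the supports of circuits of $\overline{N}$ containing $f$ are exactly the sets $B\cup\{f\}$ with $B$ a basis of $N$. A lifting of $N$ with respect to $g\notin S$ is an oriented matroid $\overline{N}$ on $S\cup\{g\}$ with $\overline{N}/g=N$ (contraction); it is generic if the supports of cocircuits of $\overline{N}$ containing $g$ are exactly the sets $(S\setminus B)\cup\{g\}$ with $B$ a basis of $N$. Let $M$ be an oriented matroid on $E$ and $f\neq g$ elements not in $E$. A generic extension-lifting of $M$ with respect to $(f,g)$ is an oriented matroid $\overline{M}$ on $E\cup\{f,g\}$ such that $(\overline{M}/g)\setminus f=M$, $\overline{M}$ is a generic extension of $\overline{M}\setminus f$ with respect to $f$, and $\overline{M}$ is a generic lifting of $\overline{M}/g$ with respect to $g$ ($f$ and $g$ are not loops nor coloops of $\overline{M}$). It is compliant if no vertex of an arrangement of $\overline{M}$ lies on the positive side of $g$ and the negative side of $f$, i.e. no signed cocircuit of $\overline{M}$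 is positive on $g$ and negative on $f$. $-_AN$ denotes the oriented matroid obtained from $N$ by reorienting the elements of $A$; reorientations of $N$ are indexed by subsets $A$ of the ground set (counted as distinct for distinct $A$). Acyclic means no positive circuit; totally cyclic means no positive cocircuit. A bounded region of $\overline{M}$ with respect to $(f,g)$ is a reorientation $-_A\overline{M}$ with $f,g\notin A$ such that $-_A\overline{M}\setminus f$ is acyclic and $-_A\overline{M}/g$ is totally cyclic. For a basis $B$ of an oriented matroid: for $b\in B$, $C^*(B;b)$ is the fundamental cocircuit, i.e. the signed cocircuit whose support is the complement of the closure of $B\setminus\{b\}$, with positive sign on $b$; for $e\notin B$, $C(B;e)$ is the fundamental circuit, i.e. the signed circuit with support contained in $B\cup\{e\}$, with positive sign on $e$. ''$C^*(B;g)\setminus f$ is positive in $-_A\overline{M}$'' means that all elements other than $f$ of the support of the fundamental cocircuit taken in $-_A\overline{M}$ have positive sign; similarly for $C(B;f)\setminus g$. An optimal basis of the oriented matroid program $(N,g,f)$ is a basis $B$ of $N$ containing $g$ but not $f$ such that $C^*(B;g)\setminus f$ and $C(B;f)\setminus g$ are positive in $N$. Let $N$ be an oriented matroid on a linearly ordered set $S$ with smallest element $g$. A basis $B$ of $N$ is fully optimal if (a) for every $e\in S\setminus B$, the signs in $C(B;e)$ of $e$ and of $\min(C(B;e))$ are opposite, and (b) for every $b\in B\setminus\{g\}$, the signs in $C^*(B;b)$ of $b$ and of $\min(C^*(B;b))$ are opposite (the minima are taken over supports). It is known (Gioan–Las Vergnas) that if $N$ is bounded with respect to $g$ (acyclic,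 with every positive cocircuit containing $g$), then $N$ has exactly one fully optimal basis. The active bijection, for bounded regions, maps a bounded region to its fully optimal basis. *)

(* Defs.v *)
From HB Require Import structures.
From mathcomp Require Import all_boot all_fingroup.

Set Implicit Arguments.
Unset Strict Implicit.
Unset Printing Implicit Defensive.

Section SignedSets.
Variable T : finType.
Implicit Types (X Y Z : {ffun T -> option bool}) (e x : T) (A : {set T}).

(* A signed subset X of T assigns to each element Some true (positive),     *)
(* Some false (negative) or None (outside the support of X).                *)
Definition signed := {ffun T -> option bool}.

Definition szero : signed := [ffun=> None].
Definition supp X : {set T} := [set x | X x != None].
Definition pos X : {set T} := [set x | X x == Some true].
Definition neg X : {set T} := [set x | X x == Some false].
Definition sopp X : signed := [ffun x => omap negb (X x)].

(* The signed set X \ e. *)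
Definition sdel e X : signed := [ffun x => if x == e then None else X x].

Definition sreorient A X : signed :=
  [ffun x => if x \in A then omap negb (X x) else X x].

Definition srelabel (s : {perm T}) X : signed := [ffun x => X ((s^-1)%g x)].

Definition positive X := neg X == set0.

Definition orth X Y :=
  [exists x, (x \in supp X) && (X x == Y x)] ==
  [exists x, (x \in supp X) && (X x == omap negb (Y x))].

End SignedSets.

Section CircuitAxioms.
Variable T : finType.
Implicit Types (S : {set T}) (C : {set signed T}).

Definition circuit_axioms S C : bool :=
  [&& [forall X in C, supp X \subset S],
      [forall X in C, supp X != set0],
      [forall X in C, sopp X \in C],
      [forall X in C, forall Y in C,
         (supp X \subset supp Y) ==> (X == Y) || (X == sopp Y)]
    & [forall X in C, forall Y in C, forall e,
         [&& X != sopp Y, e \in pos X & e \in neg Y] ==>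
         [exists Z in C, (pos Z \subset (pos X :|: pos Y) :\ e)
                      && (neg Z \subset (neg X :|: neg Y) :\ e)]]].

End CircuitAxioms.

Record omatroid (T : finType) := OMatroid {
  ground : {set T};
  circuits : {set signed T};
  _ : circuit_axioms ground circuits }.

Section CircuitAxiomsTheory.
Variable T : finType.
Implicit Types (X Y Z : signed T) (e x : T) (A : {set T}) (s : {perm T}).

Lemma sopp_suppE X : supp (sopp X) = supp X.
Proof. by apply/setP=> x; rewrite !inE ffunE; case: (X x). Qed.

Lemma soppK : involutive (@sopp T).
Proof.
by move=> X; apply/ffunP=> x; rewrite !ffunE; case: (X x) => //= -[].
Qed.

Lemma circuit_axiomsP (S : {set T}) (C : {set signed T}) :
  reflect
    [/\ forall X, X \in C -> forall x, X x != None -> x \in S,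
        forall X, X \in C -> exists x, X x != None,
        forall X, X \in C -> sopp X \in C,
        forall X Y, X \in C -> Y \in C ->
          (forall x, X x != None -> Y x != None) -> X = Y \/ X = sopp Y
      & forall X Y e, X \in C -> Y \in C -> X <> sopp Y ->
          X e = Some true -> Y e = Some false ->
          exists2 Z, Z \in C & Z e = None /\
            forall x, Z x != None -> Z x = X x \/ Z x = Y x]
    (circuit_axioms S C).
Proof.
apply: (iffP and5P) => -[h1 h2 h3 h4 h5]; split.
- move=> X XC x Xx; have /subsetP := forall_inP h1 X XC.
  by apply; rewrite inE.
- move=> X XC; have /set0Pn [x] := forall_inP h2 X XC.
  by rewrite inE => ?; exists x.
- exact/forall_inP.
- move=> X Y XC YC sXY.
  have /forall_inP/(_ Y YC)/implyP := forall_inP h4 X XC.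
  have -> : supp X \subset supp Y.
    by apply/subsetP=> x; rewrite !inE; apply: sXY.
  by move=> /(_ isT)/orP[/eqP|/eqP]; [left | right].
- move=> X Y e XC YC XY Xe Ye.
  have /forall_inP/(_ Y YC)/forallP/(_ e)/implyP := forall_inP h5 X XC.
  have -> : [&& X != sopp Y, e \in pos X & e \in neg Y].
    by rewrite !inE Xe Ye !eqxx !andbT; apply/eqP.
  move=> /(_ isT)/exists_inP[Z ZC /andP[/subsetP pZ /subsetP nZ]].
  exists Z => //; split.
    case Ze: (Z e) => [[]|] //.
      by have := pZ e; rewrite !inE Ze eqxx => /(_ isT).
    by have := nZ e; rewrite !inE Ze eqxx => /(_ isT).
  move=> x; case Zx: (Z x) => [[]|] // _.
    have := pZ x; rewrite !inE Zx eqxx => /(_ isT)/andP[_ /orP[]] /eqP ->.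
      by left.
    by right.
  have := nZ x; rewrite !inE Zx eqxx => /(_ isT)/andP[_ /orP[]] /eqP ->.
    by left.
  by right.
- apply/forall_inP=> X XC; apply/subsetP=> x; rewrite inE; exact: h1.
- apply/forall_inP=> X XC; have [x Xx] := h2 X XC.
  by apply/set0Pn; exists x; rewrite inE.
- exact/forall_inP.
- apply/forall_inP=> X XC; apply/forall_inP=> Y YC; apply/implyP=> /subsetP sXY.
  have [x Xx|->|->] := h4 X Y XC YC; rewrite ?eqxx ?orbT //.
  by have := sXY x; rewrite !inE; apply.
- apply/forall_inP=> X XC; apply/forall_inP=> Y YC; apply/forallP=> e.
  apply/implyP; rewrite !inE => /and3P[/eqP XY /eqP Xe /eqP Ye].
  have [Z ZC [Ze Zx]] := h5 X Y e XC YC XY Xe Ye.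
  apply/exists_inP; exists Z => //; apply/andP; split; apply/subsetP=> x;
    rewrite !inE => /eqP ZxE; (have [xe|_] := eqVneq x e;
      first by rewrite -xe ZxE in Ze);
    have := Zx x; rewrite ZxE => /(_ isT)[<-|<-]; rewrite eqxx ?orbT //.
Qed.

Lemma omatroid_inj (M N : omatroid T) :
  ground M = ground N -> circuits M = circuits N -> M = N.
Proof.
case: M N => [S C a] [S' C' a'] /= eS eC.
by move: a a'; rewrite eS eC => a a'; rewrite (bool_irrelevance a a').
Qed.

End CircuitAxiomsTheory.

Section Minors.
Variables (T : finType) (N : omatroid T).
Implicit Types (X Y Z : signed T) (e x : T) (A : {set T}) (s : {perm T}).

Definition delete_circuits e : {set signed T} :=
  [set X in circuits N | e \notin supp X].

Lemma delete_axioms e : circuit_axioms (ground N :\ e) (delete_circuits e).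
Proof.
rewrite /delete_circuits; case: N => S C /= /circuit_axiomsP[h1 h2 h3 h4 h5].
set D := [set X in _ | _].
have DP X : X \in D -> X \in C /\ X e = None.
  by rewrite !inE negbK => /andP[? /eqP].
have PD X : X \in C -> X e = None -> X \in D by rewrite !inE => -> ->.
apply/circuit_axiomsP; split.
- move=> X /DP[XC Xe] x Xx; rewrite !inE (h1 X XC x Xx) andbT.
  by apply: contraNneq Xx => ->; rewrite Xe.
- by move=> X /DP[XC _]; apply: h2.
- move=> X /DP[XC Xe]; apply: PD; [exact: h3 | by rewrite ffunE Xe].
- by move=> X Y /DP[XC _] /DP[YC _]; apply: h4.
- move=> X Y a /DP[XC Xe] /DP[YC Ye] XY Xa Ya.
  have [Z ZC [Za Zx]] := h5 X Y a XC YC XY Xa Ya.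
  exists Z => //; apply: PD => //.
  by have := Zx e; rewrite Xe Ye; case: (Z e) => // b /(_ isT)[].
Qed.

Definition delete e : omatroid T := OMatroid (delete_axioms e).

Definition contract_traces e : {set signed T} :=
  [set Y in [set sdel e X | X in circuits N] | supp Y != set0].

(* The traces of nonempty, inclusion-minimal support. *)
Definition contract_circuits e : {set signed T} :=
  [set Y in contract_traces e |
    [forall Z in contract_traces e,
       (supp Z \subset supp Y) ==> (supp Z == supp Y)]].

Lemma contract_axioms e : circuit_axioms (ground N :\ e) (contract_circuits e).
Proof.
rewrite /contract_circuits /contract_traces.
case: N => S C /= /circuit_axiomsP[h1 h2 h3 h4 h5].
set D := [set Y in _ | _].
pose nz X := exists2 x, x != e & X x != None.
pose sub X Y := forall x, x != e -> X x != None -> Y x != None.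
have trP Y : reflect (exists2 X, X \in C & nz X /\ Y = sdel e X)
    (Y \in [set Y in [set sdel e X | X in C] | supp Y != set0]).
  apply: (iffP idP) => [|[X XC [[x xe Xx] ->]]].
    rewrite inE => /andP[/imsetP[X XC ->] /set0Pn[x]].
    rewrite inE ffunE; case: (eqVneq x e) => // xe Xx.
    by exists X => //; split=> //; exists x.
  rewrite inE imset_f //=; apply/set0Pn; exists x.
  by rewrite inE ffunE (negPf xe).
have DP Y : reflect (exists2 X, X \in C & [/\ nz X, Y = sdel e X &
     forall Z, Z \in C -> nz Z -> sub Z X -> sub X Z]) (Y \in D).
  rewrite inE; apply: (iffP andP) => [[/trP[X XC [nX ->]] /forall_inP mX]|].
    exists X => //; split=> // Z ZC nZ sZX x xe Xx.
    have /implyP : (supp (sdel e Z) \subset supp (sdel e X)) ==>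
       (supp (sdel e Z) == supp (sdel e X)).
      by apply: mX; apply/trP; exists Z.
    have -> : supp (sdel e Z) \subset supp (sdel e X).
      apply/subsetP=> y; rewrite !inE !ffunE; case: (eqVneq y e) => // ye.
      exact: sZX.
    move=> /(_ isT)/eqP/setP/(_ x); rewrite !inE !ffunE (negPf xe) Xx.
    by move=> ->.
  case=> X XC [nX -> mX]; split; first by apply/trP; exists X.
  apply/forall_inP=> _ /trP[Z ZC [nZ ->]]; apply/implyP=> /subsetP sZX.
  have sub_ZX : sub Z X.
    move=> x xe Zx; have := sZX x; rewrite !inE !ffunE (negPf xe).
    exact.
  rewrite eqEsubset; apply/andP; split; first exact/subsetP.
  apply/subsetP=> x; rewrite !inE !ffunE; case: (eqVneq x e) => // xe.
  exact: (mX Z).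
have eqC X Y : X \in C -> Y \in C ->
    (forall x, X x != None -> Y x != None) ->
    forall x, Y x != None -> X x != None.
  move=> XC YC sXY x; have [->|->] // := h4 X Y XC YC sXY.
  by rewrite ffunE; case: (Y x).
(* every nonzero trace conformally contains a minimal one *)
have conf Z : Z \in C -> nz Z -> exists2 W, sdel e W \in D &
    forall x, x != e -> W x != None -> W x = Z x.
  move=> ZC nZ.
  have [/forall_inP minZ|] := boolP [forall W in C,
     [exists x, (x != e) && (W x != None)] ==>
     [forall x, (x != e) ==> (W x != None) ==> (Z x != None)] ==>
     [forall x, (x != e) ==> (Z x != None) ==> (W x != None)]].
    exists Z => //; apply/DP; exists Z => //; split=> // W WC [y ye Wy].
    move=> sW x xe Zx.
    move: (minZ W WC).
    have -> /= : [exists x, (x != e) && (W x != None)].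
      by apply/existsP; exists y; rewrite ye.
    have -> /= : [forall x, (x != e) ==> (W x != None) ==> (Z x != None)].
      by apply/forallP=> z; apply/implyP=> ze; apply/implyP; apply: sW.
    by move=> /forallP/(_ x); rewrite xe Zx.
  move=> /forall_inPn[W0 W0C]; rewrite !negb_imply.
  move=> /and3P[/existsP[y0 /andP[y0e W0y0]] /forallP sW0 /forallPn[z0]].
  rewrite !negb_imply => /and3P[z0e Zz0 W0z0].
  have {}sW0 : sub W0 Z by move=> x xe Wx; move: (sW0 x); rewrite xe Wx.
  pose Q W := [/\ W \in C, nz W, sub W Z &
    exists2 z, z != e & Z z != None /\ W z = None].
  have Q0 : Q W0.
    split=> //; first by exists y0.
    by exists z0 => //; split=> //; case/andP: W0z0 => /eqP.
  have Qe W : Q W -> W e != None.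
    case=> WC nW sW [z ze [Zz Wz]]; apply/eqP=> We.
    have /(_ z Zz) : forall x, Z x != None -> W x != None.
      apply: eqC => // x Wx; apply: sW => //.
      by apply: contraNneq Wx => ->; rewrite We.
    by rewrite Wz.
  have Ze : Z e = None.
    apply/eqP/negPn/negP=> Zne; case: Q0 => WC nW sW [z ze [Zz Wz]].
    have /(_ z Zz) : forall x, Z x != None -> W0 x != None.
      apply: eqC => // x Wx; case: (eqVneq x e) => [->//|xe]; exact: sW.
    by rewrite Wz.
  have Qmin W : Q W -> sdel e W \in D.
    move=> QW; have We := Qe W QW; case: QW => WC nW sW [z ze [Zz Wz]].
    apply/DP; exists W => //; split=> // V VC nV sVW x xe Wx.
    have VZ : sub V Z by move=> y ye Vy; apply: sW => //; apply: sVW.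
    apply: (eqC V W) => // y; case: (eqVneq y e) => [->//|ye]; exact: sVW.
  pose dis W := [set x | [&& x != e, W x != None & W x != Z x]].
  have [n le_n] : exists n, #|dis W0| <= n by exists #|dis W0|.
  elim: n W0 Q0 le_n {y0 y0e W0y0 z0 z0e Zz0 W0z0 W0C sW0} => [|n IH] W QW le_n.
    exists W; first exact: Qmin.
    move=> x xe Wx; apply/eqP/negPn/negP=> WZ.
    have /eqP/setP/(_ x) : dis W == set0 by rewrite -cards_eq0 -leqn0.
    by rewrite !inE xe Wx WZ.
  have [/eqP dis0|/set0Pn[a]] := boolP (dis W == set0).
    exists W; first exact: Qmin.
    move=> x xe Wx; apply/eqP/negPn/negP=> WZ.
    by move/setP/(_ x): dis0; rewrite !inE xe Wx WZ.
  rewrite inE => /and3P[ae Wa WZa]; have We := Qe W QW.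
  case: (QW) => WC nW sW [z ze [Zz Wz]].
  have [V VC [Va Vx]] : exists2 V, V \in C & V a = None /\
      forall x, V x != None -> V x = W x \/ V x = Z x.
    have Za := sW a ae Wa.
    case Wa': (W a) Wa WZa => [[]|] // _; case Za': (Z a) Za => [[]|] // _ _.
      apply: (h5 W Z a) => // WZ; move: We.
      by rewrite WZ ffunE Ze.
    have [//|//|ZW|//|//|V VC [Va Vx]] := h5 Z W a.
      by move: We; rewrite -[W]soppK -ZW ffunE Ze.
    by exists V => //; split=> // x /Vx[]; [right|left].
  have sVZ : sub V Z.
    move=> x xe Vxn; have [eV|eV] := Vx x Vxn; move: Vxn; rewrite eV //.
    exact: sW.
  have nV : nz V.
    have [/existsP[x /andP[xe Vxn]]|/existsPn nV] :=
      boolP [exists x, (x != e) && (V x != None)];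
      first by exists x.
    have Ve x : x != e -> V x = None.
      by move=> xe; have := nV x; rewrite xe /= negbK => /eqP.
    have /(_ a Wa) : forall x, W x != None -> V x != None.
      apply: eqC => // x; case: (eqVneq x e) => [->//|xe].
      by rewrite Ve.
    by rewrite Va.
  apply: (IH V).
    by split=> //; exists a => //; split=> //; apply: sW.
  rewrite -ltnS; apply: leq_trans le_n.
  apply: proper_card; apply/properP; split.
    apply/subsetP=> x; rewrite !inE => /and3P[xe Vxn].
    by have [<-|<-] := Vx x Vxn; rewrite ?eqxx // => ->; rewrite xe Vxn.
  by exists a; rewrite !inE ae ?Wa ?Va.
have elim X Y a : X \in C -> Y \in C -> X <> sopp Y -> a != e ->
    X a = Some true -> Y a = Some false -> exists2 Z, Z \in C &
    [/\ nz Z, Z a = None & forall x, Z x != None -> Z x = X x \/ Z x = Y x].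
  move=> XC YC XY ae Xa Ya; have [Z ZC [Za Zx]] := h5 X Y a XC YC XY Xa Ya.
  exists Z => //; split=> //.
  have [/existsP[x /andP[xe Zxn]]|/existsPn nZ] :=
    boolP [exists x, (x != e) && (Z x != None)]; first by exists x.
  have Ze x : Z x != None -> x = e.
    by move=> Zxn; apply/eqP; have := nZ x; rewrite Zxn andbT negbK.
  have noe W : W \in C -> W a != None -> W e = None.
    move=> WC Wa; apply/eqP/negPn/negP=> We.
    have /(_ a Wa) : forall x, W x != None -> Z x != None.
      by apply: eqC => // x /Ze ->.
    by rewrite Za.
  have [x Zxn] := h2 Z ZC; have xe := Ze x Zxn; subst x.
  have := Zx e Zxn; rewrite (noe X) ?Xa // (noe Y) ?Ya //.
  by case=> eZ; rewrite eZ in Zxn.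
apply/circuit_axiomsP; split.
- move=> _ /DP[X XC [_ -> _]] x; rewrite ffunE !inE.
  by case: (eqVneq x e) => //= _; apply: h1.
- by move=> _ /DP[X XC [[x xe Xx] -> _]]; exists x; rewrite ffunE (negPf xe).
- move=> _ /DP[X XC [[y ye Xy] -> mX]]; apply/DP.
  exists (sopp X); first exact: h3.
  split; first by exists y => //; rewrite ffunE; case: (X y) Xy.
    by apply/ffunP=> x; rewrite !ffunE; case: eqP.
  move=> Z ZC nZ sZX x xe; rewrite ffunE => Xx.
  apply: (mX Z ZC nZ) => //; last by case: (X x) Xx.
  by move=> z ze /(sZX z ze); rewrite ffunE; case: (X z).
- move=> _ _ /DP[X XC [nX -> mX]] /DP[Y YC [nY -> mY]] sXY.
  have {}sXY : sub X Y.
    by move=> x xe Xx; have := sXY x; rewrite !ffunE (negPf xe); apply.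
  have sYX := mY X XC nX sXY.
  have [/eqP XY|] := boolP (sdel e X == sdel e Y); first by left.
  have [XY _|/eqP nXY] := eqVneq X (sopp Y).
    by right; rewrite XY; apply/ffunP=> x; rewrite !ffunE; case: eqP.
  have [/forallP XY|/forallPn[a]] :=
      boolP [forall x, (x != e) ==> (X x == Y x)].
    case/eqP; apply/ffunP=> x; rewrite !ffunE.
    by case: (eqVneq x e) (XY x) => //= _ /eqP.
  rewrite negb_imply => /andP[ae XYa] _; exfalso.
  have Z_contra Z : Z \in C -> nz Z -> Z a = None -> X a != None ->
      (forall x, Z x != None -> Z x = X x \/ Z x = Y x) -> False.
    move=> ZC nZ Za Xa Zx; have /(_ a ae Xa) : sub X Z; last by rewrite Za.
    apply: mX => // x xe Zxn.
    have [eZ|eZ] := Zx x Zxn; move: Zxn; rewrite eZ //.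
    exact: sYX.
  have Xn : X a != None.
    apply: contraNneq XYa => Xa; move: (sYX a ae).
    by rewrite Xa; case: (Y a) => // b /(_ isT).
  have Yn := sXY a ae Xn.
  case Xa: (X a) Xn XYa => [[]|] // Xn; case Ya: (Y a) Yn => [[]|] // _ _.
    have [|Z ZC [nZ Za Zx]] := elim X Y a XC YC _ ae Xa Ya; first by [].
    by apply: (Z_contra Z); rewrite ?Xa.
  have [|Z ZC [nZ Za Zx]] := elim Y X a YC XC _ ae Ya Xa.
    by move=> YX; apply: nXY; rewrite YX soppK.
  apply: (Z_contra Z); rewrite ?Xa // => x /Zx[]; by [right|left].
- move=> _ _ a /DP[X XC [_ -> _]] /DP[Y YC [_ -> _]] XY.
  rewrite !ffunE; case: (eqVneq a e) => // ae Xa Ya.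
  have [|Z ZC [nZ Za Zx]] := elim X Y a XC YC _ ae Xa Ya.
    move=> eX; apply: XY; rewrite eX; apply/ffunP=> x; rewrite !ffunE.
    by case: eqP.
  have [W WD Wx] := conf Z ZC nZ; exists (sdel e W) => //; split.
    rewrite ffunE (negPf ae); apply/eqP/negPn/negP=> Wa.
    by move: (Wa); rewrite Wx // Za.
  move=> x; rewrite !ffunE; case: (eqVneq x e) => // xe Wxn.
  by have eW := Wx x xe Wxn; rewrite eW in Wxn *; apply: Zx.
Qed.

Definition contract e : omatroid T := OMatroid (contract_axioms e).

Lemma reorient_axioms A :
  circuit_axioms (ground N) [set sreorient A X | X in circuits N].
Proof.
case: N => S C /= /circuit_axiomsP[h1 h2 h3 h4 h5].
have rN X x : (sreorient A X x != None) = (X x != None).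
  by rewrite ffunE; case: (x \in A); case: (X x).
have rO X : sopp (sreorient A X) = sreorient A (sopp X).
  by apply/ffunP=> x; rewrite !ffunE; case: (x \in A).
apply/circuit_axiomsP; split.
- by move=> _ /imsetP[X XC ->] x; rewrite rN; apply: h1.
- by move=> _ /imsetP[X XC ->]; have [x Xx] := h2 X XC; exists x; rewrite rN.
- by move=> _ /imsetP[X XC ->]; rewrite rO imset_f ?h3.
- move=> _ _ /imsetP[X XC ->] /imsetP[Y YC ->] sXY; rewrite rO.
  have [|->|->] := h4 X Y XC YC; [|by left|by right].
  by move=> x; have := sXY x; rewrite !rN.
- move=> _ _ a /imsetP[X XC ->] /imsetP[Y YC ->] XY Xa Ya.
  have nXY : X <> sopp Y by move=> eX; apply: XY; rewrite rO eX.
  have [Z ZC [Za Zx]] : exists2 Z, Z \in C & Z a = None /\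
      forall x, Z x != None -> Z x = X x \/ Z x = Y x.
    move: Xa Ya; rewrite !ffunE; case: (a \in A) => Xa Ya; last exact: h5 Xa Ya.
    have Xa' : X a = Some false by case: (X a) Xa => [[]|].
    have Ya' : Y a = Some true by case: (Y a) Ya => [[]|].
    have [|Z ZC [Za Zx]] := h5 Y X a YC XC _ Ya' Xa'.
      by move=> eY; apply: nXY; rewrite eY soppK.
    by exists Z => //; split=> // x /Zx[]; [right|left].
  exists (sreorient A Z); first exact: imset_f.
  split; first by rewrite ffunE Za; case: (a \in A).
  by move=> x; rewrite rN !ffunE => /Zx[] ->; [left|right].
Qed.

Definition reorient A : omatroid T := OMatroid (reorient_axioms A).

Lemma relabel_axioms s :
  circuit_axioms (s @: ground N) [set srelabel s X | X in circuits N].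
Proof.
case: N => S C /= /circuit_axiomsP[h1 h2 h3 h4 h5].
have lO X : sopp (srelabel s X) = srelabel s (sopp X).
  by apply/ffunP=> x; rewrite !ffunE.
apply/circuit_axiomsP; split.
- move=> _ /imsetP[X XC ->] x; rewrite ffunE => Xx.
  by apply/imsetP; exists ((s^-1)%g x); [exact: (h1 X XC) | rewrite permKV].
- move=> _ /imsetP[X XC ->]; have [x Xx] := h2 X XC; exists (s x).
  by rewrite ffunE permK.
- by move=> _ /imsetP[X XC ->]; rewrite lO imset_f ?h3.
- move=> _ _ /imsetP[X XC ->] /imsetP[Y YC ->] sXY; rewrite lO.
  have [|->|->] := h4 X Y XC YC; [|by left|by right].
  by move=> x; have := sXY (s x); rewrite !ffunE permK.
- move=> _ _ a /imsetP[X XC ->] /imsetP[Y YC ->] XY; rewrite !ffunE => Xa Ya.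
  have [|Z ZC [Za Zx]] := h5 X Y _ XC YC _ Xa Ya.
    by move=> eX; apply: XY; rewrite lO eX.
  exists (srelabel s Z); first exact: imset_f.
  by rewrite ffunE; split=> // x; rewrite !ffunE; apply: Zx.
Qed.

Definition relabel s : omatroid T := OMatroid (relabel_axioms s).

End Minors.

Section Bases.
Variables (T : finType) (N : omatroid T).
Implicit Types (A B D : {set T}) (b e : T).

Definition independent A :=
  (A \subset ground N) && [forall C in circuits N, ~~ (supp C \subset A)].

Definition basis B := maxset independent B.
Definition bases : {set {set T}} := [set B | basis B].

Definition mclosure A : {set T} :=
  [set e in ground N | (e \in A) ||
     [exists C in circuits N, (e \in supp C) && (supp C \subset e |: A)]].

(* The cocircuits of the underlying matroid: minimal sets meeting every     *)
(* basis.                                                                   *)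
Definition cocircuit_support D :=
  minset [pred A : {set T} | [forall B in bases, A :&: B != set0]] D.

(* The signed cocircuits: the signature of the underlying cocircuits which  *)
(* is orthogonal to all signed circuits.                                    *)
Definition cocircuits : {set signed T} :=
  [set D : signed T | cocircuit_support (supp D) &&
                      [forall C in circuits N, orth C D]].

Definition loop e := [exists C in circuits N, supp C == [set e]].
Definition coloop e := [forall B in bases, e \in B].

Definition acyclic := [forall C in circuits N, ~~ positive C].
Definition totally_cyclic := [forall D in cocircuits, ~~ positive D].

(* C(B; e), for B a basis and e in the ground set outside B.                *)
Definition fcircuit B e : signed T :=
  odflt (szero T)
    [pick C in circuits N | (supp C \subset e |: B) && (C e == Some true)].

(* C^*(B; b), for B a basis and b in B.                                     *)
Definition fcocircuit B b : signed T :=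
  odflt (szero T)
    [pick D in cocircuits | (supp D == ground N :\: mclosure (B :\ b)) &&
                            (D b == Some true)].

End Bases.

Section ExtensionLifting.
Variable T : finType.
Implicit Types (M N Nbar Mbar : omatroid T) (f g : T).

Definition extension N f Nbar : Prop :=
  [/\ f \notin ground N, ground Nbar = f |: ground N & delete Nbar f = N].

Definition generic_extension N f Nbar : Prop :=
  extension N f Nbar /\
  [set supp C | C in circuits Nbar & f \in supp C] =
  [set f |: B | B in bases N].

Definition lifting N g Nbar : Prop :=
  [/\ g \notin ground N, ground Nbar = g |: ground N & contract Nbar g = N].

Definition generic_lifting N g Nbar : Prop :=
  lifting N g Nbar /\
  [set supp D | D in cocircuits Nbar & g \in supp D] =
  [set g |: (ground N :\: B) | B in bases N].

Definition generic_extension_lifting M f g Mbar : Prop :=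
  [/\ [/\ f != g, f \notin ground M & g \notin ground M],
      ground Mbar = f |: (g |: ground M) /\ delete (contract Mbar g) f = M,
      generic_extension (delete Mbar f) f Mbar,
      generic_lifting (contract Mbar g) g Mbar
    & [/\ ~~ loop Mbar f, ~~ coloop Mbar f, ~~ loop Mbar g
        & ~~ coloop Mbar g]].

Definition compliant Mbar f g :=
  [forall D in cocircuits Mbar, ~~ ((D g == Some true) && (D f == Some false))].

End ExtensionLifting.

Section Regions.
Variable T : finType.
Implicit Types (N Mbar : omatroid T) (f g e b : T) (A B : {set T}).

(* Reorientations are indexed by the subset A of reoriented elements.       *)
Definition bounded_regions Mbar f g : {set {set T}} :=
  [set A : {set T} | [&& A \subset ground Mbar, f \notin A, g \notin A,
      acyclic (delete (reorient Mbar A) f)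
    & totally_cyclic (contract (reorient Mbar A) g)]].

Definition bases_with_without Mbar g f : {set {set T}} :=
  [set B in bases Mbar | (g \in B) && (f \notin B)].

Definition associated Mbar f g A B :=
  positive (sdel f (fcocircuit (reorient Mbar A) B g)) &&
  positive (sdel g (fcircuit (reorient Mbar A) B f)).

Definition region_basis Mbar f g A : {set T} :=
  odflt set0
    [pick B in bases_with_without Mbar g f | associated Mbar f g A B].

Definition optimal_basis N g f B :=
  [&& basis N B, g \in B, f \notin B,
      positive (sdel f (fcocircuit N B g))
    & positive (sdel g (fcircuit N B f))].

Definition linear_order_on (S : {set T}) (r : rel T) : Prop :=
  [/\ {in S, reflexive r}, {in S &, antisymmetric r},
      {in S & &, transitive r} & {in S &, total r}].

(* The r-minimum of the support of X, for x0 in this support.               *)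
Definition min_supp (r : rel T) (x0 : T) (X : signed T) : T :=
  extremum r x0 [pred x in supp X] id.

Definition opposite_signs (X : signed T) x y :=
  (X x != None) && (X y == omap negb (X x)).

Definition fully_optimal (r : rel T) g N B :=
  [&& basis N B,
      [forall e in ground N :\: B,
         let C := fcircuit N B e in opposite_signs C e (min_supp r e C)]
    & [forall b in B :\ g,
         let D := fcocircuit N B b in opposite_signs D b (min_supp r b D)]].

Definition bounded N g :=
  acyclic N && [forall D in cocircuits N, positive D ==> (g \in supp D)].

(* The value of the active bijection at a region bounded with respect to g. *)
Definition active_basis (r : rel T) g N : {set T} :=
  odflt set0 [pick B | fully_optimal r g N B].

(* Mbar' replaces f by f' in Mbar and is compliant.                         *)
Definition compliant_replacement M Mbar f g f' Mbar' : Prop :=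
  [/\ generic_extension_lifting M f' g Mbar', compliant Mbar' f' g,
      delete Mbar' f' = delete Mbar f
    & contract Mbar' g = relabel (contract Mbar g) (tperm f f')].

End Regions.

(* Main.v *)
Require Import Defs.
From mathcomp Require Import all_boot all_fingroup.

Set Implicit Arguments.
Unset Strict Implicit.
Unset Printing Implicit Defensive.

(** The statement is linear programming duality for an oriented matroid
    program all of whose vertices are nondegenerate, together with a
    perturbation of the objective f.

    Genericity enters as two conditions on supports, [generic_point] and
    [generic_copoint]: C(B;f) covers all of B, and C*(B;g) covers everything
    outside B. A basis B containing g but not f thus prescribes a nonzero
    sign at every element of M, and being associated with A means that A is
    the set of elements with a negative prescribed sign ([associatedP]). This
    gives exactly one A for each B, and orthogonality shows that the
    reorientation is a bounded region ([optimal_bounded]).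

    Conversely a bounded region has an optimal basis. [lp_duality] proves it
    by induction: an element is deleted or contracted, and the certificate
    that one of these operations destroys boundedness fixes the sign of the
    element in the solution after the other operation. The basis is unique
    because eliminating f between the circuits of two optimal bases gives a
    circuit that cannot be orthogonal to both of their cocircuits
    ([optimal_unique]). Parts (1) and (2) follow.

    For an order starting with g, f, genericity identifies the minima in the
    definition of full optimality, which becomes optimality plus positivity
    of C*(B;g) at f ([fully_optimalP]); compliance gives this last sign.

    When compliance fails, f is replaced by f' = g + epsilon f with epsilon
    infinitesimal, the lexicographic extension: the sign of a cocircuit at f'
    is its sign at g unless that is zero, so the result is compliant. Its
    circuits are explicit ([lex_circuit]); circuit elimination follows from
    orthogonality by a colouring argument ([painting_elim]), once points and
    flats are separated by circuits or covectors ([lex_dichotomy]). The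
    prescribed signs depend only on the deletion of the extension point and
    on the contraction of g, which are unchanged, so any compliant
    replacement has the same regions and the same bijection
    ([replacement_sign]).

    All this rests on the existence of signed cocircuits, which are not part
    of the circuit axioms: they come from [covector_exists], where
    contracting down to rank one is justified by [contract_conformal]. *)

(** * Circuits and contraction *)

Section Circuits.
Variable T : finType.
Implicit Types (N : omatroid T) (X Y Z V W D : signed T) (a b e x y : T).

Lemma in_supp X x : (x \in supp X) = (X x != None).
Proof. by rewrite inE. Qed.

Lemma negbK_omap (u : option bool) : omap negb (omap negb u) = u.
Proof. by case: u => [[]|]. Qed.

Lemma circuit_ground N X x : X \in circuits N -> X x != None -> x \in ground N.
Proof. by case: N => S C /= /circuit_axiomsP[h _ _ _ _] XC; apply: h. Qed.

Lemma circuit_neq0 N X : X \in circuits N -> exists x, X x != None.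
Proof. by case: N => S C /= /circuit_axiomsP[_ h _ _ _]; apply: h. Qed.

Lemma circuit_sopp N X : X \in circuits N -> sopp X \in circuits N.
Proof. by case: N => S C /= /circuit_axiomsP[_ _ h _ _]; apply: h. Qed.

Lemma circuit_min N X Y : X \in circuits N -> Y \in circuits N ->
  (forall x, X x != None -> Y x != None) -> X = Y \/ X = sopp Y.
Proof. by case: N => S C /= /circuit_axiomsP[_ _ _ h _]; apply: h. Qed.

Lemma circuit_min_supp N X Y : X \in circuits N -> Y \in circuits N ->
  (forall x, X x != None -> Y x != None) ->
  forall x, Y x != None -> X x != None.
Proof.
move=> XC YC sXY x; have [->|->] // := circuit_min XC YC sXY.
by rewrite ffunE; case: (Y x).
Qed.

Lemma circuit_eq N X Y x : X \in circuits N -> Y \in circuits N ->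
  (forall y, X y != None -> Y y != None) ->
  X x != None -> X x = Y x -> X = Y.
Proof.
move=> XC YC sXY nX; have [//|XE] := circuit_min XC YC sXY.
by move: nX; rewrite XE ffunE; case: (Y x) => [[]|].
Qed.

Lemma circuit_elim N X Y e : X \in circuits N -> Y \in circuits N ->
  X <> sopp Y -> X e != None -> Y e = omap negb (X e) ->
  exists2 Z, Z \in circuits N &
    Z e = None /\ forall x, Z x != None -> Z x = X x \/ Z x = Y x.
Proof.
case: N => S C /= /circuit_axiomsP[_ _ _ _ h] XC YC XY.
case Xe: (X e) => [[]|] //= _ Ye; first exact: h Xe Ye.
have [|Z ZC [Ze Zx]] := h Y X e YC XC _ Ye Xe.
  by move=> YX; apply: XY; rewrite YX soppK.
by exists Z => //; split=> // x /Zx[]; [right|left].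
Qed.

(** The form in which a contraction is used throughout: its circuits are
    traces of circuits of N, and minimality is tested against circuits of N. *)
Lemma contract_circuitP N e Y :
  reflect (exists2 X, X \in circuits N &
     [/\ exists2 x, x != e & X x != None, Y = sdel e X &
         forall Z, Z \in circuits N -> (exists2 x, x != e & Z x != None) ->
          (forall x, x != e -> Z x != None -> X x != None) ->
          forall x, x != e -> X x != None -> Z x != None])
  (Y \in circuits (contract N e)).
Proof.
have trP W : reflect (exists2 X, X \in circuits N &
     (exists2 x, x != e & X x != None) /\ W = sdel e X)
    (W \in contract_traces N e).
  rewrite /contract_traces; apply: (iffP idP) => [|[X XC [[x xe Xx] ->]]].
    rewrite inE => /andP[/imsetP[X XC ->] /set0Pn[x]].
    rewrite inE ffunE; case: (eqVneq x e) => // xe Xx.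
    by exists X => //; split=> //; exists x.
  rewrite inE imset_f //=; apply/set0Pn; exists x.
  by rewrite inE ffunE (negPf xe).
have sub_sdel X Z : reflect (forall x, x != e -> Z x != None -> X x != None)
    (supp (sdel e Z) \subset supp (sdel e X)).
  apply: (iffP subsetP) => h x.
    by move=> xe; have := h x; rewrite !inE !ffunE (negPf xe).
  by rewrite !inE !ffunE; case: (eqVneq x e) => // xe; apply: h.
rewrite inE; apply: (iffP andP) => [[/trP[X XC [nX ->]] /forall_inP mX]|].
  exists X => //; split=> // Z ZC nZ /sub_sdel sZX.
  have /implyP/(_ sZX)/eqP eZX := mX (sdel e Z) (introT (trP _)
    (ex_intro2 _ _ Z ZC (conj nZ erefl))).
  by apply/sub_sdel; rewrite eZX.
case=> X XC [nX -> mX]; split; first by apply/trP; exists X.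
apply/forall_inP=> _ /trP[Z ZC [nZ ->]]; apply/implyP=> sZX.
rewrite eqEsubset sZX; apply/sub_sdel; apply: mX => //; exact/sub_sdel.
Qed.

Lemma contract_mem N e X : X \in circuits N -> X e != None ->
  (exists2 x, x != e & X x != None) -> sdel e X \in circuits (contract N e).
Proof.
move=> XC Xe nX; apply/contract_circuitP; exists X => //; split=> //.
move=> Z ZC nZ sZX x xe; apply: (circuit_min_supp ZC XC) => // y.
by case: (eqVneq y e) => [->|/sZX]; [rewrite Xe|apply].
Qed.

(** A circuit X avoiding e may split in N / e. Then there is a circuit V
    through e and a inside X + e, and eliminations between V and X remove the
    elements at which their signs differ. The element a is never lost: if V'
    lost it, eliminating e between V and V' would give a circuit inside X,
    hence X itself, with a wrong sign. *)
Lemma contract_conformal N e X a : X \in circuits N -> a != e ->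
  X a != None -> exists2 V, V \in circuits N &
    [/\ sdel e V \in circuits (contract N e), V a != None &
        forall x, x != e -> V x != None -> V x = X x].
Proof.
move=> XC ae Xa.
have [Xe|/negPn/eqP Xe] := boolP (X e != None).
  by exists X => //; split=> //; apply: contract_mem => //; exists a.
have [/exists_inP[W WC /and3P[We /existsP[w /andP[we Ww]] /forallP sWX]]|nW] :=
  boolP [exists W in circuits N, [&& W e != None,
    [exists x, (x != e) && (W x != None)] &
    [forall x, (x != e) ==> (W x != None) ==> (X x != None)]]]; last first.
  exists X => //; split=> //; apply/contract_circuitP; exists X => //.
  split=> [|//|Z ZC [z ze Zz] sZX x xe]; first by exists a.
  apply: (circuit_min_supp ZC XC) => // y; case: (eqVneq y e) => [->|/sZX] //.
  move=> Ze; case/negP: nW; apply/exists_inP; exists Z => //; apply/and3P.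
  split=> //; first by apply/existsP; exists z; rewrite ze.
  by apply/forallP=> x'; apply/implyP => x'e; apply/implyP/sZX.
have {}sWX x : x != e -> W x != None -> X x != None.
  by move=> xe Wx; move: (sWX x); rewrite xe Wx.
(* A circuit contained in X + e that does not contain e is X up to sign. *)
have inX Z z : Z \in circuits N -> Z z = None -> X z != None ->
    (forall x, x != e -> Z x != None -> X x != None) -> Z e != None.
  move=> ZC Zz Xz sZ; apply/negP=> /eqP Ze.
  have /(_ z Xz) : forall x, X x != None -> Z x != None.
    apply: (circuit_min_supp ZC XC) => // x; case: (eqVneq x e) => [->|/sZ//].
    by rewrite Ze.
  by rewrite Zz.
have [V [VC Ve Va sV]] : exists V, [/\ V \in circuits N, V e != None,
    V a = X a & forall x, x != e -> V x != None -> X x != None].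
  suff [V [VC Ve Va sV]] : exists V, [/\ V \in circuits N, V e != None,
      V a != None & forall x, x != e -> V x != None -> X x != None].
    have [eVa|nVa] := eqVneq (V a) (X a); first by exists V.
    exists (sopp V); split; rewrite ?ffunE ?circuit_sopp //.
    - by case: (V e) Ve.
    - by move: Va Xa nVa; case: (V a) => [[]|]; case: (X a) => [[]|].
    - by move=> x xe; rewrite ffunE => Vx; apply: sV; case: (V x) Vx.
  have [Wa|/negPn/eqP Wa] := boolP (W a != None); first by exists W.
  have Xw := sWX w we Ww.
  have [W' [W'C W'e W'a W'w sW']] : exists W', [/\ W' \in circuits N,
      W' e != None, W' a = None, W' w = omap negb (X w) &
      forall x, x != e -> W' x != None -> X x != None].
    have [eWw|nWw] := eqVneq (W w) (omap negb (X w)); first by exists W.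
    exists (sopp W); split; rewrite ?ffunE ?circuit_sopp // ?Wa //.
    - by case: (W e) We.
    - by move: Ww Xw nWw; case: (W w) => [[]|]; case: (X w) => [[]|].
    - by move=> x xe; rewrite ffunE => Wx; apply: sWX; case: (W x) Wx.
  (* W misses a: eliminating w between X and W' gives a circuit through a,
     since otherwise e could be eliminated within X minus a. *)
  have [|V VC [Vw Vx]] := circuit_elim XC W'C _ Xw W'w.
    by move=> XW; move: Xa; rewrite XW ffunE W'a.
  have sV x : x != e -> V x != None -> X x != None.
    by move=> xe nV; have [eV|eV] := Vx x nV; move: nV; rewrite eV //; apply: sW'.
  have Ve := inX V w VC Vw Xw sV.
  exists V; split=> //; apply/negP=> /eqP Va.
  have eVW : V e = W' e by have [|//] := Vx e Ve; move: Ve => /[swap] ->; rewrite Xe.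
  have [||||Z ZC [Ze Zx]] := @circuit_elim N V (sopp W') e VC.
  - exact: circuit_sopp.
  - rewrite soppK => VW; move: Xw; rewrite -[X w]negbK_omap -W'w -VW Vw //.
  - by [].
  - by rewrite ffunE eVW.
  have : Z e != None; last by rewrite Ze.
  apply: (inX Z a) => //.
    apply/eqP/negPn/negP=> Za; have := Zx a Za; rewrite ffunE Va W'a.
    by case=> E; rewrite E in Za.
  move=> x xe nZ; have [eZ|eZ] := Zx x nZ; move: nZ; rewrite eZ; first exact: sV.
  by rewrite ffunE => h; apply: sW' => //; case: (W' x) h.
(* The elements at which V is not yet conformal to X. *)
pose dis V := [set x | [&& x != e, V x != None & V x != X x]].
have [n le_n] : exists n, #|dis V| <= n by exists #|dis V|.
elim: n V VC Ve Va sV le_n => [|n IH] V VC Ve Va sV le_n;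
  have [/eqP dis0|/set0Pn[z]] := boolP (dis V == set0);
  try (exists V => //; split; rewrite ?Va //;
    [ by apply: contract_mem => //; exists a; rewrite ?Va
    | by move=> x xe nV; apply/eqP/negPn/negP=> nVX;
         move/setP/(_ x): dis0; rewrite !inE xe nV nVX]).
  by move: le_n; rewrite leqn0 cards_eq0 => /eqP ->; rewrite inE.
rewrite inE => /and3P[ze Vz nVX]; have Xz := sV z ze Vz.
have XVz : X z = omap negb (V z).
  by move: Vz Xz nVX; case: (V z) => [[]|]; case: (X z) => [[]|].
have [|V' V'C [V'z V'x]] := circuit_elim VC XC _ Vz XVz.
  by move=> VX; move: Ve; rewrite VX ffunE Xe.
have sV' x : x != e -> V' x != None -> X x != None.
  by move=> xe nV; have [eV|eV] := V'x x nV; move: nV; rewrite eV //; apply: sV.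
have V'e := inX V' z V'C V'z Xz sV'.
have eV'e : V' e = V e by have [//|] := V'x e V'e; move: V'e => /[swap] ->; rewrite Xe.
have V'a : V' a = X a.
  have [//|nE] := eqVneq (V' a) (X a); exfalso.
  have V'a : V' a = None.
    by apply/eqP/negPn/negP=> h; case/eqP: nE; have [->|->] := V'x a h.
  have [||||Z ZC [Ze Zx]] := @circuit_elim N V (sopp V') e VC.
  - exact: circuit_sopp.
  - by rewrite soppK => VV'; move: Xa; rewrite -Va VV' V'a.
  - by [].
  - by rewrite ffunE eV'e.
  have ZX x : Z x != None -> X x != None.
    case: (eqVneq x e) => [->|xe nZ]; first by rewrite Ze.
    have [eZ|eZ] := Zx x nZ; move: nZ; rewrite eZ; first exact: sV.
    by rewrite ffunE => h; apply: sV' => //; case: (V' x) h.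
  have nZ x : X x != None -> Z x != None by apply: (circuit_min_supp ZC XC).
  have eZX : Z = X.
    apply: (@circuit_eq N _ _ a) => //; first exact: nZ.
    by rewrite -Va; have [//|] := Zx a (nZ a Xa); rewrite ffunE V'a => E;
      have := nZ a Xa; rewrite E.
  have := Zx z (nZ z Xz); rewrite ffunE V'z /= eZX => -[] E.
    by case/eqP: nVX.
  by rewrite E in Xz.
apply: (IH V') => //; rewrite -ltnS; apply: leq_trans le_n.
apply: proper_card; apply/properP; split.
  apply/subsetP=> x; rewrite !inE => /and3P[-> nV nE] /=.
  by have [E|E] := V'x x nV; rewrite E ?eqxx // in nV nE *; rewrite nV nE.
by exists z; rewrite !inE ze ?Vz ?nVX // V'z.
Qed.

End Circuits.

(** * Orthogonality and the existence of covectors *)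

Section Covectors.
Variable T : finType.
Implicit Types (N : omatroid T) (X Y Z V W D : signed T) (a b e x y : T).
Implicit Types (B K : {set T}).

Lemma orth_at X Y x : orth X Y -> X x != None -> Y x != None ->
  exists y, [/\ y != x, X y != None, Y y != None &
                (X y == Y y) = (X x != Y x)].
Proof.
move=> /eqP oXY Xx Yx; have [eXY|nXY] := eqVneq (X x) (Y x).
  have : [exists x, (x \in supp X) && (X x == Y x)].
    by apply/existsP; exists x; rewrite in_supp Xx eXY eqxx.
  rewrite oXY => /existsP[y]; rewrite in_supp => /andP[Xy /eqP XYy].
  exists y; split=> //.
  - apply: contraTneq Yx => eyx; move: XYy; rewrite eyx eXY.
    by case: (Y x) => [[]|].
  - by move: Xy; rewrite XYy; case: (Y y).
  - by move: Xy; rewrite XYy; case: (Y y) => [[]|].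
have : [exists x, (x \in supp X) && (X x == omap negb (Y x))].
  apply/existsP; exists x; rewrite in_supp Xx /=.
  by move: Xx Yx nXY; case: (X x) => [[]|]; case: (Y x) => [[]|].
rewrite -oXY => /existsP[y]; rewrite in_supp => /andP[Xy /eqP XYy].
exists y; rewrite -XYy eqxx; split=> //.
by apply: contraNneq nXY => <-; rewrite XYy.
Qed.

Lemma orth_disjoint X Y : orth X Y ->
  (forall x, X x != None -> Y x != None -> X x = Y x) ->
  forall x, X x != None -> Y x = None.
Proof.
move=> oXY sXY x Xx; apply/eqP/negPn/negP=> Yx.
have [y [_ Xy Yy]] := orth_at oXY Xx Yx.
by rewrite (sXY y) // (sXY x) // !eqxx.
Qed.

Lemma orth_disjointN X Y : orth X Y ->
  (forall x, X x != None -> Y x != None -> X x <> Y x) ->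
  forall x, X x != None -> Y x = None.
Proof.
move=> oXY sXY x Xx; apply/eqP/negPn/negP=> Yx.
have [y [_ Xy Yy]] := orth_at oXY Xx Yx.
have nE : X x != Y x by apply/eqP; apply: sXY.
by rewrite nE => /eqP; apply: sXY.
Qed.

Lemma orth_two X Y x y : orth X Y -> X x != None -> Y x != None ->
  (forall z, X z != None -> Y z != None -> z = x \/ z = y) ->
  [/\ X y != None, Y y != None & (X y == Y y) = (X x != Y x)].
Proof.
move=> oXY Xx Yx h; have [z [zx Xz Yz E]] := orth_at oXY Xx Yx.
by have [ezx|ezy] := h z Xz Yz; [rewrite ezx eqxx in zx | rewrite -ezy].
Qed.

Lemma orth_one X Y x : orth X Y -> X x != None ->
  (forall z, X z != None -> Y z != None -> z = x) -> Y x = None.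
Proof.
move=> oXY Xx h; apply/eqP/negPn/negP=> Yx.
have [z [zx Xz Yz _]] := orth_at oXY Xx Yx.
by rewrite (h z) // eqxx in zx.
Qed.

(** The composites of cocircuits, in the form in which they are built and
    used, entry by entry. Entries outside the ground set are arbitrary. *)
Definition covector N D := [forall C in circuits N, orth C D].

Lemma covector_orth N D C : covector N D -> C \in circuits N -> orth C D.
Proof. by move=> /forall_inP; apply. Qed.

Lemma orthI X Y :
  (forall x, X x != None -> X x = Y x ->
     exists2 y, X y != None & X y = omap negb (Y y)) ->
  (forall x, X x != None -> X x = omap negb (Y x) ->
     exists2 y, X y != None & X y = Y y) ->
  orth X Y.
Proof.
move=> h1 h2; rewrite /orth; apply/eqP; apply/idP/idP => /existsP[x];
  rewrite in_supp => /andP[Xx /eqP XYx]; apply/existsP.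
  by have [y Xy E] := h1 x Xx XYx; exists y; rewrite in_supp Xy E eqxx.
by have [y Xy E] := h2 x Xx XYx; exists y; rewrite in_supp Xy E eqxx.
Qed.

Lemma covectorI N D :
  (forall X x, X \in circuits N -> X x != None -> X x = D x ->
     exists2 y, X y != None & X y = omap negb (D y)) ->
  covector N D.
Proof.
move=> h; apply/forall_inP=> X XC; apply: orthI => x Xx XDx; first exact: h XDx.
have [|||y] := h (sopp X) x; rewrite ?circuit_sopp ?ffunE //.
- by case: (X x) Xx.
- by rewrite XDx negbK_omap.
move=> Xy E; exists y; first by case: (X y) Xy.
by rewrite -[X y]negbK_omap E negbK_omap.
Qed.

Lemma covector_sopp N D : covector N D -> covector N (sopp D).
Proof.
move=> cD; apply: covectorI => X x XC Xx; rewrite ffunE => XDx.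
have Dx : D x != None by move: Xx; rewrite XDx; case: (D x).
have [y [_ Xy Dy E]] := orth_at (covector_orth cD XC) Xx Dx.
exists y => //; rewrite ffunE negbK_omap; apply/eqP; rewrite E XDx.
by case: (D x) Dx => [[]|].
Qed.

(** A circuit of N violating orthogonality at a point contains a circuit of
    the contraction that violates it at the same point, by
    [contract_conformal]. *)
Lemma covector_contract N e D : D e = None ->
  covector (contract N e) D = covector N D.
Proof.
move=> De; apply/idP/idP=> cD; last first.
  apply: covectorI => _ x /contract_circuitP[X XC [_ -> _]].
  rewrite ffunE; have [->//|xe Xx XDx] := eqVneq x e.
  have Dx : D x != None by rewrite -XDx.
  have [y [_ Xy Dy E]] := orth_at (covector_orth cD XC) Xx Dx.
  have ye : y != e by apply: contraNneq Dy => ->; rewrite De.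
  exists y; rewrite ffunE (negPf ye) //.
  by move: Xy Dy E; rewrite XDx eqxx; case: (X y) => [[]|]; case: (D y) => [[]|].
apply: covectorI => X x XC Xx XDx.
have xe : x != e by apply: contraNneq Xx => xe; rewrite XDx xe De.
have [V VC [VN Vx cV]] := contract_conformal XC xe Xx.
have Dx : D x != None by rewrite -XDx.
have [|y [_ Vy Dy E]] := orth_at (x := x) (covector_orth cD VN) _ Dx.
  by rewrite ffunE (negPf xe).
have ye : y != e by apply: contraNneq Dy => ->; rewrite De.
move: Vy E; rewrite !ffunE (negPf xe) (negPf ye) => Vy.
rewrite (cV x xe Vx) (cV y ye Vy) XDx eqxx => nE.
have VXy := cV y ye Vy; exists y; first by rewrite -VXy.
move: Vy Dy nE; rewrite VXy.
by case: (X y) => [[]|]; case: (D y) => [[]|].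
Qed.

(** Rank one: every nonloop is parallel to a, and the sign of D at e is
    dictated by a two-element circuit on a and e. *)
Lemma covector_parallel N a :
  (forall C, C \in circuits N -> C a != None ->
     exists2 x, x != a & C x != None) ->
  (forall e, e \in ground N -> e != a -> exists C, [/\ C \in circuits N,
     C a = Some true, C e != None & forall x, C x != None -> x = a \/ x = e]) ->
  exists D, [/\ covector N D, D a = Some true &
                forall x, x \notin ground N -> x != a -> D x = None].
Proof.
move=> nla hpar.
pose par e := [pick C in circuits N | [&& C a == Some true, C e != None &
   [forall x, (C x != None) ==> ((x == a) || (x == e))]]].
have parP e : e \in ground N -> e != a -> exists2 C, par e = Some C &
    [/\ C \in circuits N, C a = Some true, C e != None & forall x, C x != None ->
      x = a \/ x = e].
  move=> eN ea; rewrite /par; case: pickP => [C|].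
    move=> /and4P[CC /eqP Ca Ce /forallP hC]; exists C => //; split=> // x Cx.
    by move: (hC x); rewrite Cx /= => /orP[] /eqP ->; [left|right].
  have [C [CC Ca Ce Cx]] := hpar e eN ea.
  move/(_ C)/negP; case; rewrite CC Ca Ce eqxx /=.
  by apply/forallP=> x; apply/implyP=> /Cx[] ->; rewrite eqxx ?orbT.
pose D : signed T := [ffun x => if x == a then Some true else
  if x \in ground N then if par x is Some C then omap negb (C x) else None
  else None].
exists D; split; last 2 first.
- by rewrite ffunE eqxx.
- by move=> x xN xa; rewrite ffunE (negPf xa) (negPf xN).
have DE e C : e \in ground N -> e != a -> par e = Some C ->
    D e = omap negb (C e).
  by move=> eN ea pe; rewrite ffunE (negPf ea) eN pe.
have Da : D a = Some true by rewrite ffunE eqxx.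
apply: covectorI => X x XC Xx XDx; have xN := circuit_ground XC Xx.
(* A circuit through a is one of the chosen two-element circuits. *)
have thru Z y : Z \in circuits N -> Z a != None -> Z y != None -> y != a ->
    exists C, [/\ C \in circuits N, D y = omap negb (C y), C y != None,
      C a = Some true & Z = C \/ Z = sopp C].
  move=> ZC Za Zy ya; have yN := circuit_ground ZC Zy.
  have [C pC [CC Ca Cy Cz]] := parP y yN ya.
  exists C; split=> //; first exact: DE.
  have [z /Cz[->|->] //|->|->] := circuit_min CC ZC; first by left.
  by right; rewrite soppK.
have [eXa|xa] := eqVneq x a.
  subst x; have [y ya Xy] := nla X XC Xx.
  have [C [CC Dy Cy Ca [XE|XE]]] := thru X y XC Xx Xy ya.
    by exists y; rewrite ?Dy ?negbK_omap ?XE.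
  by move: XDx; rewrite Da XE ffunE Ca.
have [Xa|/negPn/eqP Xa] := boolP (X a != None).
  have [C [CC Dx Cx Ca [XE|XE]]] := thru X x XC Xa Xx xa.
    by move: XDx Cx; rewrite Dx XE; case: (C x) => [[]|].
  by exists a => //; rewrite Da XE ffunE Ca.
have [C pC [CC Ca Cx Cz]] := parP x xN xa.
have XCx : C x = omap negb (X x) by rewrite XDx (DE x C) // negbK_omap.
have [|Z ZC [Zx Zz]] := circuit_elim XC CC _ Xx XCx.
  by move=> XE; move: Ca; rewrite -[C]soppK -XE ffunE Xa.
have Za : Z a != None.
  apply/negP=> /eqP Za; have /(_ x Xx) : forall y, X y != None -> Z y != None.
    apply: (circuit_min_supp ZC XC) => y Zy; have [eZ|eZ] := Zz y Zy.
      by rewrite -eZ.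
    have Cy : C y != None by rewrite -eZ.
    by have [ey|-> //] := Cz y Cy; rewrite ey Za in Zy.
  by rewrite Zx.
have [y ya Zy] := nla Z ZC Za.
have yx : y != x by apply: contraNneq Zy => ->; rewrite Zx.
have XZy : Z y = X y.
  have [//|eZ] := Zz y Zy; have [|ey|ey] := Cz y; first by rewrite -eZ.
    by rewrite ey eqxx in ya.
  by rewrite ey eqxx in yx.
have [C' [C'C Dy C'y C'a [ZE|ZE]]] := thru Z y ZC Za Zy ya; exists y;
  rewrite -XZy ?Dy ?negbK_omap ?ZE //.
  by rewrite -ZE.
have := Zz a Za; rewrite Xa Ca ZE ffunE C'a => -[] //.
Qed.

(** The signed form of the separation of a point a from a flat. Elements are
    contracted as long as a stays outside the span of K; this disposes of K,
    and what remains has rank one. A covector of a contraction, set to zero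
    at the contracted element, is a covector of N. *)
Lemma covector_exists N K a :
  (forall C, C \in circuits N -> C a != None ->
     exists x, [/\ x != a, x \notin K & C x != None]) ->
  exists D, [/\ covector N D, D a = Some true &
                forall x, x \in K -> x != a -> D x = None].
Proof.
have [n le_n] : exists n, #|ground N| <= n by exists #|ground N|.
elim: n N K le_n => [|n IH] N K le_n hK;
  have [/exists_inP[e eN /andP[ea /forall_inP he]]|nex] := boolP [exists e in
    ground N, (e != a) && [forall C in circuits N, (C a != None) ==>
     [exists x, [&& x != a, x != e, x \notin K & C x != None]]]].
- by move: le_n; rewrite leqn0 cards_eq0 => /eqP gN; rewrite gN inE in eN.
- have [||D [cD Da DN]] := @covector_parallel N a.
  + by move=> C CC Ca; have [x [xa _ Cx]] := hK C CC Ca; exists x.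
  + by move=> e; move: le_n; rewrite leqn0 cards_eq0 => /eqP ->; rewrite inE.
  exists D; split=> // x xK xa; apply: DN => //.
  by move: le_n; rewrite leqn0 cards_eq0 => /eqP ->; rewrite inE.
- have [||D [cD Da DK]] := IH (contract N e) K.
  + by rewrite /= -ltnS; apply: leq_trans le_n; rewrite [in leqRHS](cardsD1 e) eN.
  + move=> _ /contract_circuitP[X XC [_ -> _]].
    rewrite ffunE [a == e]eq_sym (negPf ea) => Xa.
    have /implyP/(_ Xa)/existsP[x /and4P[xa xe xK Xx]] := he X XC.
    by exists x; rewrite xa xK ffunE (negPf xe).
  exists (sdel e D); split; last 2 first.
  + by rewrite ffunE [a == e]eq_sym (negPf ea).
  + by move=> x xK xa; rewrite ffunE; case: eqP => // _; apply: DK.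
  rewrite -(@covector_contract N e) ?ffunE ?eqxx //.
  apply: covectorI => Y x YC Yx YDx.
  have Ye : Y e = None.
    by case/contract_circuitP: YC => X _ [_ -> _]; rewrite ffunE eqxx.
  have xe : x != e by apply: contraNneq Yx => ->; rewrite Ye.
  move: YDx; rewrite ffunE (negPf xe) => YDx.
  have Dx : D x != None by rewrite -YDx.
  have [y [_ Yy Dy E]] := orth_at (covector_orth cD YC) Yx Dx.
  have ye : y != e by apply: contraNneq Yy => ->; rewrite Ye.
  exists y => //; rewrite ffunE (negPf ye).
  by move: Yy Dy E; rewrite YDx eqxx; case: (Y y) => [[]|]; case: (D y) => [[]|].
have nexe e : e \in ground N -> e != a -> exists C, [/\ C \in circuits N,
    C a = Some true & forall x, C x != None -> [\/ x = a, x = e | x \in K]].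
  move=> eN ea; move/exists_inPn/(_ e eN): nex; rewrite ea /=.
  case/forall_inPn=> C CC; rewrite negb_imply => /andP[Ca /existsPn hC].
  have hC' x : C x != None -> [\/ x = a, x = e | x \in K].
    move=> Cx; move: (hC x); rewrite Cx andbT !negb_and !negbK => /or3P[/eqP|/eqP|].
    - by constructor 1.
    - by constructor 2.
    - by constructor 3.
  case Ca': (C a) Ca => [[]|] // _; first by exists C.
  exists (sopp C); rewrite circuit_sopp // ffunE Ca'; split=> // x.
  by rewrite ffunE => Cx; apply: hC'; case: (C x) Cx.
have KN x : x \in K -> x != a -> x \notin ground N.
  move=> xK xa; apply/negP=> xN; have [C [CC Ca hC]] := nexe x xN xa.
  have [|y [ya yK Cy]] := hK C CC; first by rewrite Ca.
  have [ey|ey|yK'] := hC y Cy; first by rewrite ey eqxx in ya.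
    by rewrite ey xK in yK.
  by rewrite yK' in yK.
have [||D [cD Da DN]] := @covector_parallel N a.
- by move=> C CC Ca; have [x [xa _ Cx]] := hK C CC Ca; exists x.
- move=> e eN ea; have [C [CC Ca hC]] := nexe e eN ea; exists C.
  have [|y [ya yK Cy]] := hK C CC; first by rewrite Ca.
  have CE x : C x != None -> x = a \/ x = e.
    move=> Cx; have [->|->|xK] := hC x Cx; [by left|by right|left].
    apply/eqP/negPn/negP=> xa; have := KN x xK xa.
    by rewrite (circuit_ground CC Cx).
  split=> //; have [ey|<-//] := CE y Cy; by rewrite ey eqxx in ya.
- by exists D; split=> // x xK xa; apply: DN => //; apply: KN.
Qed.

End Covectors.

(** * Bases, fundamental circuits and fundamental cocircuits *)

Section BaseTheory.
Variable T : finType.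
Implicit Types (N : omatroid T) (C X Y Z D : signed T) (a b e x y : T).
Implicit Types (A B K : {set T}).

Lemma indepP N A :
  reflect (A \subset ground N /\
           forall C, C \in circuits N -> exists2 x, C x != None & x \notin A)
          (independent N A).
Proof.
apply: (iffP andP) => -[sA h]; split=> //.
  move=> C CC; have /subsetPn[x] := forall_inP h C CC.
  by rewrite in_supp; exists x.
apply/forall_inP=> C CC; have [x Cx xA] := h C CC.
by apply/subsetPn; exists x; rewrite ?in_supp.
Qed.

Lemma basis_indep N B : basis N B -> independent N B.
Proof. by case/maxsetP. Qed.

Lemma basis_ground N B x : basis N B -> x \in B -> x \in ground N.
Proof. by case/maxsetP=> /indepP[/subsetP sB _] _; apply: sB. Qed.

Lemma basisP N B :
  reflect (independent N B /\
     forall e, e \in ground N -> e \notin B -> exists C, [/\ C \in circuits N,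
       C e = Some true & forall x, C x != None -> x = e \/ x \in B])
    (basis N B).
Proof.
apply: (iffP maxsetP) => -[iB h]; split=> //.
  move=> e eN eB.
  have /indepP[sBN iC] := iB.
  have : ~~ independent N (e |: B).
    apply/negP=> /h; rewrite subsetUr => /(_ isT) E.
    by move: eB; rewrite -E setU11.
  rewrite /independent subUset sub1set eN sBN /= => /forall_inPn[C CC].
  rewrite negbK => /subsetP sC.
  have CE x : C x != None -> x = e \/ x \in B.
    by rewrite -in_supp => /sC; rewrite !inE => /orP[/eqP|]; [left|right].
  have Ce : C e != None.
    have [x Cx xB] := iC C CC; have [<-//|xB'] := CE x Cx.
    by rewrite xB' in xB.
  case Ce': (C e) Ce => [[]|] // _; first by exists C.
  exists (sopp C); rewrite circuit_sopp // ffunE Ce'; split=> // x.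
  by rewrite ffunE => Cx; apply: CE; case: (C x) Cx.
move=> A iA sBA; have /indepP[sAN iC] := iA; apply/eqP; rewrite eqEsubset sBA andbT.
apply/subsetP=> e eA; apply/negPn/negP=> eB.
have [C [CC Ce Cx]] := h e (subsetP sAN e eA) eB.
have [x /Cx[->|xB]] := iC C CC; first by rewrite eA.
by rewrite (subsetP sBA).
Qed.

Lemma basis_ext N A : independent N A -> exists2 B, basis N B & A \subset B.
Proof. by case/maxset_exists=> B; exists B. Qed.

Lemma circuit_notin_indep N B C : independent N B -> C \in circuits N ->
  (forall x, C x != None -> x \in B) -> False.
Proof.
by case/indepP=> _ h CC sC; have [x /sC xB] := h C CC; rewrite xB.
Qed.

Lemma fcircuit_uniq N B e X Y : independent N B ->
  X \in circuits N -> Y \in circuits N ->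
  (forall x, X x != None -> x = e \/ x \in B) ->
  (forall x, Y x != None -> x = e \/ x \in B) ->
  X e = Y e -> X = Y.
Proof.
move=> iB XC YC sX sY eXY; have [Xe|/negPn/eqP Xe] := boolP (X e != None).
  have [//|nXY] := eqVneq X Y.
  have [||Z ZC [Ze Zx]] := circuit_elim XC (circuit_sopp YC) _ Xe.
  - by rewrite soppK; apply/eqP.
  - by rewrite ffunE eXY.
  case: (circuit_notin_indep iB ZC) => x nZ.
  have [xe|//] : x = e \/ x \in B.
    have [E|E] := Zx x nZ; first by apply: sX; rewrite -E.
    by apply: sY; move: nZ; rewrite E ffunE; case: (Y x).
  by rewrite xe Ze in nZ.
case: (circuit_notin_indep iB XC) => x Xx; have [xe|//] := sX x Xx.
by rewrite xe Xe in Xx.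
Qed.

Lemma fcircuitP N B e : basis N B -> e \in ground N -> e \notin B ->
  [/\ fcircuit N B e \in circuits N, fcircuit N B e e = Some true &
      forall x, fcircuit N B e x != None -> x = e \/ x \in B].
Proof.
move=> /basisP[_ hB] eN eB; rewrite /fcircuit; case: pickP => [C|] /=.
  case/and3P=> CC /subsetP sC /eqP Ce; split=> // x; rewrite -in_supp => /sC.
  by rewrite !inE => /orP[/eqP|]; [left|right].
have [C [CC Ce Cx]] := hB e eN eB; move=> /(_ C)/negP[]; rewrite CC Ce eqxx.
rewrite andbT; apply/subsetP=> x; rewrite in_supp !inE => /Cx[->|->].
  by rewrite eqxx.
by rewrite orbT.
Qed.

Lemma fcircuit_eq N B e C : basis N B -> e \notin B -> C \in circuits N ->
  C e = Some true -> (forall x, C x != None -> x = e \/ x \in B) ->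
  C = fcircuit N B e.
Proof.
move=> bB eB CC Ce sC.
have eN : e \in ground N by apply: (circuit_ground CC); rewrite Ce.
have [FC Fe sF] := fcircuitP bB eN eB.
by apply: (fcircuit_uniq (basis_indep bB) CC FC sC sF); rewrite Ce Fe.
Qed.

Lemma basis_exchange N B e b C : basis N B -> e \notin B -> b \in B ->
  C \in circuits N -> C e != None -> C b != None ->
  (forall x, C x != None -> x = e \/ x \in B) -> basis N (e |: B :\ b).
Proof.
move=> bB eB bB' CC Ce Cb sC; have iB := basis_indep bB.
have be : b != e by apply: contraNneq eB => <-.
have eN : e \in ground N := circuit_ground CC Ce.
have norm X x : X \in circuits N -> X x != None -> exists Y,
    [/\ Y \in circuits N, Y x = Some true &
        forall y, (Y y != None) = (X y != None)].
  move=> XC; case Xx: (X x) => [[]|] // _; first by exists X.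
  exists (sopp X); rewrite circuit_sopp // ffunE Xx; split=> // y.
  by rewrite ffunE; case: (X y).
apply/basisP; split.
  apply/indepP; split.
    apply/subsetP=> x; rewrite !inE => /orP[/eqP->//|/andP[_]].
    exact: basis_ground.
  move=> X XC; have [/existsP[x /andP[Xx xB]]|/existsPn nX] :=
    boolP [exists x, (X x != None) && (x \notin e |: B :\ b)].
    by exists x.
  have sX x : X x != None -> x = e \/ x \in B.
    move=> Xx; have := nX x; rewrite Xx /= !inE negbK => /orP[/eqP|/andP[_]].
      by left.
    by right.
  have Xb : X b = None.
    apply/eqP/negPn/negP=> Xb; have := nX b.
    by rewrite Xb !inE eqxx (negPf be).
  have [Xe|/negPn/eqP Xe] := boolP (X e != None); last first.
    case: (circuit_notin_indep iB XC) => x Xx.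
    by have [xe|//] := sX x Xx; rewrite xe Xe in Xx.
  have [Y [YC Ye YE]] := norm X e XC Xe; have [Z [ZC Ze ZE]] := norm C e CC Ce.
  have YZ : Y = Z.
    apply: (fcircuit_uniq iB YC ZC (e := e)); rewrite ?Ye ?Ze // => x.
      by rewrite YE; apply: sX.
    by rewrite ZE; apply: sC.
  by move: Cb; rewrite -ZE -YZ YE Xb.
move=> x xN xB'.
have [xb|xb] := eqVneq x b.
  subst x; have [Y [YC Yb YE]] := norm C b CC Cb; exists Y; split=> // x.
  rewrite YE => Cx; have [->|xb] := eqVneq x b; [by left | right].
  by rewrite !inE xb; have [->|->] := sC x Cx; rewrite ?eqxx ?orbT.
have [xB xe] : x \notin B /\ x != e.
  by move: xB'; rewrite !inE xb negb_or /= => /andP[].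
have [FC Fx sF] := fcircuitP bB xN xB.
have [Fb|/negPn/eqP Fb] := boolP (fcircuit N B x b != None); last first.
  exists (fcircuit N B x); split=> // y Fy.
  have [->|yB] := sF y Fy; [by left | right].
  by rewrite !inE yB andbT; apply/orP; right; apply: contraNneq Fy => ->; rewrite Fb.
have [C' [C'C C'b C'E]] : exists C', [/\ C' \in circuits N,
    C' b = omap negb (fcircuit N B x b) &
    forall y, (C' y != None) = (C y != None)].
  have [E|E] := eqVneq (C b) (omap negb (fcircuit N B x b)); first by exists C.
  exists (sopp C); rewrite circuit_sopp // ffunE; split=> //.
    by move: Cb Fb E; case: (C b) => [[]|]; case: (fcircuit N B x b) => [[]|].
  by move=> y; rewrite ffunE; case: (C y).
have C'x : C' x = None.
  apply/eqP/negPn; rewrite C'E; apply/negP => /sC[xe'|xB''].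
    by rewrite xe' eqxx in xe.
  by rewrite xB'' in xB.
have [|Z ZC [Zb Zy]] := circuit_elim FC C'C _ Fb C'b.
  by move=> E; move: Fx; rewrite E ffunE C'x.
have sZ y : Z y != None -> y = x \/ y \in e |: B :\ b.
  move=> nZ; have yb : y != b by apply: contraNneq nZ => ->; rewrite Zb.
  rewrite !inE yb /=; have [E|E] := Zy y nZ.
    have [|->|->] := sF y; first by rewrite -E.
      by left.
    by right; rewrite orbT.
  have /sC[->|->] : C y != None by rewrite -C'E -E.
    by right; rewrite eqxx.
  by right; rewrite orbT.
have Zx : Z x != None.
  apply/negP=> /eqP Zx.
  have Z_sub y : Z y != None -> y = e \/ y \in B.
    move=> nZ; have [yx|] := sZ y nZ; first by rewrite yx Zx in nZ.
    by rewrite !inE => /orP[/eqP|/andP[_]]; [left|right].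
  have [Ze|/negPn/eqP Ze] := boolP (Z e != None); last first.
    case: (circuit_notin_indep iB ZC) => y nZ.
    by have [ye|//] := Z_sub y nZ; rewrite ye Ze in nZ.
  have [Y1 [Y1C Y1e Y1E]] := norm Z e ZC Ze.
  have [Y2 [Y2C Y2e Y2E]] := norm C e CC Ce.
  have YZ : Y1 = Y2.
    apply: (fcircuit_uniq iB Y1C Y2C (e := e)); rewrite ?Y1e ?Y2e // => y.
      by rewrite Y1E; apply: Z_sub.
    by rewrite Y2E; apply: sC.
  by move: Cb; rewrite -Y2E -YZ Y1E Zb.
have [Y [YC Yx YE]] := norm Z x ZC Zx; exists Y; split=> // y.
by rewrite YE; apply: sZ.
Qed.

Lemma covector_basis0 N B D : basis N B -> covector N D ->
  (forall x, x \in B -> D x = None) -> forall x, x \in ground N -> D x = None.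
Proof.
move=> bB cD DB x xN; have [/DB//|xB] := boolP (x \in B).
have [FC Fx sF] := fcircuitP bB xN xB.
apply: (orth_one (covector_orth cD FC)); first by rewrite Fx.
by move=> z Fz Dz; have [//|zB] := sF z Fz; rewrite DB in Dz.
Qed.

(** Orthogonality leaves no choice: the fundamental circuit of x meets D in x
    and b only. *)
Lemma covector_fcircuit N B b D x : basis N B -> b \in B -> covector N D ->
  D b = Some true -> (forall y, y \in B -> y != b -> D y = None) ->
  x \in ground N -> x \notin B -> D x = omap negb (fcircuit N B x b).
Proof.
move=> bB bB' cD Db DB xN xB; have [FC Fx sF] := fcircuitP bB xN xB.
have oFD := covector_orth cD FC.
have two z : fcircuit N B x z != None -> D z != None -> z = x \/ z = b.
  move=> Fz Dz; have [->|zB] := sF z Fz; [by left | right].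
  by apply/eqP/negPn/negP=> zb; rewrite DB in Dz.
have [Fb|/negPn/eqP Fb] := boolP (fcircuit N B x b != None).
  have [|z Fz Dz|_ Dx] := orth_two (x := b) (y := x) oFD Fb.
  - by rewrite Db.
  - by have [->|->] := two z Fz Dz; [right|left].
  rewrite Fx Db; move: Fb Dx; case: (D x) => [[]|] //;
  by case: (fcircuit N B x b) => [[]|].
rewrite Fb; apply: (orth_one oFD); first by rewrite Fx.
move=> z Fz Dz; have [//|zb] := two z Fz Dz.
by rewrite zb Fb in Fz.
Qed.

Lemma fcovector_eq N B b D D' : basis N B -> b \in B ->
  covector N D -> covector N D' -> D b = D' b ->
  (forall y, y \in B -> y != b -> D y = None) ->
  (forall y, y \in B -> y != b -> D' y = None) ->
  (forall y, y \notin ground N -> D y = None) ->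
  (forall y, y \notin ground N -> D' y = None) -> D b != None -> D = D'.
Proof.
move=> bB bB'.
have main F F' : covector N F -> covector N F' -> F b = F' b ->
    (forall y, y \in B -> y != b -> F y = None) ->
    (forall y, y \in B -> y != b -> F' y = None) ->
    (forall y, y \notin ground N -> F y = None) ->
    (forall y, y \notin ground N -> F' y = None) -> F b = Some true -> F = F'.
  move=> cF cF' E hF hF' gF gF' Fb; have F'b : F' b = Some true by rewrite -E.
  apply/ffunP=> x; have [xN|xN] := boolP (x \in ground N); last by rewrite gF ?gF'.
  have [xB|xB] := boolP (x \in B); last first.
    by rewrite (covector_fcircuit bB bB' cF Fb) // (covector_fcircuit bB bB' cF' F'b).
  by have [->//|xb] := eqVneq x b; rewrite hF ?hF'.
move=> cD cD' E hD hD' gD gD'; case Db: (D b) => [[]|] // _; first exact: main.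
suff E' : sopp D = sopp D' by rewrite -[D]soppK E' soppK.
apply: main.
- exact: covector_sopp.
- exact: covector_sopp.
- by rewrite !ffunE E.
- by move=> y yB yb; rewrite ffunE hD.
- by move=> y yB yb; rewrite ffunE hD'.
- by move=> y yN; rewrite ffunE gD.
- by move=> y yN; rewrite ffunE gD'.
- by rewrite ffunE Db.
Qed.

Lemma cocircuit_covector N D : D \in cocircuits N -> covector N D.
Proof. by rewrite inE => /andP[]. Qed.

Lemma cocircuit_supportP N (S : {set T}) :
  reflect ((forall B, basis N B -> exists2 x, x \in B & x \in S) /\
    forall a, a \in S -> exists B, [/\ basis N B, a \in B &
       forall x, x \in B -> x \in S -> x = a])
   (cocircuit_support N S).
Proof.
have hitP (A : {set T}) :
    reflect (forall B, basis N B -> exists2 x, x \in B & x \in A)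
    [forall B in bases N, A :&: B != set0].
  apply: (iffP forall_inP) => h B bB.
    have /set0Pn[x] : A :&: B != set0 by apply: h; rewrite inE.
    by rewrite inE => /andP[]; exists x.
  have [|x xB xA] := h B; first by rewrite inE in bB.
  by apply/set0Pn; exists x; rewrite inE xA.
apply: (iffP minsetP) => /= -[hS mS]; split.
- exact/hitP.
- move=> a aS; have [/hitP hSa|/forall_inPn[B]] :=
    boolP [forall B in bases N, (S :\ a) :&: B != set0].
    have E : S :\ a = S by apply: mS; [exact/hitP | exact: subD1set].
    by move: aS; rewrite -E !inE eqxx.
  rewrite inE negbK => bB /eqP SB; exists B.
  have uB x : x \in B -> x \in S -> x = a.
    move=> xB xS; apply/eqP/negPn/negP=> xa.
    by move/setP/(_ x): SB; rewrite !inE xa xS xB.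
  split=> //; have [x xB xS] := hitP _ hS B bB.
  by rewrite -(uB x).
- exact/hitP.
- move=> A /hitP hA sAS; apply/eqP; rewrite eqEsubset sAS.
  apply/subsetP=> a aS; have [B [bB aB uB]] := mS a aS.
  have [x xB xA] := hA B bB.
  by rewrite -(uB x) // (subsetP sAS).
Qed.

Lemma cocircuit_basis N D a : D \in cocircuits N -> D a != None ->
  exists B, [/\ basis N B, a \in B & forall x, x \in B -> x != a -> D x = None].
Proof.
rewrite inE => /andP[/cocircuit_supportP[_ mD] _] Da.
have [|B [bB aB uB]] := mD a; first by rewrite in_supp.
exists B; split=> // x xB xa; apply/eqP/negPn/negP=> Dx.
by rewrite (uB x) ?eqxx ?in_supp in xa.
Qed.

Lemma cocircuit_meets N B D : D \in cocircuits N -> basis N B ->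
  exists2 x, x \in B & D x != None.
Proof.
rewrite inE => /andP[/cocircuit_supportP[hD _] _] /hD[x xB].
by rewrite in_supp; exists x.
Qed.

Lemma cocircuit_ground N D x : D \in cocircuits N -> D x != None ->
  x \in ground N.
Proof.
by move=> DD Dx; have [B [bB xB _]] := cocircuit_basis DD Dx; apply: basis_ground bB xB.
Qed.

Lemma fcovector_cocircuit N B b D : basis N B -> b \in B -> covector N D ->
  D b != None -> (forall y, y \in B -> y != b -> D y = None) ->
  (forall y, y \notin ground N -> D y = None) -> D \in cocircuits N.
Proof.
move=> bB bB' cD Db DB gD; rewrite inE; apply/andP; split=> //.
have bN := basis_ground bB bB'.
apply/cocircuit_supportP; split=> [B' bB''|e].
  have [/existsP[x /andP[xB Dx]]|/existsPn no] :=
    boolP [exists x, (x \in B') && (D x != None)].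
    by exists x; rewrite ?in_supp.
  rewrite (covector_basis0 bB'' cD) // in Db => x xB.
  by apply/eqP/negPn/negP=> Dx; have := no x; rewrite xB Dx.
rewrite in_supp => De; have eN : e \in ground N.
  by apply/negPn/negP=> /gD De'; rewrite De' in De.
have [eB|eB] := boolP (e \in B).
  have eb : e = b by apply/eqP/negPn/negP=> eb; rewrite DB in De.
  subst e; exists B; split=> // x xB; rewrite in_supp => Dx.
  by apply/eqP/negPn/negP=> xb; rewrite DB in Dx.
have [FC Fe sF] := fcircuitP bB eN eB.
have [||Fb _ _] := @orth_two _ _ _ e b (covector_orth cD FC) _ De.
- by rewrite Fe.
- move=> z Fz Dz; have [->|zB] := sF z Fz; [by left | right].
  by apply/eqP/negPn/negP=> zb; rewrite DB in Dz.
exists (e |: B :\ b); split.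
- by apply: (basis_exchange bB eB bB' FC); rewrite ?Fe.
- by rewrite setU11.
- move=> x; rewrite !inE => /orP[/eqP//|/andP[xb xB]] Dx.
  by rewrite DB in Dx.
Qed.

(** The underlying cocircuit carries a signature because a covector separates
    b from the rest of B; it is cut down to the ground set. *)
Lemma fcovector_exists N B b : basis N B -> b \in B -> exists D,
  [/\ D \in cocircuits N, D b = Some true,
      forall y, y \in B -> y != b -> D y = None &
      forall y, y \notin ground N -> D y = None].
Proof.
move=> bB bB'; have bN := basis_ground bB bB'.
have [|D [cD Db DB]] := @covector_exists _ N (B :\ b) b.
  move=> C CC Cb; have [x Cx xB] := snd (elimT (indepP _ _) (basis_indep bB)) C CC.
  by exists x; rewrite !inE Cx (negPf xB) andbF; split=> //; apply: contraNneq xB => ->.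
pose D' : signed T := [ffun x => if x \in ground N then D x else None].
have D'b : D' b = Some true by rewrite ffunE bN.
have D'B y : y \in B -> y != b -> D' y = None.
  by move=> yB yb; rewrite ffunE DB ?inE ?yb //; case: ifP.
have D'N y : y \notin ground N -> D' y = None by rewrite ffunE => /negPf->.
exists D'; split=> //; apply: (fcovector_cocircuit bB bB') => //; last first.
  by rewrite D'b.
apply: covectorI => X x XC Xx.
rewrite ffunE (circuit_ground XC Xx) => XDx.
have [|y [_ Xy Dy E]] := orth_at (covector_orth cD XC) Xx; first by rewrite -XDx.
exists y => //; rewrite ffunE (circuit_ground XC Xy).
by move: Xy Dy E; rewrite XDx eqxx; case: (X y) => [[]|]; case: (D y) => [[]|].
Qed.

Lemma fcovector_supp N B b D : basis N B -> b \in B -> covector N D ->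
  D b != None -> (forall y, y \in B -> y != b -> D y = None) ->
  (forall y, y \notin ground N -> D y = None) ->
  supp D = ground N :\: mclosure N (B :\ b).
Proof.
move=> bB bB' cD Db DB gD; have bN := basis_ground bB bB'.
apply/setP=> x; rewrite in_supp in_setD [x \in mclosure _ _]inE.
have [xN|/gD->] := boolP (x \in ground N); last by rewrite andbF.
rewrite /= andbT; have [xB|xB] := boolP (x \in B :\ b).
  by move: xB; rewrite !inE => /andP[xb xB]; rewrite DB.
rewrite /=; apply/idP/exists_inPn=> [Dx C CC|no].
  apply/negP=> /andP[]; rewrite in_supp => Cx /subsetP sC.
  have Dx0 : D x = None.
    apply: (orth_one (covector_orth cD CC) Cx) => z Cz Dz.
    have : z \in supp C by rewrite in_supp.
    by move/sC; rewrite !inE => /orP[/eqP//|/andP[zb zB]]; rewrite DB in Dz.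
  by rewrite Dx0 in Dx.
have [->//|xb] := eqVneq x b.
have {}xB : x \notin B by move: xB; rewrite !inE xb.
have [FC Fx sF] := fcircuitP bB xN xB.
have Fb : fcircuit N B x b != None.
  apply/negP=> /eqP Fb; case/negP: (no _ FC); rewrite in_supp Fx /=.
  apply/subsetP=> z; rewrite in_supp !inE => Fz; have [->|->] := sF z Fz.
    by rewrite eqxx.
  by rewrite andbT; apply/orP; right; apply: contraNneq Fz => ->; rewrite Fb.
have [//||//] := @orth_two _ _ _ b x (covector_orth cD FC) Fb.
move=> z Fz Dz; have [->|zB] := sF z Fz; [by right | left].
by apply/eqP/negPn/negP=> zb; rewrite DB in Dz.
Qed.

Lemma fcocircuitP N B b : basis N B -> b \in B ->
  [/\ fcocircuit N B b \in cocircuits N, fcocircuit N B b b = Some true,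
      forall y, y \in B -> y != b -> fcocircuit N B b y = None &
      forall y, y \notin ground N -> fcocircuit N B b y = None].
Proof.
move=> bB bB'; rewrite /fcocircuit; case: pickP => [D|] /=.
  case/and3P=> DD /eqP sD /eqP Db; split=> // y => [yB yb|yN].
    apply/eqP/negPn; rewrite -in_supp sD !inE; apply/negP=> /andP[/negP nE _]; apply: nE.
    by rewrite (basis_ground bB yB) yB yb.
  by apply/eqP/negPn; rewrite -in_supp sD !inE (negPf yN).
have [D [DD Db DB gD]] := fcovector_exists bB bB'.
move=> /(_ D)/negP[]; rewrite DD Db eqxx (fcovector_supp bB bB') ?eqxx //.
  exact: cocircuit_covector.
by rewrite Db.
Qed.

Lemma fcocircuit_eq N B b D : basis N B -> b \in B -> covector N D ->
  D b = Some true -> (forall y, y \in B -> y != b -> D y = None) ->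
  (forall y, y \notin ground N -> D y = None) -> D = fcocircuit N B b.
Proof.
move=> bB bB' cD Db DB gD; have [FD Fb FB gF] := fcocircuitP bB bB'.
apply: (fcovector_eq bB bB') => //; rewrite ?Db ?Fb //.
exact: cocircuit_covector.
Qed.

(** As [covector_exists], with a cocircuit: extend a maximal independent
    subset of K, together with a, to a basis, and take the fundamental
    cocircuit of a. *)
Lemma cocircuit_exists N K a : a \in ground N ->
  (forall C, C \in circuits N -> C a != None ->
     exists x, [/\ x != a, x \notin K & C x != None]) ->
  exists D, [/\ D \in cocircuits N, D a = Some true &
                forall x, x \in K -> x != a -> D x = None].
Proof.
move=> aN hK.
pose P := [pred A : {set T} | independent N A && (A \subset K :\ a)].
have P0 : P set0.
  rewrite /= sub0set andbT; apply/indepP; split; first exact: sub0set.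
  by move=> C CC; have [x Cx] := circuit_neq0 CC; exists x; rewrite ?inE.
have [I /maxsetP[/andP[iI /subsetP sI] mI] _] := maxset_exists P0.
have [sIN iC] := indepP _ _ iI.
have [|B bB sB] := @basis_ext N (a |: I).
  apply/indepP; split; first by rewrite subUset sub1set aN.
  move=> C CC; have [Ca|/negPn/eqP Ca] := boolP (C a != None).
    have [x [xa xK Cx]] := hK C CC Ca; exists x => //.
    rewrite !inE (negPf xa); apply: contra xK => /sI.
    by rewrite !inE => /andP[].
  have [x Cx xI] := iC C CC; exists x => //; rewrite !inE (negPf xI) orbF.
  by apply: contraNneq Cx => ->; rewrite Ca.
have aB : a \in B by rewrite (subsetP sB) ?setU11.
have [DD Da DB gD] := fcocircuitP bB aB; exists (fcocircuit N B a); split=> //.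
have DI x : x \in I -> fcocircuit N B a x = None.
  move=> xI; apply: DB; first by rewrite (subsetP sB) // !inE xI orbT.
  by have := sI x xI; rewrite !inE => /andP[].
move=> x xK xa; have [/DI//|xI] := boolP (x \in I).
have [xN|/gD//] := boolP (x \in ground N).
have : ~~ independent N (x |: I).
  apply/negP=> iX; have E : x |: I = I.
    apply: mI; last exact: subsetUr.
    by rewrite /= iX subUset sub1set !inE xa xK; apply/subsetP.
  by move: xI; rewrite -E setU11.
rewrite /independent subUset sub1set xN sIN /= => /forall_inPn[C CC].
rewrite negbK => /subsetP sC.
have CE y : C y != None -> y = x \/ y \in I.
  by rewrite -in_supp => /sC; rewrite !inE => /orP[/eqP|]; [left|right].
have Cx : C x != None.
  have [y Cy yI] := iC C CC; have [<-//|yI'] := CE y Cy.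
  by rewrite yI' in yI.
apply: (orth_one (covector_orth (cocircuit_covector DD) CC) Cx) => y Cy Dy.
by have [//|/DI E] := CE y Cy; rewrite E in Dy.
Qed.

End BaseTheory.

(** * Linear programming duality *)

Section Programs.
Variable T : finType.
Implicit Types (N : omatroid T) (C X Y Z D : signed T) (a b e f g x y : T).
Implicit Types (A B K P : {set T}).

(** Genericity of the extension by f in terms of fundamental circuits: C(B;f)
    has full support B + f. Only supports are involved, so that the condition
    survives reorientation. *)
Definition generic_point N f := forall B C, basis N B -> f \notin B ->
  C \in circuits N -> C f != None ->
  (forall x, C x != None -> x = f \/ x \in B) ->
  forall x, x \in B -> C x != None.

(** The dual condition, that C*(B;g) contains everything outside B, read off
    the fundamental circuits C(B;e). *)
Definition generic_copoint N g := forall B e C, basis N B -> g \in B ->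
  e \notin B -> C \in circuits N -> C e != None ->
  (forall x, C x != None -> x = e \/ x \in B) -> C g != None.

Lemma basis_sub_eq N B B' : basis N B -> basis N B' -> B \subset B' -> B = B'.
Proof.
by case/maxsetP=> _ mB /maxsetP[iB' _] sBB'; rewrite (mB B').
Qed.

Lemma generic_point_circuit N f C : generic_point N f -> C \in circuits N ->
  C f != None -> exists B, [/\ basis N B, f \notin B &
    forall x, (C x != None) = (x == f) || (x \in B)].
Proof.
move=> gf CC Cf; have [|B bB sB] := @basis_ext _ N (supp C :\ f).
  apply/indepP; split.
    apply/subsetP=> x; rewrite !inE => /andP[_]; exact: circuit_ground.
  move=> X XC; have [/existsP[x /andP[Xx xC]]|/existsPn no] :=
    boolP [exists x, (X x != None) && (x \notin supp C :\ f)]; first by exists x.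
  have sX x : X x != None -> x != f /\ C x != None.
    by move=> Xx; have := no x; rewrite Xx !inE /= negbK => /andP[].
  have : X f != None by apply: (circuit_min_supp XC CC) => // x /sX[].
  by move/sX; rewrite eqxx => -[].
have sC x : C x != None -> x = f \/ x \in B.
  move=> Cx; have [->|xf] := eqVneq x f; [by left | right].
  by rewrite (subsetP sB) // !inE xf.
have fB : f \notin B.
  apply/negP=> fB; case: (circuit_notin_indep (basis_indep bB) CC) => x.
  by case/sC=> [->|].
exists B; split=> // x; apply/idP/orP=> [/sC[->|->]|[/eqP->//|xB]].
- by rewrite eqxx; left.
- by right.
- exact: (gf B C).
Qed.

Lemma generic_cocircuit_supp N g B D : generic_copoint N g -> basis N B ->
  g \in B -> D \in cocircuits N -> D g != None ->
  (forall x, x \in B -> x != g -> D x = None) ->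
  forall x, (D x != None) = (x \in ground N) && ((x == g) || (x \notin B)).
Proof.
move=> gg bB gB DD Dg DB x; have cD := cocircuit_covector DD.
have [xN|xN] /= := boolP (x \in ground N); last first.
  by apply: contraNF xN; apply: cocircuit_ground.
have [->|xg] /= := eqVneq x g; first by [].
have [xB|xB] /= := boolP (x \in B); first by rewrite DB.
have [FC Fx sF] := fcircuitP bB xN xB.
have Fg : fcircuit N B x g != None by apply: (gg B x); rewrite ?Fx.
have [//|z Fz Dz|//] := orth_two (x := g) (y := x) (covector_orth cD FC) Fg.
have [->|zB] := sF z Fz; [by right | left].
by apply/eqP/negPn/negP=> zg; rewrite DB in Dz.
Qed.

(** By genericity, C - f is a basis and the zero set of D is a basis minus g;
    complementarity makes the first a subset of the second plus g. *)
Lemma complementary_basis N f g C D :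
  generic_point N f -> generic_copoint N g ->
  C \in circuits N -> D \in cocircuits N -> C f != None -> D g != None ->
  (forall x, x != f -> x != g -> C x = None \/ D x = None) ->
  exists B, [/\ basis N B, g \in B, f \notin B,
     forall x, (C x != None) = (x == f) || (x \in B) &
     forall x, (D x != None) = (x \in ground N) && ((x == g) || (x \notin B))].
Proof.
move=> gf gg CC DD Cf Dg CD.
have [B [bB fB CE]] := generic_point_circuit gf CC Cf.
have [B' [bB' gB' DB']] := cocircuit_basis DD Dg.
have DE := generic_cocircuit_supp gg bB' gB' DD Dg DB'.
have E : B = B'.
  apply: (basis_sub_eq bB bB'); apply/subsetP=> x xB.
  have [->//|xg] := eqVneq x g.
  have xf : x != f by apply: contraNneq fB => <-.
  have [Cx|Dx] := CD x xf xg.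
    by have := CE x; rewrite Cx xB orbT.
  have := DE x; rewrite Dx (basis_ground bB xB) (negPf xg) /=.
  by move/esym/negbFE.
by exists B; rewrite E in bB fB CE *; split.
Qed.

Definition pinned f g P K := ~: (f |: (g |: (P :|: K))).

(** The minor in question is obtained by contracting K, deleting the
    complement of P, K, f and g, and then deleting f; its circuits are
    followed through the circuits of N itself. *)
Definition minor_acyclic N f g K P := forall C, C \in circuits N ->
  C f = None -> (forall x, x \in pinned f g P K -> C x = None) ->
  (forall x, x \in P -> C x <> Some false) -> C g <> Some false ->
  (forall x, x \in P -> C x = None) /\ C g = None.

(** Dually, for the same minor with g contracted in place of f deleted. *)
Definition minor_totally_cyclic N f g K P := forall D, D \in cocircuits N ->
  D g = None -> (forall x, x \in K -> D x = None) ->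
  (forall x, x \in P -> D x <> Some false) -> D f <> Some false ->
  (forall x, x \in P -> D x = None) /\ D f = None.

Lemma in_pinned f g P K x :
  (x \in pinned f g P K) = [&& x != f, x != g, x \notin P & x \notin K].
Proof. by rewrite !inE !negb_or. Qed.

Lemma circuit_positive_at N C x : C \in circuits N -> C x != None ->
  exists Y, [/\ Y \in circuits N, Y x = Some true &
     forall y, (Y y == None) = (C y == None)].
Proof.
move=> CC; case Cx: (C x) => [[]|] // _; first by exists C.
exists (sopp C); rewrite circuit_sopp // ffunE Cx; split=> // y.
by rewrite ffunE; case: (C y).
Qed.

(** Linear programming duality for the minors of N, by induction on the set P
    of elements that carry a sign constraint. An element e of P may be
    deleted or contracted. Deletion keeps the minor acyclic; contraction
    keeps it totally cyclic. If deletion destroys total cyclicity, a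
    cocircuit negative only at e shows by orthogonality that the solution of
    the contracted program has the right sign at e; dually for contraction.
    Both cannot be destroyed, since the two witnesses would not be
    orthogonal. If both survive and both solutions are negative at e, then
    eliminating f between the two circuits yields a circuit that contradicts
    one of the two cocircuits, whatever its sign at g. *)
Lemma lp_duality N f g K P :
  generic_point N f -> generic_copoint N g ->
  f \in ground N -> g \in ground N -> f != g ->
  f \notin P -> g \notin P -> f \notin K -> g \notin K ->
  (forall x, x \in P -> x \notin K) ->
  minor_acyclic N f g K P -> minor_totally_cyclic N f g K P ->
  exists C D, [/\ C \in circuits N, D \in cocircuits N,
    [/\ C f = Some true, forall x, x \in pinned f g P K -> C x = None &
     forall x, x \in P -> C x <> Some false],
    [/\ D g = Some true, forall x, x \in K -> D x = None &
     forall x, x \in P -> D x <> Some false] &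
    forall x, x \in P -> C x = None \/ D x = None].
Proof.
move=> gf gg fN gN fg.
have [n le_n] : exists n, #|P| <= n by exists #|P|.
elim: n K P le_n => [|n IH] K P le_n fP gP fK gK PK H1 H2.
  have P0 x : x \in P = false.
    by move: le_n; rewrite leqn0 cards_eq0 => /eqP->; rewrite inE.
  have [C [CC Cf CL]] : exists C, [/\ C \in circuits N, C f = Some true &
      forall x, x \in pinned f g P K -> C x = None].
    have [/exists_inP[C CC /andP[Cf /forall_inP sC]]|no] := boolP [exists C in
      circuits N, (C f != None) && [forall x in pinned f g P K, C x == None]].
      have [Y [YC Yf YE]] := circuit_positive_at CC Cf.
      by exists Y; split=> // x /sC; rewrite -YE => /eqP.
    have [|D [DD Df DK]] := @cocircuit_exists _ N (g |: K) f fN.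
      move=> C CC Cf; move/exists_inPn/(_ C CC): no; rewrite Cf /=.
      case/forall_inPn=> x; rewrite in_pinned => /and4P[xf xg xP xK] Cx.
      by exists x; rewrite !inE negb_or xg.
    have [|x xK|x||_] := H2 D DD; rewrite ?P0 ?Df //.
      by rewrite DK ?inE ?eqxx // eq_sym.
    by apply: DK; [rewrite !inE xK orbT | apply: contraNneq fK => <-].
  have [D [DD Dg DK]] : exists D, [/\ D \in cocircuits N, D g = Some true &
      forall x, x \in K -> D x = None].
    have [|D [DD Dg DK]] := @cocircuit_exists _ N K g gN; last first.
      exists D; split=> // x xK; apply: DK => //.
      by apply: contraNneq gK => <-.
    move=> X XC Xg; have [/existsP[x /and3P[xg xK Xx]]|/existsPn no] :=
      boolP [exists x, [&& x != g, x \notin K & X x != None]]; first by exists x.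
    have X0 x : x \notin K -> x != g -> X x = None.
      by move=> xK xg; apply/eqP; have := no x; rewrite xg xK /= negbK.
    have [Y [YC Yg YE]] := circuit_positive_at XC Xg.
    have Y0 x : x \notin K -> x != g -> Y x = None.
      by move=> xK xg; apply/eqP; rewrite YE X0.
    have [|x|x||_] := H1 Y YC; rewrite ?P0 ?Yg //.
      exact: Y0.
    by rewrite in_pinned => /and4P[_ xg _ xK]; apply: Y0.
  by exists C, D; split=> //; [split=> // x | split=> // x | move=> x]; rewrite P0.
have [P0|[e eP]] := set_0Vmem P.
  by apply: (IH K P) => //; rewrite P0 cards0.
have [ef eg] : e != f /\ e != g.
  by split; [apply: contraNneq fP => <- | apply: contraNneq gP => <-].
have eK := PK e eP.
pose P' := P :\ e.
have P'E x : (x \in P') = (x != e) && (x \in P) by rewrite !inE.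
have le_n' : #|P'| <= n.
  by rewrite -ltnS; apply: leq_trans le_n; rewrite [in leqRHS](cardsD1 e) eP.
have fP' : f \notin P' by rewrite P'E negb_and fP orbT.
have gP' : g \notin P' by rewrite P'E negb_and gP orbT.
have P'P x : x \in P' -> x \in P by rewrite P'E => /andP[].
have pinD x : x \in pinned f g P K -> x \in pinned f g P' K.
  by rewrite !in_pinned P'E => /and4P[-> -> /negPf-> ->]; rewrite andbF.
have pinC x : x \in pinned f g P K -> x \in pinned f g P' (e |: K).
  rewrite !in_pinned P'E !inE negb_or => /and4P[-> -> xP ->].
  rewrite (negPf xP) andbF !andbT /=.
  by apply: contraNneq xP => ->.
have cases x : x != f -> x != g ->
    [\/ x = e, x \in P', x \in K | x \in pinned f g P K].
  move=> xf xg; have [->|xe] := eqVneq x e; first by constructor 1.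
  have [xP|xP] := boolP (x \in P); first by constructor 2; rewrite P'E xe.
  have [xK|xK] := boolP (x \in K); first by constructor 3.
  by constructor 4; rewrite in_pinned xf xg xP.
have eP'K x : x \in P' -> x \notin e |: K.
  by rewrite P'E !inE negb_or => /andP[-> /PK].
(* A witness of failure is negative at e, as otherwise it would already
   contradict the hypothesis on P. *)
have del : minor_totally_cyclic N f g K P' \/
   exists D, [/\ D \in cocircuits N, D g = None,
     forall x, x \in K -> D x = None &
     [/\ forall x, x \in P' -> D x <> Some false, D f <> Some false &
         D e = Some false]].
  have [/exists_inP[D DD]|no] := boolP [exists D in cocircuits N,
     [&& D g == None, [forall x in K, D x == None],
         [forall x in P', D x != Some false], D f != Some false &
         D e == Some false]].
    case/and5P=> /eqP Dg /forall_inP DK /forall_inP DP /eqP Df /eqP De.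
    right; exists D; split=> //; first by move=> x /DK/eqP.
    by split=> // x /DP/eqP.
  left=> D DD Dg DK DP Df; have [||DP0 ->] // := H2 D DD Dg DK.
    move=> x xP; have [->|xe] := eqVneq x e; last by apply: DP; rewrite P'E xe.
    move=> De; move/exists_inPn/(_ D DD)/negP: no; apply.
    rewrite Dg De !eqxx /= andbT; apply/and3P; split.
    - by apply/forall_inP=> y /DK ->.
    - by apply/forall_inP=> y /DP/eqP.
    - exact/eqP.
  by split=> // x /P'P; apply: DP0.
have con : minor_acyclic N f g (e |: K) P' \/
   exists C, [/\ C \in circuits N, C f = None,
     forall x, x \in pinned f g P K -> C x = None &
     [/\ forall x, x \in P' -> C x <> Some false, C g <> Some false &
         C e = Some false]].
  have [/exists_inP[C CC]|no] := boolP [exists C in circuits N,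
     [&& C f == None, [forall x in pinned f g P K, C x == None],
         [forall x in P', C x != Some false], C g != Some false &
         C e == Some false]].
    case/and5P=> /eqP Cf /forall_inP CL /forall_inP CP /eqP Cg /eqP Ce.
    right; exists C; split=> //; first by move=> x /CL/eqP.
    by split=> // x /CP/eqP.
  left=> C CC Cf CL CP Cg; have [|||CP0 ->] // := H1 C CC Cf.
  - by move=> x /pinC; apply: CL.
  - move=> x xP; have [->|xe] := eqVneq x e; last by apply: CP; rewrite P'E xe.
    move=> Ce; move/exists_inPn/(_ C CC)/negP: no; apply.
    rewrite Cf Ce !eqxx /= andbT; apply/and3P; split.
    + by apply/forall_inP=> y /pinC/CL ->.
    + by apply/forall_inP=> y /CP/eqP.
    + exact/eqP.
  - by split=> // x /P'P; apply: CP0.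
have solD : minor_totally_cyclic N f g K P' ->
  exists C D, [/\ C \in circuits N, D \in cocircuits N,
    [/\ C f = Some true, forall x, x \in pinned f g P K -> C x = None,
     C e = None & forall x, x \in P' -> C x <> Some false],
    [/\ D g = Some true, forall x, x \in K -> D x = None &
     forall x, x \in P' -> D x <> Some false] &
    forall x, x \in P' -> C x = None \/ D x = None].
  move=> H2d; have [x /P'P /PK|C CC Cf CL CP Cg||C [D [CC DD [Cf CL CP] HD CD]]]
    := IH K P' le_n' fP' gP' fK gK.
  - by [].
  - have Ce : C e = None by apply: CL; rewrite in_pinned ef eg eK P'E eqxx.
    have [|||CP0 ->] // := H1 C CC Cf.
    + by move=> x /pinD; apply: CL.
    + move=> x xP; have [->|xe] := eqVneq x e; first by rewrite Ce.
      by apply: CP; rewrite P'E xe.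
    + by split=> // x /P'P; apply: CP0.
  - exact: H2d.
  - exists C, D; split=> //; split=> //; first by move=> x /pinD; apply: CL.
    by apply: CL; rewrite in_pinned ef eg eK P'E eqxx.
have solC : minor_acyclic N f g (e |: K) P' ->
  exists C D, [/\ C \in circuits N, D \in cocircuits N,
    [/\ C f = Some true, forall x, x \in pinned f g P K -> C x = None &
     forall x, x \in P' -> C x <> Some false],
    [/\ D g = Some true, forall x, x \in K -> D x = None, D e = None &
     forall x, x \in P' -> D x <> Some false] &
    forall x, x \in P' -> C x = None \/ D x = None].
  move=> H1c; have [||||D DD Dg DK DP Df|C [D [CC DD [Cf CL CP]
    [Dg DK DP] CD]]] // := IH (e |: K) P' le_n' fP' gP'.
  - by rewrite !inE negb_or eq_sym ef.
  - by rewrite !inE negb_or eq_sym eg.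
  - have De : D e = None by apply: DK; rewrite setU11.
    have [|||DP0 ->] // := H2 D DD Dg.
    + by move=> x xK; apply: DK; rewrite !inE xK orbT.
    + move=> x xP; have [->|xe] := eqVneq x e; first by rewrite De.
      by apply: DP; rewrite P'E xe.
    + by split=> // x /P'P; apply: DP0.
  - exists C, D; split=> //; split=> //.
    + by move=> x /pinC; apply: CL.
    + by move=> x xK; apply: DK; rewrite !inE xK orbT.
    + by apply: DK; rewrite setU11.
(* Such vectors have equal signs on their common support, which contains e:
   they are not orthogonal. *)
have agree C D : C \in circuits N -> D \in cocircuits N ->
    (forall x, x \in pinned f g P K -> C x = None) ->
    (forall x, x \in K -> D x = None) ->
    (forall x, x \in P' -> C x <> Some false) ->
    (forall x, x \in P' -> D x <> Some false) ->
    C f = None \/ C f = Some true /\ D f <> Some false ->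
    D g = None \/ D g = Some true /\ C g <> Some false ->
    C e = Some false -> D e = Some false -> False.
  move=> CC DD CL DK CP DP Cfs Dgs Ce De.
  suff E : D e = None by rewrite E in De.
  apply: (orth_disjoint (covector_orth (cocircuit_covector DD) CC)) => [x Cx Dx|].
    have [E0|xf] := eqVneq x f.
      subst x; case: Cfs => [E|[-> E]]; first by rewrite E in Cx.
      by case: (D f) Dx E => [[]|].
    have [E0|xg] := eqVneq x g.
      subst x; case: Dgs => [E|[-> E]]; first by rewrite E in Dx.
      by case: (C g) Cx E => [[]|].
    have [E0|xP|/DK E|/CL E] := cases x xf xg.
    - by rewrite E0 Ce De.
    - by move: (CP x xP) (DP x xP) Cx Dx; case: (C x) => [[]|]; case: (D x) => [[]|].
    - by rewrite E in Dx.
    - by rewrite E in Cx.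
  by rewrite Ce.
case: del => [/solD[C1 [D1 [C1C D1D [C1f C1L C1e C1P] [D1g D1K D1P] CD1]]]|];
  last first.
  case=> [D [DD Dg DK [DP Df De]]].
  case: con => [/solC[C2 [D2 [C2C D2D [C2f C2L C2P] [D2g D2K D2e D2P] CD2]]]|];
    last first.
    by case=> C [CC Cf CL [CP Cg Ce]]; exfalso; apply: (agree C D) => //; left.
  exists C2, D2; split=> //; [split=> //|split=> //|]; move=> x xP;
    have [->|xe] := eqVneq x e; rewrite ?D2e //.
  - by move=> C2e; apply: (agree C2 D) => //; [right | left].
  - by apply: C2P; rewrite P'E xe.
  - by apply: D2P; rewrite P'E xe.
  - by right.
  - by apply: CD2; rewrite P'E xe.
have [D1e|/eqP D1e] := eqVneq (D1 e) (Some false); last first.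
  exists C1, D1; split=> //; [split=> //|split=> //|]; move=> x xP;
    have [->|xe] := eqVneq x e; rewrite ?C1e //.
  - by apply: C1P; rewrite P'E xe.
  - by apply: D1P; rewrite P'E xe.
  - by left.
  - by apply: CD1; rewrite P'E xe.
case: con => [/solC[C2 [D2 [C2C D2D [C2f C2L C2P] [D2g D2K D2e D2P] CD2]]]|];
  last first.
  by case=> C [CC Cf CL [CP Cg Ce]]; exfalso; apply: (agree C D1) => //; [left | right].
have [C2e|/eqP C2e] := eqVneq (C2 e) (Some false); last first.
  exists C2, D2; split=> //; [split=> //|split=> //|]; move=> x xP;
    have [->|xe] := eqVneq x e; rewrite ?D2e //.
  - by apply: C2P; rewrite P'E xe.
  - by apply: D2P; rewrite P'E xe.
  - by right.
  - by apply: CD2; rewrite P'E xe.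
(* Both solutions are negative at e: Z eliminates f between C1 and - C2. *)
exfalso.
have [||x xf xg|B [bB gB fB C1E D1E]] := complementary_basis gf gg C1C D1D.
- by rewrite C1f.
- by rewrite D1g.
- have [->|/CD1//|/D1K->|/C1L->] := cases x xf xg; [by left| by right| by left].
have [|||Z ZC [Zf Zx]] := circuit_elim (e := f) C1C (circuit_sopp C2C).
- by rewrite soppK => E; rewrite E C2e in C1e.
- by rewrite C1f.
- by rewrite ffunE C1f C2f.
(* Z is not contained in B, so it meets D1 at a point other than f and g,
   where its sign comes from - C2 and is opposite to that of D1. *)
have [z nZz zB] := snd (elimT (indepP _ _) (basis_indep bB)) Z ZC.
have ZC2 x : Z x != None -> C1 x = None -> Z x = omap negb (C2 x).
  by move=> nZ C1x; have [E|->] := Zx x nZ; [rewrite E C1x in nZ|rewrite ffunE].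
have ZC1 x : Z x != None -> C2 x = None -> Z x = C1 x.
  by move=> nZ C2x; have [//|E] := Zx x nZ; rewrite E ffunE C2x in nZ.
have ZL x : x \in pinned f g P K -> Z x = None.
  move=> xL; apply/eqP/negPn/negP=> nZ.
  by have E := ZC1 x nZ (C2L x xL); rewrite E C1L in nZ.
have Zg : Z g = Some true.
  have [//|nZg] := eqVneq (Z g) (Some true); exfalso.
  have : D1 z = None; last first.
    by move=> E; have := D1E z; rewrite E (circuit_ground ZC nZz) zB orbT.
  apply: (orth_disjointN (covector_orth (cocircuit_covector D1D) ZC)) => //.
  move=> x nZ Dx ZD; have [E|xf] := eqVneq x f; first by rewrite E Zf in nZ.
  have [E|xg] := eqVneq x g; first by rewrite -E ZD E D1g in nZg.
  have [E|xP|/D1K E|/ZL E] := cases x xf xg.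
  - by move: ZD; rewrite (ZC2 x nZ) E ?C1e // D1e C2e.
  - have [C1x|E] := CD1 x xP; last by rewrite E in Dx.
    move: (C2P x xP) (D1P x xP) Dx; rewrite -ZD (ZC2 x nZ C1x).
    by case: (C2 x) => [[]|].
  - by rewrite E in Dx.
  - by rewrite E in nZ.
(* Against D2 the signs of Z come from C1 and agree with those of D2. *)
suff E : D2 g = None by rewrite E in D2g.
apply: (orth_disjoint (covector_orth (cocircuit_covector D2D) ZC)); last by rewrite Zg.
move=> x nZ Dx; have [E|xf] := eqVneq x f; first by rewrite E Zf in nZ.
have [->|xg] := eqVneq x g; first by rewrite Zg D2g.
have [E|xP|/D2K E|/ZL E] := cases x xf xg.
- by rewrite E D2e in Dx.
- have [C2x|E] := CD2 x xP; last by rewrite E in Dx.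
  have ZE := ZC1 x nZ C2x.
  move: (C1P x xP) (D2P x xP) Dx nZ; rewrite ZE.
  by case: (C1 x) => [[]|]; case: (D2 x) => [[]|].
- by rewrite E in Dx.
- by rewrite E in nZ.
Qed.
End Programs.

(** * Optimal bases and bounded regions *)

Section Optimal.
Variable T : finType.
Implicit Types (N : omatroid T) (C X Y Z D : signed T) (a b e f g x y : T).
Implicit Types (A B K P : {set T}).

Lemma positive_sdelP e X :
  reflect (forall x, x != e -> X x <> Some false) (positive (sdel e X)).
Proof.
apply: (iffP eqP) => [/setP h x xe Xx|h].
  by have := h x; rewrite !inE ffunE (negPf xe) Xx.
apply/setP=> x; rewrite !inE ffunE; case: (eqVneq x e) => // xe.
by apply/negbTE/eqP; apply: h.
Qed.

Lemma positiveP X : reflect (forall x, X x <> Some false) (positive X).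
Proof.
apply: (iffP eqP) => [/setP h x Xx|h]; first by have := h x; rewrite !inE Xx.
by apply/setP=> x; rewrite !inE; apply/negbTE/eqP; apply: h.
Qed.

Lemma deleteP N f C :
  (C \in circuits (delete N f)) = (C \in circuits N) && (C f == None).
Proof. by rewrite inE in_supp negbK. Qed.

Lemma nonloopP N e C : ~~ loop N e -> C \in circuits N -> C e != None ->
  exists2 x, x != e & C x != None.
Proof.
move=> /exists_inPn nl CC Ce.
have [/existsP[x /andP[xe Cx]]|/existsPn no] :=
  boolP [exists x, (x != e) && (C x != None)]; first by exists x.
case/negP: (nl C CC); apply/eqP/setP=> x; rewrite in_supp inE.
have [->//|xe] := eqVneq x e; by have := no x; rewrite xe /= => /negPf.
Qed.

Lemma indep_contract N e A : e \in ground N -> ~~ loop N e ->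
  independent (contract N e) A = (e \notin A) && independent N (e |: A).
Proof.
move=> eN nl; apply/indepP/andP => [[sA iA]|[eA /indepP[sA iA]]].
  have eA : e \notin A.
    by apply/negP=> /(subsetP sA); rewrite !inE eqxx.
  split=> //; apply/indepP; split.
    rewrite subUset sub1set eN; apply/subsetP=> x /(subsetP sA).
    by rewrite !inE => /andP[].
  move=> C CC; have [x xe Cx] : exists2 x, x != e & C x != None.
    have [x Cx] := circuit_neq0 CC; have [xe|] := eqVneq x e; last by exists x.
    by rewrite xe in Cx; exact: nonloopP nl CC Cx.
  have [V VC [VN Vx VE]] := contract_conformal CC xe Cx.
  have [y] := iA _ VN; rewrite ffunE; have [//|ye] := eqVneq y e => Vy yA.
  by exists y; rewrite -?VE // !inE negb_or ye.
split.
  apply/subsetP=> x xA; have xe : x != e by apply: contraNneq eA => <-.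
  by rewrite !inE xe (subsetP sA) // !inE xA orbT.
move=> _ /contract_circuitP[X XC [_ -> _]]; have [x Xx] := iA X XC.
rewrite !inE negb_or => /andP[xe xA].
by exists x; rewrite // ffunE (negPf xe).
Qed.

Lemma basis_contract N e B : e \in ground N -> ~~ loop N e ->
  basis (contract N e) B = (e \notin B) && basis N (e |: B).
Proof.
move=> eN nl; apply/maxsetP/andP => [[]|[eB /maxsetP[iB mB]]].
  rewrite indep_contract // => /andP[eB iB] mB; split=> //.
  apply/maxsetP; split=> // A iA sBA; have eA : e \in A.
    by rewrite (subsetP sBA) ?setU11.
  rewrite -(setD1K eA); congr (_ |: _); apply: mB.
    by rewrite indep_contract // setD11 setD1K.
  apply/subsetP=> x xB; rewrite !inE (subsetP sBA) ?inE ?xB ?orbT // andbT.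
  by apply: contraNneq eB => <-.
split; first by rewrite indep_contract // eB.
move=> A; rewrite indep_contract // => /andP[eA iA] sBA.
have E : e |: A = e |: B by apply: mB => //; apply: setUS.
by rewrite -(setU1K eA) E setU1K.
Qed.

Lemma basis_exchange_in N e B : basis N B -> e \notin B -> e \in ground N ->
  ~~ loop N e -> exists b B', [/\ b \in B, basis N B', e \in B' &
     forall x, x \in B' -> x = e \/ x \in B /\ x != b].
Proof.
move=> bB eB eN nl; have [FC Fe sF] := fcircuitP bB eN eB.
have [|b be Fb] := nonloopP nl FC; first by rewrite Fe.
have bB' : b \in B by have [E|//] := sF b Fb; rewrite E eqxx in be.
exists b, (e |: B :\ b); split=> //; last 2 first.
- by rewrite setU11.
- by move=> x; rewrite !inE => /orP[/eqP->|/andP[]]; [left | right].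
by apply: (basis_exchange bB eB bB' FC); rewrite ?Fe.
Qed.

(** The forward inclusion rests on [contract_conformal], through
    [covector_contract]; minimality of the support is checked on bases
    containing e, which can be produced by exchange because e is not a loop. *)
Lemma cocircuits_contract N e D : e \in ground N -> ~~ loop N e ->
  (D \in cocircuits (contract N e)) = (D \in cocircuits N) && (D e == None).
Proof.
move=> eN nl; apply/idP/andP => [DD|[DD /eqP De]].
  have De : D e = None.
    apply/eqP/negPn/negP=> /(cocircuit_ground DD).
    by rewrite !inE eqxx.
  split; last exact/eqP.
  have cD := cocircuit_covector DD; rewrite covector_contract // in cD.
  have [x Dx] : exists x, D x != None.
    have [|B bB _] := @basis_ext _ (contract N e) set0.
      apply/indepP; split; first exact: sub0set.
      by move=> C /circuit_neq0[x Cx]; exists x; rewrite ?inE.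
    by have [x _] := cocircuit_meets DD bB; exists x.
  have [B [bB xB DB]] := cocircuit_basis DD Dx.
  have xe : x != e by apply: contraNneq Dx => ->; rewrite De.
  move: bB; rewrite basis_contract // => /andP[eB bB].
  apply: (fcovector_cocircuit bB (b := x)) => //.
  - by rewrite !inE xB orbT.
  - by move=> y; rewrite !inE => /orP[/eqP->//|yB] yx; apply: DB.
  - move=> y yN; apply/eqP/negPn/negP=> /(cocircuit_ground DD).
    by rewrite !inE (negPf yN) andbF.
rewrite inE -/(covector _ _) covector_contract // (cocircuit_covector DD) andbT.
apply/cocircuit_supportP; split=> [B|a].
  rewrite basis_contract // => /andP[eB bB].
  have [x] := cocircuit_meets DD bB; rewrite !inE => /orP[/eqP->|xB Dx].
    by rewrite De.
  by exists x; rewrite ?in_supp.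
rewrite in_supp => Da; have [B [bB aB DB]] := cocircuit_basis DD Da.
have ae : a != e by apply: contraNneq Da => ->; rewrite De.
suff [B' [bB' eB' aB' DB']] : exists B', [/\ basis N B', e \in B', a \in B' &
    forall x, x \in B' -> x != a -> D x = None].
  exists (B' :\ e); split.
  - by rewrite basis_contract // setD11 setD1K.
  - by rewrite !inE ae.
  - move=> x; rewrite !inE => /andP[xe xB'] Dx.
    by apply/eqP/negPn/negP=> xa; rewrite DB' in Dx.
have [eB|eB] := boolP (e \in B); first by exists B.
have [b [B' [_ bB' eB' sB']]] := basis_exchange_in bB eB eN nl.
have DB' x : x \in B' -> x != a -> D x = None.
  by move=> /sB'[->|[xB _]] //; apply: DB.
exists B'; split=> //; apply/negPn/negP=> aB'.
have [x xB' Dx] := cocircuit_meets DD bB'.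
by rewrite DB' // in Dx; apply: contraNneq aB' => <-.
Qed.

Definition optimal N f g B := [/\ basis N B, g \in B, f \notin B,
  forall x, x != g -> fcircuit N B f x <> Some false &
  forall x, x != f -> fcocircuit N B g x <> Some false].

(** Eliminate f between C(B;f) and - C(B';f). Where the resulting circuit
    meets C*(B;g), other than at g, its sign comes from the second circuit
    and is negative; where it meets C*(B';g) the sign comes from the first
    and is positive. The first fact forces the sign + at g, the second
    forbids it. *)
Lemma optimal_unique N f g B B' :
  generic_point N f -> generic_copoint N g -> f \in ground N ->
  optimal N f g B -> optimal N f g B' -> B = B'.
Proof.
move=> gf gg fN [bB gB fB Cp Dp] [bB' gB' fB' Cp' Dp'].
have [CC Cf sC] := fcircuitP bB fN fB.
have [CC' Cf' sC'] := fcircuitP bB' fN fB'.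
have [DD Dg DB _] := fcocircuitP bB gB.
have [DD' Dg' DB' _] := fcocircuitP bB' gB'.
have DE := generic_cocircuit_supp gg bB gB DD.
set C := fcircuit N B f in CC Cf sC Cp *.
set C' := fcircuit N B' f in CC' Cf' sC' Cp' *.
set D := fcocircuit N B g in DD Dg DB Dp DE *.
set D' := fcocircuit N B' g in DD' Dg' DB' Dp' *.
have CD x : x != f -> x != g -> D x != None -> C x = None.
  move=> xf xg Dx; apply/eqP/negPn/negP=> /sC[xf'|xB].
    by rewrite xf' eqxx in xf.
  by rewrite DB in Dx.
have CD' x : x != f -> x != g -> D' x != None -> C' x = None.
  move=> xf xg Dx; apply/eqP/negPn/negP=> /sC'[xf'|xB].
    by rewrite xf' eqxx in xf.
  by rewrite DB' in Dx.
have [E|nCC'] := eqVneq C C'.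
  apply: (basis_sub_eq bB bB'); apply/subsetP=> x xB.
  have xf : x != f by apply: contraNneq fB => <-.
  have : C x != None by apply: (gf B C) => //; rewrite Cf.
  by rewrite E => /sC'[xf'|//]; rewrite xf' eqxx in xf.
have [|||Z ZC [Zf Zx]] := circuit_elim (e := f) CC (circuit_sopp CC').
- by rewrite soppK; apply/eqP.
- by rewrite Cf.
- by rewrite ffunE Cf Cf'.
have [z nZz zB] := snd (elimT (indepP _ _) (basis_indep bB)) Z ZC.
have zf : z != f by apply: contraNneq nZz => ->; rewrite Zf.
have zg : z != g by apply: contraNneq zB => ->.
have ZN x : Z x != None -> x != f -> x != g -> D x != None -> Z x <> D x.
  move=> nZ xf xg Dx ZD; have Cx := CD x xf xg Dx.
  have ZE : Z x = omap negb (C' x).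
    by have [E|->] := Zx x nZ; [rewrite E Cx in nZ | rewrite ffunE].
  by move: (Cp' x xg) (Dp x xf) Dx; rewrite -ZD ZE; case: (C' x) => [[]|].
have ZP x : Z x != None -> x != f -> x != g -> D' x != None -> Z x = D' x.
  move=> nZ xf xg Dx; have Cx := CD' x xf xg Dx.
  have ZE : Z x = C x by have [//|E] := Zx x nZ; rewrite E ffunE Cx in nZ.
  move: (Cp x xg) (Dp' x xf) Dx nZ; rewrite ZE.
  by case: (C x) => [[]|]; case: (D' x) => [[]|].
have Zf' x : Z x != None -> x != f by apply: contraNneq => ->; rewrite Zf.
have Zg : Z g = Some true.
  have [//|nZg] := eqVneq (Z g) (Some true); exfalso.
  have : D z = None; last first.
    have := DE _ DB z; rewrite Dg (circuit_ground ZC nZz) zB orbT.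
    by move=> /(_ isT) Dz E; rewrite E in Dz.
  apply: (orth_disjointN (covector_orth (cocircuit_covector DD) ZC)) => // x nZ Dx.
  have [->|xg] := eqVneq x g; first by rewrite Dg; apply/eqP.
  exact: ZN (Zf' x nZ) xg Dx.
suff E : D' g = None by rewrite E in Dg'.
apply: (orth_disjoint (covector_orth (cocircuit_covector DD') ZC)); last by rewrite Zg.
move=> x nZ Dx; have [->|xg] := eqVneq x g; first by rewrite Zg Dg'.
exact: ZP (Zf' x nZ) xg Dx.
Qed.

Lemma optimal_exists N f g :
  generic_point N f -> generic_copoint N g ->
  f \in ground N -> g \in ground N -> f != g ->
  (forall C, C \in circuits N -> C f = None -> ~ positive C) ->
  (forall D, D \in cocircuits N -> D g = None -> ~ positive D) ->
  exists B, optimal N f g B.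
Proof.
move=> gf gg fN gN fg H1 H2.
have inP x : (x \in ~: [set f; g]) = (x != f) && (x != g).
  by rewrite !inE negb_or.
have [|||||||C [D [CC DD [Cf _ Cp] [Dg _ Dp] CD]]] :=
  @lp_duality _ N f g set0 (~: [set f; g]) gf gg fN gN fg.
- by rewrite inP eqxx.
- by rewrite inP eqxx andbF.
- by rewrite inE.
- by rewrite inE.
- by move=> x _; rewrite inE.
- move=> C CC Cf _ Cp Cg; case: (H1 C CC Cf); apply/positiveP=> x.
  have [->|xf] := eqVneq x f; first by rewrite Cf.
  by have [->//|xg] := eqVneq x g; apply: Cp; rewrite inP xf.
- move=> D DD Dg _ Dp Df; case: (H2 D DD Dg); apply/positiveP=> x.
  have [->|xg] := eqVneq x g; first by rewrite Dg.
  by have [->//|xf] := eqVneq x f; apply: Dp; rewrite inP xf.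
have [||x xf xg|B [bB gB fB CE DE]] := complementary_basis gf gg CC DD.
- by rewrite Cf.
- by rewrite Dg.
- by apply: CD; rewrite inP xf.
exists B; split=> // x xe.
- rewrite -(@fcircuit_eq _ N B f C) //; last first.
    by move=> y; rewrite CE => /orP[/eqP|]; [left|right].
  have [->|xf] := eqVneq x f; first by rewrite Cf.
  by apply: Cp; rewrite inP xf.
- rewrite -(@fcocircuit_eq _ N B g D) //.
  + have [->|xg] := eqVneq x g; first by rewrite Dg.
    by apply: Dp; rewrite inP xe.
  + exact: cocircuit_covector.
  + move=> y yB yg; apply/eqP/negPn.
    by rewrite DE (negPf yg) yB andbF.
  + by move=> y yN; apply/eqP/negPn; rewrite DE (negPf yN).
Qed.

(** A positive circuit avoiding f would be disjoint from C*(B;g), hence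
    contained in B; a positive cocircuit avoiding g would be disjoint from
    C(B;f), hence would miss B. *)
Lemma optimal_bounded N f g B :
  generic_point N f -> generic_copoint N g -> f \in ground N ->
  optimal N f g B ->
  (forall C, C \in circuits N -> C f = None -> ~ positive C) /\
  (forall D, D \in cocircuits N -> D g = None -> ~ positive D).
Proof.
move=> gf gg fN [bB gB fB Cp Dp].
have [CC Cf sC] := fcircuitP bB fN fB; have [DD Dg DB _] := fcocircuitP bB gB.
have cD := cocircuit_covector DD.
split=> [X XC Xf /positiveP Xp|Y YD Yg /positiveP Yp].
  apply: (circuit_notin_indep (basis_indep bB) XC) => x Xx.
  apply/negPn/negP=> xB.
  have Dx : fcocircuit N B g x != None.
    rewrite (generic_cocircuit_supp gg bB gB DD) ?Dg //.
    by rewrite (circuit_ground XC Xx) xB orbT.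
  have Dx0 : fcocircuit N B g x = None; last by rewrite Dx0 in Dx.
  apply: (orth_disjoint (covector_orth cD XC)) => // y Xy Dy.
  have yf : y != f by apply: contraNneq Xy => ->; rewrite Xf.
  by move: (Xp y) (Dp y yf) Xy Dy; case: (X y) => [[]|];
    case: (fcocircuit N B g y) => [[]|].
have [x xB Yx] := cocircuit_meets YD bB.
have Yx0 : Y x = None; last by rewrite Yx0 in Yx.
apply: (orth_disjoint (covector_orth (cocircuit_covector YD) CC)).
  move=> y Cy Yy; have yg : y != g by apply: contraNneq Yy => ->; rewrite Yg.
  by move: (Yp y) (Cp y yg) Cy Yy; case: (Y y) => [[]|];
    case: (fcircuit N B f y) => [[]|].
by apply: (gf B) => //; rewrite Cf.
Qed.

Lemma bounded_optimal N f g :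
  generic_point N f -> generic_copoint N g ->
  f \in ground N -> g \in ground N -> f != g -> ~~ loop N g ->
  reflect (exists B, optimal N f g B)
    (acyclic (delete N f) && totally_cyclic (contract N g)).
Proof.
move=> gf gg fN gN fg nl; apply: (iffP andP) => [[/forall_inP a /forall_inP t]|].
  apply: optimal_exists => // [C CC Cf|D DD Dg]; apply/negP.
    by apply: a; rewrite deleteP CC Cf.
  by apply: t; rewrite cocircuits_contract // DD Dg.
case=> B oB; have [H1 H2] := optimal_bounded gf gg fN oB; split.
  by apply/forall_inP=> C; rewrite deleteP => /andP[CC /eqP Cf]; apply/negP/H1.
apply/forall_inP=> D; rewrite cocircuits_contract // => /andP[DD /eqP Dg].
exact/negP/H2.
Qed.

End Optimal.

(** * Reorientation *)

Section Reorientation.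
Variable T : finType.
Implicit Types (N : omatroid T) (C X Y Z D : signed T) (a b e f g x y : T).
Implicit Types (A B K P : {set T}).

Lemma sreorientK A : involutive (@sreorient T A).
Proof.
by move=> X; apply/ffunP=> x; rewrite !ffunE; case: (x \in A); rewrite ?negbK_omap.
Qed.

Lemma sreorient_eq0 A X x : (sreorient A X x == None) = (X x == None).
Proof. by rewrite ffunE; case: (x \in A); case: (X x). Qed.

Lemma circuits_reorient N A C :
  (C \in circuits (reorient N A)) = (sreorient A C \in circuits N).
Proof.
apply/imsetP/idP => [[X XC ->]|CC]; first by rewrite sreorientK.
by exists (sreorient A C); rewrite ?sreorientK.
Qed.

Lemma indep_reorient N A B : independent (reorient N A) B = independent N B.
Proof.
apply/indepP/indepP => -[sB iB]; split=> // C CC.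
  have [|x] := iB (sreorient A C); first by rewrite circuits_reorient sreorientK.
  by rewrite sreorient_eq0; exists x.
have [|x] := iB (sreorient A C); first by rewrite -circuits_reorient.
by rewrite sreorient_eq0; exists x.
Qed.

Lemma basis_reorient N A B : basis (reorient N A) B = basis N B.
Proof.
by apply: maxset_eq => C; apply: indep_reorient.
Qed.

Lemma bases_reorient N A : bases (reorient N A) = bases N.
Proof. by apply/setP=> B; rewrite !inE basis_reorient. Qed.

Lemma orth_reorient A X Y : orth (sreorient A X) (sreorient A Y) = orth X Y.
Proof.
have sub F G : orth F G -> orth (sreorient A F) (sreorient A G).
  move=> oFG; apply: orthI => x; rewrite sreorient_eq0 => Fx E.
    have FG : F x = G x.
      by move: E; rewrite !ffunE; case: (x \in A) => //;
        case: (F x) => [[]|]; case: (G x) => [[]|].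
    have [|y [_ Fy Gy nE]] := orth_at oFG Fx; first by rewrite -FG.
    exists y; rewrite ?sreorient_eq0 // !ffunE.
    by move: Fy Gy nE; rewrite FG eqxx; case: (y \in A);
      case: (F y) => [[]|]; case: (G y) => [[]|].
  have FG : F x = omap negb (G x).
    by move: E; rewrite !ffunE; case: (x \in A) => //;
      case: (F x) => [[]|]; case: (G x) => [[]|].
  have [|y [_ Fy Gy nE]] := orth_at oFG Fx; first by move: Fx; rewrite FG; case: (G x).
  exists y; rewrite ?sreorient_eq0 // !ffunE.
  by move: Fy Gy nE Fx; rewrite FG; case: (y \in A);
    case: (F y) => [[]|]; case: (G y) => [[]|]; case: (G x) => [[]|].
by apply/idP/idP=> [/sub|]; [rewrite !sreorientK | apply: sub].
Qed.

Lemma covector_reorient N A D :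
  covector (reorient N A) D = covector N (sreorient A D).
Proof.
apply/forall_inP/forall_inP => h C CC.
  rewrite -(orth_reorient A) sreorientK; apply: h.
  by rewrite circuits_reorient sreorientK.
by rewrite -(orth_reorient A); apply: h; rewrite -circuits_reorient.
Qed.

Lemma cocircuits_reorient N A D :
  (D \in cocircuits (reorient N A)) = (sreorient A D \in cocircuits N).
Proof.
rewrite !inE -!/(covector _ _) covector_reorient; congr (_ && _).
have -> : supp (sreorient A D) = supp D.
  by apply/setP=> x; rewrite !in_supp sreorient_eq0.
by rewrite /cocircuit_support bases_reorient.
Qed.

Lemma fcircuit_reorient N A B e : basis N B -> e \in ground N -> e \notin B ->
  e \notin A -> fcircuit (reorient N A) B e = sreorient A (fcircuit N B e).
Proof.
move=> bB eN eB eA; have [CC Ce sC] := fcircuitP bB eN eB.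
apply/esym/fcircuit_eq; rewrite ?basis_reorient //.
- by rewrite circuits_reorient sreorientK.
- by rewrite ffunE (negPf eA).
- by move=> x; rewrite sreorient_eq0; apply: sC.
Qed.

Lemma fcocircuit_reorient N A B b : basis N B -> b \in B -> b \notin A ->
  fcocircuit (reorient N A) B b = sreorient A (fcocircuit N B b).
Proof.
move=> bB bB' bA; have [DD Db DB gD] := fcocircuitP bB bB'.
apply/esym/fcocircuit_eq; rewrite ?basis_reorient //.
- by rewrite covector_reorient sreorientK; apply: cocircuit_covector.
- by rewrite ffunE (negPf bA).
- by move=> x xB xb; apply/eqP; rewrite sreorient_eq0 DB.
- by move=> x xN; apply/eqP; rewrite sreorient_eq0 gD.
Qed.

Lemma generic_point_reorient N A f :
  generic_point N f -> generic_point (reorient N A) f.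
Proof.
move=> gf B C; rewrite basis_reorient circuits_reorient => bB fB CC Cf sC x xB.
rewrite -(sreorient_eq0 A); apply: (gf B) => //; rewrite ?sreorient_eq0 //.
by move=> y; rewrite sreorient_eq0; apply: sC.
Qed.

Lemma generic_copoint_reorient N A g :
  generic_copoint N g -> generic_copoint (reorient N A) g.
Proof.
move=> gg B e C; rewrite basis_reorient circuits_reorient => bB gB eB CC Ce sC.
rewrite -(sreorient_eq0 A); apply: (gg B e) => //; rewrite ?sreorient_eq0 //.
by move=> y; rewrite sreorient_eq0; apply: sC.
Qed.

Lemma loop_reorient N A e : loop (reorient N A) e = loop N e.
Proof.
have sE C : supp (sreorient A C) = supp C.
  by apply/setP=> x; rewrite !in_supp sreorient_eq0.
apply/exists_inP/exists_inP => -[C CC /eqP Ce]; exists (sreorient A C);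
  rewrite ?sE ?Ce //; first by rewrite -circuits_reorient.
by rewrite circuits_reorient sreorientK.
Qed.

End Reorientation.

(** * The bijection between bounded regions and bases *)

Section Regions.
Variable T : finType.
Variables (N : omatroid T) (f g : T).
Hypotheses (gf : generic_point N f) (gg : generic_copoint N g).
Hypotheses (fN : f \in ground N) (gN : g \in ground N) (fg : f != g).
Hypothesis nlg : ~~ loop N g.
Implicit Types (C D X : signed T) (A B : {set T}) (x y e b : T).

Lemma bounded_regionsP A :
  reflect ([/\ A \subset ground N, f \notin A & g \notin A] /\
           exists B, optimal (reorient N A) f g B)
          (A \in bounded_regions N f g).
Proof.
have bo := @bounded_optimal _ (reorient N A) f g (generic_point_reorient gf)
  (generic_copoint_reorient gg) fN gN fg.
rewrite loop_reorient in bo; rewrite inE.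
apply: (iffP and4P) => [[sA fA gA /bo h]|[[sA fA gA] /bo h]]; split=> //.
  by apply: h.
by apply: h.
Qed.

Lemma gbasesP B : reflect [/\ basis N B, g \in B & f \notin B]
  (B \in bases_with_without N g f).
Proof. by rewrite !inE; apply: and3P. Qed.

Lemma associated_optimal A B : B \in bases_with_without N g f ->
  reflect (optimal (reorient N A) f g B) (associated N f g A B).
Proof.
case/gbasesP=> bB gB fB.
apply: (iffP andP) => [[/positive_sdelP Dp /positive_sdelP Cp]|[_ _ _ Cp Dp]].
  by split=> //; rewrite basis_reorient.
by split; apply/positive_sdelP.
Qed.

Lemma optimal_gbases A B : optimal (reorient N A) f g B ->
  B \in bases_with_without N g f.
Proof. by case; rewrite basis_reorient => *; apply/gbasesP. Qed.

Lemma optimal_basisP A B :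
  reflect (optimal (reorient N A) f g B) (optimal_basis (reorient N A) g f B).
Proof.
apply: (iffP and5P) => -[bB gB fB].
  by move=> /positive_sdelP Dp /positive_sdelP Cp.
by move=> Cp Dp; split=> //; apply/positive_sdelP.
Qed.

Lemma optimal_uniq A B B' : optimal (reorient N A) f g B ->
  optimal (reorient N A) f g B' -> B = B'.
Proof.
apply: optimal_unique => //.
  exact: generic_point_reorient.
exact: generic_copoint_reorient.
Qed.

(** C(B;f) covers B and C*(B;g) covers the rest, both with full support, so
    this single vector records all the signs relevant to optimality. *)
Definition basis_sign B x :=
  if x \in B then fcircuit N B f x else fcocircuit N B g x.

Lemma basis_sign_neq0 B x : basis N B -> g \in B -> f \notin B ->
  x \in ground N -> basis_sign B x != None.
Proof.
move=> bB gB fB xN; rewrite /basis_sign; case: ifPn => xB.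
  have [CC Cf sC] := fcircuitP bB fN fB.
  by apply: (gf bB fB CC) => //; rewrite Cf.
have [DD Dg DB _] := fcocircuitP bB gB.
by rewrite (generic_cocircuit_supp gg bB gB DD) ?Dg // xN xB orbT.
Qed.

(** Optimality in the reorientation determines A from B: the elements to
    reorient are those with a negative prescribed sign. *)
Lemma associatedP A B : B \in bases_with_without N g f ->
  f \notin A -> g \notin A ->
  (associated N f g A B <-> forall x, x \in ground N -> x != f -> x != g ->
     basis_sign B x = Some (x \notin A)).
Proof.
move=> BG fA gA; have [bB gB fB] := gbasesP _ BG.
have [CC Cf sC] := fcircuitP bB fN fB.
have [DD Dg DB gD] := fcocircuitP bB gB.
have sgn (u : option bool) x : u != None ->
    (if x \in A then omap negb u else u) <> Some false <->
    u = Some (x \notin A).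
  by case: (x \in A); case: u => [[]|].
split=> [/(associated_optimal _ BG)[_ _ _ Cp Dp] x xN xf xg|h].
  have := basis_sign_neq0 bB gB fB xN.
  rewrite /basis_sign; case: ifPn => xB /(sgn _ x) h0; apply/h0.
    by have := Cp x xg; rewrite fcircuit_reorient // ffunE.
  by have := Dp x xf; rewrite fcocircuit_reorient // ffunE.
apply/(associated_optimal _ BG); split=> //; first by rewrite basis_reorient.
  move=> x xg; rewrite fcircuit_reorient // ffunE.
  have [->|xf] := eqVneq x f; first by rewrite (negPf fA) Cf.
  have [xB|xB] := boolP (x \in B); last first.
    have -> : fcircuit N B f x = None; last by case: ifP.
    apply/eqP/negPn/negP=> /sC[xf'|xB'].
      by rewrite xf' eqxx in xf.
    by rewrite xB' in xB.
  have xN := basis_ground bB xB; have := h x xN xf xg.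
  by have := basis_sign_neq0 bB gB fB xN; rewrite /basis_sign xB => /(sgn _ x) h0 /h0.
move=> x xf; rewrite fcocircuit_reorient // ffunE.
have [->|xg] := eqVneq x g; first by rewrite (negPf gA) Dg.
have [xB|xB] := boolP (x \in B); first by rewrite DB //; case: ifP.
have [xN|xN] := boolP (x \in ground N); last by rewrite gD //; case: ifP.
have := h x xN xf xg.
by have := basis_sign_neq0 bB gB fB xN; rewrite /basis_sign (negPf xB) => /(sgn _ x) h0 /h0.
Qed.

Lemma associated_exists B : B \in bases_with_without N g f ->
  exists! A : {set T}, A \subset ground N :\: [set f; g] /\ associated N f g A B.
Proof.
move=> BG; have [bB gB fB] := gbasesP _ BG.
pose A := [set x in ground N :\: [set f; g] | basis_sign B x == Some false].
have sA (A' : {set T}) : A' \subset ground N :\: [set f; g] ->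
    [/\ f \notin A', g \notin A' & forall x, x \in A' ->
        [/\ x \in ground N, x != f & x != g]].
  move=> /subsetP sA'; split.
  - by apply/negP=> /sA'; rewrite !inE eqxx.
  - by apply/negP=> /sA'; rewrite !inE eqxx orbT.
  - by move=> x /sA'; rewrite !inE negb_or => /andP[/andP[]].
have sAA : A \subset ground N :\: [set f; g].
  by apply/subsetP=> x; rewrite inE => /andP[].
have [fA gA _] := sA A sAA.
exists A; split=> [|A' [/sA[fA' gA' sA']]].
  split=> //; apply/associatedP => // x xN xf xg.
  have := basis_sign_neq0 bB gB fB xN.
  rewrite !inE negb_or xN xf xg /=.
  by case: (basis_sign B x) => [[]|].
move/(associatedP BG fA' gA') => h; apply/setP=> x; rewrite !inE negb_or.
have [xA|xA] := boolP (x \in A').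
  have [xN xf xg] := sA' x xA.
  by rewrite xN xf xg h // xA.
apply/negP=> /andP[/andP[/andP[xf xg] xN]].
by rewrite h // xA.
Qed.

Lemma region_basisP A : A \in bounded_regions N f g ->
  region_basis N f g A \in bases_with_without N g f /\
  associated N f g A (region_basis N f g A).
Proof.
case/bounded_regionsP=> _ [B oB]; rewrite /region_basis; case: pickP => [B'|/(_ B)].
  by case/andP.
have BG := optimal_gbases oB.
by rewrite BG /=; move/negP; case; apply/associated_optimal.
Qed.

Lemma region_basis_eq A B : A \in bounded_regions N f g ->
  optimal (reorient N A) f g B <-> B = region_basis N f g A.
Proof.
move=> AR; have [BG /(associated_optimal _ BG) oB] := region_basisP AR.
by split=> [/optimal_uniq/(_ oB)|->].
Qed.

Section FullyOptimal.
Variable r : rel T.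
Hypothesis lr : linear_order_on (ground N) r.
Hypothesis rg : forall e, e \in ground N -> r g e.
Hypothesis rf : forall e, e \in ground N -> e != g -> r f e.

Lemma min_supp_eq x0 X m : X m != None ->
  (forall x, X x != None -> x \in ground N) ->
  (forall x, X x != None -> r m x) -> min_supp r x0 X = m.
Proof.
move=> Xm XN rm; have [_ anti _ _] := lr.
rewrite /min_supp /extremum; case: pickP => [y|/(_ m)] /=.
  rewrite in_supp => /andP[Xy /forallP/(_ m)/implyP].
  rewrite in_supp => /(_ Xm) ry.
  by apply: anti; rewrite ?XN // ry rm.
rewrite in_supp Xm /=; case/forallP=> x; apply/implyP.
by rewrite in_supp => /rm.
Qed.

(** For a basis containing g but not f, genericity makes g the minimum of
    every C(B;e) and f the minimum of every C*(B;b) with b other than g. So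
    condition (a) says that C*(B;g) is positive, including at f, and (b) that
    C(B;f) is positive off g. A basis without g fails (a) at e = g, whose
    minimum is itself; a basis with f fails (b) at b = f. *)
Lemma fully_optimalP A B : g \notin A -> f \notin A ->
  reflect (optimal (reorient N A) f g B /\ fcocircuit (reorient N A) B g f = Some true)
          (fully_optimal r g (reorient N A) B).
Proof.
move=> gA fA; pose N' := reorient N A; rewrite -/N'.
have gf' : generic_point N' f by apply: generic_point_reorient.
have gg' : generic_copoint N' g by apply: generic_copoint_reorient.
have fN' : f \in ground N' by [].
have gN' : g \in ground N' by [].
apply: (iffP and3P) => [[bB /forall_inP ha /forall_inP hb]|[[bB gB fB Cp Dp] Df]].
  have gB : g \in B.
    apply/negPn/negP=> gB; have := ha g; rewrite inE gB gN' => /(_ isT) /=.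
    have [CC Cg sC] := fcircuitP bB gN' gB.
    rewrite (@min_supp_eq _ _ g) ?Cg //.
    - by rewrite /opposite_signs Cg.
    - by move=> x; apply: circuit_ground CC.
    - by move=> x /(circuit_ground CC); apply: rg.
  have fB : f \notin B.
    apply/negP=> fB; have := hb f; rewrite !inE fg fB => /(_ isT) /=.
    have [DD Df DB gD] := fcocircuitP bB fB.
    rewrite (@min_supp_eq _ _ f) ?Df //.
    - by rewrite /opposite_signs Df.
    - by move=> x; apply: cocircuit_ground DD.
    - move=> x Dx; apply: rf; first exact: cocircuit_ground DD Dx.
      by apply: contraNneq Dx => ->; rewrite DB // eq_sym.
  have [CC Cf sC] := fcircuitP bB fN' fB.
  have [DD Dg DB gD] := fcocircuitP bB gB.
  (* Condition (a) makes C*(B;g) positive. *)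
  have Dp x : x \in ground N' -> x \notin B -> fcocircuit N' B g x = Some true.
    move=> xN xB; have := ha x; rewrite inE xB xN => /(_ isT) /=.
    have [FC Fx sF] := fcircuitP bB xN xB.
    have Fg : fcircuit N' B x g != None by apply: (gg' B x); rewrite ?Fx.
    rewrite (@min_supp_eq _ _ g) //.
    - rewrite /opposite_signs Fx /= => /eqP E.
      by rewrite (covector_fcircuit bB gB (cocircuit_covector DD)) // E.
    - by move=> y; apply: circuit_ground FC.
    - by move=> y /(circuit_ground FC); apply: rg.
  split; last exact: Dp.
  split=> // x xe.
    have [xB|xB] := boolP (x \in B); last first.
      move=> E; have [|xf|] := sC x; rewrite ?E //; last by rewrite (negPf xB).
      by rewrite xf Cf in E.
    have := hb x; rewrite !inE xe xB => /(_ isT) /=.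
    have [FD Fx FB gF] := fcocircuitP bB xB.
    have Cx : fcircuit N' B f x != None by apply: (gf' B) => //; rewrite Cf.
    have Ff := covector_fcircuit bB xB (cocircuit_covector FD) Fx FB fN' fB.
    rewrite (@min_supp_eq _ _ f).
    - by rewrite /opposite_signs Fx Ff /=; case: (fcircuit N' B f x) => [[]|].
    - by rewrite Ff; case: (fcircuit N' B f x) Cx.
    - by move=> y; apply: cocircuit_ground FD.
    - move=> y Fy; apply: rf; first exact: cocircuit_ground FD Fy.
      by apply: contraNneq Fy => ->; rewrite FB // eq_sym.
  have [xB|xB] := boolP (x \in B).
    by have [->|xg] := eqVneq x g; [rewrite Dg | rewrite DB].
  have [xN|xN] := boolP (x \in ground N'); last by rewrite gD.
  by rewrite Dp.
have [CC Cf sC] := fcircuitP bB fN' fB.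
have [DD Dg DB gD] := fcocircuitP bB gB.
have DE := generic_cocircuit_supp gg' bB gB DD _ DB.
rewrite Dg in DE; move/(_ isT): DE => DE.
split=> //; apply/forall_inP=> x.
  rewrite inE => /andP[xB xN].
  have [FC Fx sF] := fcircuitP bB xN xB.
  have Fg : fcircuit N' B x g != None by apply: (gg' B x); rewrite ?Fx.
  rewrite /= (@min_supp_eq _ _ g) //.
  - have := covector_fcircuit bB gB (cocircuit_covector DD) Dg DB xN xB.
    have -> : fcocircuit N' B g x = Some true.
      have [->//|xf] := eqVneq x f.
      by have := DE x; have := Dp x xf; rewrite xN xB orbT;
        case: (fcocircuit N' B g x) => [[]|].
    by rewrite /opposite_signs Fx; case: (fcircuit N' B x g) => [[]|].
  - by move=> y; apply: circuit_ground FC.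
  - by move=> y /(circuit_ground FC); apply: rg.
rewrite !inE => /andP[xg xB].
have [FD Fx FB gF] := fcocircuitP bB xB.
have Cx : fcircuit N' B f x != None by apply: (gf' B) => //; rewrite Cf.
have Ff := covector_fcircuit bB xB (cocircuit_covector FD) Fx FB fN' fB.
rewrite /= (@min_supp_eq _ _ f).
- rewrite /opposite_signs Fx Ff /=; have := Cp x xg.
  by case: (fcircuit N' B f x) Cx => [[]|].
- by rewrite Ff; case: (fcircuit N' B f x) Cx.
- by move=> y; apply: cocircuit_ground FD.
- move=> y Fy; apply: rf; first exact: cocircuit_ground FD Fy.
  by apply: contraNneq Fy => ->; rewrite FB // eq_sym.
Qed.

End FullyOptimal.

Section Compliant.
(* Compliance supplies the one sign that optimality leaves open, that of
   C*(B;g) at f. *)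
Hypothesis cmp : compliant N f g.

Lemma compliant_optimal A B : f \notin A -> g \notin A ->
  optimal (reorient N A) f g B ->
  fcocircuit (reorient N A) B g f = Some true.
Proof.
move=> fA gA [bB gB fB _ Dp]; rewrite basis_reorient in bB.
have [DD Dg DB _] := fcocircuitP bB gB.
rewrite fcocircuit_reorient // ffunE (negPf fA).
have := generic_cocircuit_supp gg bB gB DD; rewrite Dg => /(_ isT DB f).
rewrite fN fB orbT; have := forall_inP cmp _ DD; rewrite Dg eqxx /=.
by case: (fcocircuit N B g f) => [[]|].
Qed.

(** From right to left the point is that f is not reoriented. Duality applies
    to the reorientation in any case; if f were in A, compliance would make
    C*(B;g) negative at f, hence C(B;f) positive at g too, a positive
    circuit. *)
Lemma compliant_bounded A : A \subset ground N -> g \notin A ->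
  (A \in bounded_regions N f g <-> bounded (reorient N A) g).
Proof.
move=> sA gA; pose N' := reorient N A.
have gf' : generic_point N' f by apply: generic_point_reorient.
have gg' : generic_copoint N' g by apply: generic_copoint_reorient.
split=> [/bounded_regionsP[[_ fA _] [B oB]]|/andP[/forall_inP a /forall_inP t]].
  have Df := compliant_optimal fA gA oB.
  have [_ H2] := optimal_bounded gf' gg' fN oB.
  case: (oB) => bB gB fB Cp Dp; have [DD Dg DB _] := fcocircuitP bB gB.
  apply/andP; split; apply/forall_inP; last first.
    move=> D DD'; apply/implyP=> Dpos; rewrite in_supp.
    by apply/negP=> /eqP Dg0; case: (H2 D DD' Dg0).
  move=> X XC; apply/negP=> /positiveP Xp.
  apply: (circuit_notin_indep (basis_indep bB) XC) => x Xx.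
  apply/negPn/negP=> xB.
  have Dx : fcocircuit N' B g x != None.
    rewrite (generic_cocircuit_supp gg' bB gB DD) ?Dg //.
    by rewrite (circuit_ground XC Xx) xB orbT.
  have Dx0 : fcocircuit N' B g x = None; last by rewrite Dx0 in Dx.
  apply: (orth_disjoint (covector_orth (cocircuit_covector DD) XC)) => // y Xy Dy.
  have Dpy : fcocircuit N' B g y <> Some false.
    have [->|] := eqVneq y f; last exact: Dp.
    by rewrite Df.
  by move: (Xp y) Dpy Xy Dy; case: (X y) => [[]|];
    case: (fcocircuit N' B g y) => [[]|].
have [C CC _|D DD Dg Dp|B oB] := optimal_exists gf' gg' fN gN fg.
- exact/negP/a.
- by have /implyP/(_ Dp) := t D DD; rewrite in_supp Dg.
apply/bounded_regionsP; split; last by exists B.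
split=> //; apply/negP=> fA.
case: (oB) => bB gB fB Cp Dp; have [DD Dg DB _] := fcocircuitP bB gB.
have [CC Cf sC] := fcircuitP (bB : basis N' B) fN fB.
have Df : fcocircuit N' B g f = Some false.
  have := DD; rewrite cocircuits_reorient => /(forall_inP cmp).
  rewrite !ffunE (negPf gA) Dg fA eqxx /=.
  have := generic_cocircuit_supp gg' bB gB DD; rewrite Dg => /(_ isT DB f).
  rewrite fN fB orbT; case: (fcocircuit N' B g f) => [[]|] //.
case/negP: (a _ CC); apply/positiveP=> x.
have [->|xg] := eqVneq x g; last exact: Cp.
have := covector_fcircuit bB gB (cocircuit_covector DD) Dg DB fN fB.
by rewrite Df; case: (fcircuit N' B f g) => [[]|].
Qed.

End Compliant.
End Regions.

(** * Elimination from orthogonality *)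

Section Painting.
Variable T : finType.
Variable Cs : {set signed T}.
Implicit Types (C X Y Z D : signed T) (a e x : T) (K P : {set T}).

Definition orth_all D := forall C, C \in Cs -> orth C D.

Hypothesis Cs_sopp : forall C, C \in Cs -> sopp C \in Cs.
(* The unsigned alternative: a is spanned by K, or separated from it. *)
Hypothesis Cs_dichotomy : forall a K, a \notin K ->
  (exists2 C, C \in Cs & C a != None /\ forall x, C x != None -> x = a \/ x \in K)
  \/ (exists2 D, orth_all D & D a != None /\ forall x, x \in K -> D x = None).

Lemma orth_all_sopp D : orth_all D -> orth_all (sopp D).
Proof.
move=> oD C CC; apply: orthI => x Cx; rewrite ffunE => E.
  have [|y [_ Cy Dy nE]] := orth_at (oD C CC) Cx.
    by move: Cx; rewrite E; case: (D x).
  exists y; rewrite ?ffunE ?negbK_omap //; apply/eqP; rewrite nE E.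
  by move: Cx; rewrite E; case: (D x) => [[]|].
rewrite negbK_omap in E; have [|y [_ Cy Dy nE]] := orth_at (oD C CC) Cx.
  by rewrite -E.
exists y; rewrite ?ffunE //; move: Cy Dy nE; rewrite E eqxx.
by case: (C y) => [[]|]; case: (D y) => [[]|].
Qed.

(** The colouring lemma of Minty. An element e of P is moved to the free
    elements of the circuit or to those of the covector. Of the two outcomes,
    one is immediately a solution unless a circuit and a covector both have
    the wrong sign at e; then they agree on their common support, which
    contains a and e, against orthogonality. *)
Lemma painting (s : T -> bool) a K P :
  a \notin P -> a \notin K -> (forall x, x \in P -> x \notin K) ->
  (exists2 C, C \in Cs & [/\ C a = Some (s a),
     forall x, x \in P -> C x <> Some (~~ s x) &
     forall x, x != a -> x \notin P -> x \notin K -> C x = None]) \/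
  (exists2 D, orth_all D & [/\ D a = Some (s a),
     forall x, x \in P -> D x <> Some (~~ s x) &
     forall x, x \in K -> D x = None]).
Proof.
have [n le_n] : exists n, #|P| <= n by exists #|P|.
elim: n K P le_n => [|n IH] K P le_n aP aK PK.
  have P0 x : x \in P = false.
    by move: le_n; rewrite leqn0 cards_eq0 => /eqP->; rewrite inE.
  have [[C CC [Ca sC]]|[D oD [Da DK]]] := Cs_dichotomy aK; [left | right].
    have C0 x : x != a -> x \notin K -> C x = None.
      move=> xa xK; apply/eqP/negPn/negP=> /sC[xa'|xK'].
        by rewrite xa' eqxx in xa.
      by rewrite xK' in xK.
    have [Es|ns] := eqVneq (C a) (Some (s a)).
      by exists C => //; split=> // x; [rewrite P0 | move=> xa _; apply: C0].
    exists (sopp C); first exact: Cs_sopp.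
    split=> [|x|x xa _ xK]; rewrite ?P0 // ffunE.
      by move: Ca ns; case: (C a) => [[]|]; case: (s a).
    by rewrite C0.
  have [Es|ns] := eqVneq (D a) (Some (s a)).
    by exists D => //; split=> // x; rewrite P0.
  exists (sopp D); first exact: orth_all_sopp.
  split=> [|x|x xK]; rewrite ?P0 // ffunE.
    by move: Da ns; case: (D a) => [[]|]; case: (s a).
  by rewrite DK.
have [P0|[e eP]] := set_0Vmem P.
  by apply: IH => //; rewrite P0 cards0.
have ea : e != a by apply: contraNneq aP => <-.
have eK := PK e eP.
have P'E x : (x \in P :\ e) = (x != e) && (x \in P) by rewrite !inE.
have le_n' : #|P :\ e| <= n.
  by rewrite -ltnS; apply: leq_trans le_n; rewrite [in leqRHS](cardsD1 e) eP.
have aP' : a \notin P :\ e by rewrite P'E negb_and aP orbT.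
have [||[C CC [Ca CP C0]]|[D oD [Da DP DK]]] := IH (e |: K) (P :\ e) le_n' aP'.
- by rewrite !inE negb_or eq_sym ea.
- by move=> x; rewrite !inE negb_or => /andP[-> /PK].
- have C0' x : x != a -> x \notin P -> x \notin K -> C x = None.
    move=> xa xP xK; apply: C0 => //; first by rewrite P'E negb_and xP orbT.
    by rewrite !inE negb_or xK andbT; apply: contraNneq xP => ->.
  have [Ce|/eqP Ce] := eqVneq (C e) (Some (~~ s e)); last first.
    left; exists C => //; split=> // x xP.
    by have [->//|xe] := eqVneq x e; apply: CP; rewrite P'E xe.
  have [|[C2 C2C [C2a C2P C20]]|[D oD [Da DP DK]]] := IH K (P :\ e) le_n' aP' aK.
  + by move=> x; rewrite P'E => /andP[_ /PK].
  + have C2e : C2 e = None by apply: C20; rewrite // P'E eqxx.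
    left; exists C2 => //; split=> // x.
      by have [->|xe xP] := eqVneq x e; [rewrite C2e | apply: C2P; rewrite P'E xe].
    by move=> xa xP xK; apply: C20; rewrite // P'E negb_and xP orbT.
  + have [De|/eqP De] := eqVneq (D e) (Some (~~ s e)); last first.
      right; exists D => //; split=> // x xP.
      by have [->//|xe] := eqVneq x e; apply: DP; rewrite P'E xe.
    suff E : D a = None by rewrite E in Da.
    apply: (orth_disjoint (oD C CC)); last by rewrite Ca.
    move=> x Cx Dx; have [->|xa] := eqVneq x a; first by rewrite Ca Da.
    have [->|xe] := eqVneq x e; first by rewrite Ce De.
    have [xP|xP] := boolP (x \in P :\ e).
      move: (CP x xP) (DP x xP) Cx Dx.
      by case: (C x) => [[]|]; case: (D x) => [[]|]; case: (s x).
    have [/DK E|xK] := boolP (x \in K); first by rewrite E in Dx.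
    by rewrite C0 // !inE negb_or xe in Cx.
- have De : D e = None by apply: DK; rewrite setU11.
  right; exists D => //; split=> // x.
    by have [->|xe xP] := eqVneq x e; [rewrite De | apply: DP; rewrite P'E xe].
  by move=> xK; apply: DK; rewrite !inE xK orbT.
Qed.

(** The signs are prescribed on the elements where X and Y do not disagree,
    left free where they do, and e and everything else is excluded. A
    covector as second outcome of [painting] would have to be opposite to X
    or Y at e, hence to agree with the other one everywhere. *)
Lemma painting_elim X Y e : X \in Cs -> Y \in Cs -> X <> sopp Y ->
  X e != None -> Y e = omap negb (X e) ->
  exists2 Z, Z \in Cs & Z e = None /\
    forall x, Z x != None -> Z x = X x \/ Z x = Y x.
Proof.
move=> XC YC nXY Xe Ye.
pose s x := if X x is Some b then b else odflt true (Y x).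
pose K := [set x | [&& x != e, X x != None & Y x == omap negb (X x)]].
pose P0 := [set x | [&& x != e, x \notin K & (X x != None) || (Y x != None)]].
have [a aP0] : exists a, a \in P0.
  apply/set0Pn/negP=> /eqP/setP P00; apply: nXY; apply/ffunP=> x.
  rewrite ffunE; have [->|xe] := eqVneq x e; first by rewrite Ye negbK_omap.
  have := P00 x; rewrite !inE xe /=.
  case: (X x) => [b|] /=; last by case: (Y x).
  by rewrite andbT => /negbFE/eqP->; rewrite /= negbK.
have sP x : x \in P0 -> (X x != None -> X x = Some (s x)) /\
    (Y x != None -> Y x = Some (s x)).
  rewrite !inE /s => /and3P[-> /=].
  by case: (X x) => [[]|]; case: (Y x) => [[]|].
have [||| [Z ZC [Za ZP Z0]]|[D oD [Da DP DK]]] := @painting s a K (P0 :\ a).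
- by rewrite !inE eqxx.
- by move: aP0; rewrite inE => /and3P[].
- by move=> x; rewrite 2!inE => /andP[_]; rewrite inE => /and3P[].
- have ae : a != e by move: aP0; rewrite inE => /andP[].
  exists Z => //; split.
    by apply: Z0; rewrite 1?eq_sym // !inE ?eqxx ?andbF.
  move=> x Zx; have [xK|xK] := boolP (x \in K).
    move: xK; rewrite inE => /and3P[_ Xx /eqP->].
    by move: Zx Xx; case: (Z x) => [[]|]; case: (X x) => [[]|] //; auto.
  have [xP|xP] := boolP (x \in P0); last first.
    by rewrite Z0 // in Zx; [apply: contraNneq xP => -> | rewrite inE negb_and xP orbT].
  have Zs : Z x = Some (s x).
    have [->//|xa] := eqVneq x a; have := ZP x; rewrite inE xP inE xa => /(_ isT).
    by move: Zx; case: (Z x) => [[]|]; case: (s x).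
  have [hX hY] := sP x xP; move: xP; rewrite inE => /and3P[_ _ /orP[/hX|/hY] ->].
    by left.
  by right.
have Ds x : x != e -> D x != None ->
    (X x != None -> X x = D x) /\ (Y x != None -> Y x = D x).
  move=> xe Dx; have [/DK E|xK] := boolP (x \in K); first by rewrite E in Dx.
  have [xP|] := boolP (x \in P0).
    have -> : D x = Some (s x); last exact: sP.
    have [->//|xa] := eqVneq x a; have := DP x; rewrite inE xP inE xa => /(_ isT).
    by move: Dx; case: (D x) => [[]|]; case: (s x).
  by rewrite inE xe xK /= negb_or !negbK => /andP[/eqP-> /eqP->].
have Dn : D a != None by rewrite Da.
have ae : a != e by move: aP0; rewrite inE => /andP[].
have main F F' : F \in Cs -> F' \in Cs -> F' e != None -> F' e = omap negb (F e) ->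
    (forall x, x != e -> D x != None -> F x != None -> F x = D x) ->
    (forall x, x != e -> D x != None -> F' x != None -> F' x = D x) ->
    F a != None -> False.
  move=> FC F'C F'e E hF hF' Fa.
  have [y [_ Fy Dy]] := orth_at (oD F FC) Fa Dn.
  rewrite (hF a) // eqxx => /negbT nE.
  have ye : y = e.
    by apply/eqP/negPn/negP=> ye; rewrite (hF y) // eqxx in nE.
  subst y; have F'D : F' e = D e.
    by rewrite E; move: Fy Dy nE; case: (F e) => [[]|]; case: (D e) => [[]|].
  have De : D e = None; last by rewrite De in Dy.
  apply: (orth_disjoint (oD F' F'C)) F'e => x F'x Dx.
  by have [->//|xe] := eqVneq x e; apply: hF'.
have Ye' : Y e != None by rewrite Ye; case: (X e) Xe.
have : (X a != None) || (Y a != None) by move: aP0; rewrite inE => /and3P[].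
case/orP=> [Xa|Ya].
  by case: (main X Y) => // x xe Dx; have [] := Ds x xe Dx.
case: (main Y X) => // [|x xe Dx|x xe Dx]; first by rewrite Ye negbK_omap.
  by have [] := Ds x xe Dx.
by have [] := Ds x xe Dx.
Qed.

End Painting.

(** * The lexicographic extension *)

(* The new point f' stands for g + epsilon f with epsilon a positive
   infinitesimal; it replaces f. *)
Section Lexicographic.
Variable T : finType.

Lemma orth_witness (X Y : signed T) x y : X x != None -> Y x != None ->
  X y != None -> Y y != None -> (X x == Y x) = (X y != Y y) -> orth X Y.
Proof.
move=> Xx Yx Xy Yy E; rewrite /orth.
have h1 z : X z != None -> X z == Y z ->
    [exists x, (x \in supp X) && (X x == Y x)].
  by move=> Xz XYz; apply/existsP; exists z; rewrite in_supp Xz.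
have h2 z : X z != None -> Y z != None -> X z != Y z ->
    [exists x, (x \in supp X) && (X x == omap negb (Y x))].
  move=> Xz Yz XYz; apply/existsP; exists z; rewrite in_supp Xz /=.
  by move: Xz Yz XYz; case: (X z) => [[]|]; case: (Y z) => [[]|].
have [Exx|nxx] := boolP (X x == Y x).
  by rewrite (h1 x) // (h2 y) // -E.
by rewrite (h1 y) ?(h2 x) //; move: nxx; rewrite E negbK.
Qed.

Lemma circuit_or_covector (N : omatroid T) (K : {set T}) a :
  (exists2 C, C \in circuits N &
     C a != None /\ forall x, C x != None -> x = a \/ x \in K) \/
  (exists2 D, covector N D & D a = Some true /\
     forall x, x \in K -> x != a -> D x = None).
Proof.
have [/exists_inP[C CC /andP[Ca /forallP sC]]|no] := boolP [exists C in
    circuits N, (C a != None) &&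
      [forall x, (C x != None) ==> ((x == a) || (x \in K))]].
  left; exists C => //; split=> // x Cx.
  by have := sC x; rewrite Cx /= => /orP[/eqP|]; [left|right].
right; have [|D [cD Da DK]] := @covector_exists _ N K a; last by exists D.
move=> C CC Ca; move/exists_inPn/(_ C CC): no; rewrite Ca /=.
case/forallPn=> x; rewrite negb_imply negb_or => /andP[Cx /andP[xa xK]].
by exists x.
Qed.

Variables (N : omatroid T) (f g f' : T).
Hypothesis gf : generic_point N f.
Hypotheses (fN : f \in ground N) (gN : g \in ground N) (fg : f != g).
Hypothesis f'N : f' \notin ground N :\ f.
Implicit Types (C D X Y W : signed T) (A B K : {set T}) (x y e b : T).

Lemma lex_f'g : f' != g.
Proof. by apply: contraNneq f'N => ->; rewrite !inE gN eq_sym fg. Qed.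

Lemma lex_f'x x : x \in ground N -> x != f -> x != f'.
Proof. by move=> xN xf; apply: contraNneq f'N => <-; rewrite !inE xf. Qed.

(** The leading term of the dependency of f' on B: that of g alone. When g
    belongs to B the dependency is f' - g, whence the sign - at g. *)
Definition near_circuit B : signed T :=
  if g \in B then [ffun x => if x == g then Some false else None]
  else sdel g (fcircuit N B g).

(** The fundamental circuit of f' with respect to B: the infinitesimal term,
    proportional to C(B;f), decides where the leading term vanishes. *)
Definition lex_circuit B : signed T :=
  [ffun x => if x == f' then Some true else
     if x \in B then
       if near_circuit B x is Some s then Some s else fcircuit N B f x
     else None].

Definition lex_circuits : {set signed T} :=
  [set X | (X \in circuits N) && (X f == None) ||
     [exists B in bases N, (f \notin B) &&
        ((X == lex_circuit B) || (X == sopp (lex_circuit B)))]].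

Lemma lex_circuitsP X :
  reflect ((X \in circuits N /\ X f = None) \/ exists B, [/\ basis N B,
     f \notin B & X = lex_circuit B \/ X = sopp (lex_circuit B)])
   (X \in lex_circuits).
Proof.
rewrite inE; apply: (iffP orP) => -[].
- by case/andP=> XC /eqP Xf; left.
- case/exists_inP=> B; rewrite inE => bB /andP[fB XE]; right; exists B.
  by split=> //; case/orP: XE => /eqP; [left|right].
- by case=> XC Xf; left; rewrite XC Xf.
- case=> B [bB fB XE]; right; apply/exists_inP; exists B; first by rewrite inE.
  by rewrite fB; case: XE => ->; rewrite eqxx ?orbT.
Qed.

Section OneBasis.
Variable B : {set T}.
Hypotheses (bB : basis N B) (fB : f \notin B).

Lemma lex_f'B : f' \notin B.
Proof.
have [->//|f'f] := eqVneq f' f; apply/negP=> f'B; have := f'N.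
by rewrite !inE f'f (basis_ground bB f'B).
Qed.

Lemma lex_circuit_f' : lex_circuit B f' = Some true.
Proof. by rewrite ffunE eqxx. Qed.

Lemma lex_circuit_in x : x \in B -> lex_circuit B x =
  if near_circuit B x is Some s then Some s else fcircuit N B f x.
Proof.
by move=> xB; rewrite ffunE xB; case: eqP => // xf'; have := lex_f'B; rewrite -xf' xB.
Qed.

Lemma lex_circuit_supp x :
  (lex_circuit B x != None) = (x == f') || (x \in B).
Proof.
have [->|xf'] /= := eqVneq x f'; first by rewrite lex_circuit_f'.
have [xB|xB] := boolP (x \in B); last by rewrite ffunE (negPf xf') (negPf xB).
rewrite lex_circuit_in //; case: (near_circuit B x) => [s|] //.
have [CC Cf sC] := fcircuitP bB fN fB.
by apply: (gf bB fB CC) => //; rewrite Cf.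
Qed.

Lemma lex_circuit_g : g \in B -> lex_circuit B g = Some false.
Proof. by move=> gB; rewrite lex_circuit_in // /near_circuit gB ffunE eqxx. Qed.

Lemma lex_circuit_far x : g \in B -> x \in B -> x != g ->
  lex_circuit B x = fcircuit N B f x.
Proof.
by move=> gB xB xg; rewrite lex_circuit_in // /near_circuit gB ffunE (negPf xg).
Qed.

(** Where Y does not see the leading term, f' behaves as f. *)
Lemma lex_orth_f D Y : covector N Y ->
  (forall x, x \in B -> D x = Y x) -> D f' = Y f ->
  (forall x, x \in B -> Y x != None -> lex_circuit B x = fcircuit N B f x) ->
  orth (lex_circuit B) D.
Proof.
move=> cY DY Df' CE; have [CC Cf sC] := fcircuitP bB fN fB.
have oC := covector_orth cY CC.
have supp0 x : lex_circuit B x != None -> D x != None -> exists y,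
    [/\ fcircuit N B f y = lex_circuit B x, Y y = D x, Y y != None &
        y = f /\ x = f' \/ y = x /\ x \in B].
  rewrite lex_circuit_supp => /orP[/eqP->|xB].
    by rewrite lex_circuit_f' Df' => Yf; exists f; split=> //; left.
  by rewrite DY // => Yx; exists x; rewrite CE //; split=> //; right.
have supp1 y : fcircuit N B f y != None -> Y y != None -> exists x,
    lex_circuit B x = fcircuit N B f y /\ D x = Y y.
  move=> Cy Yy; have [yf|yB] := sC y Cy; last by exists y; rewrite CE // DY.
  by exists f'; rewrite lex_circuit_f' Df' yf Cf.
apply: orthI => x Cx E.
  have [|y [E1 E2 Yy _]] := supp0 x Cx; first by rewrite -E.
  have [||z [_ Cz Yz nE]] := @orth_at _ _ _ y oC; rewrite ?E1 //.
  have [w [E3 E4]] := supp1 z Cz Yz; exists w; rewrite E3 // E4.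
  by move: Cz Yz nE; rewrite E1 E2 E eqxx; case: (fcircuit N B f z) => [[]|];
    case: (Y z) => [[]|].
have [|y [E1 E2 Yy _]] := supp0 x Cx; first by move: Cx; rewrite E; case: (D x).
have [||z [_ Cz Yz nE]] := @orth_at _ _ _ y oC; rewrite ?E1 //.
have [w [E3 E4]] := supp1 z Cz Yz; exists w; rewrite E3 // E4; apply/eqP.
by rewrite nE E1 E2 E; move: Yy; rewrite E2; case: (D x) => [[]|].
Qed.

Lemma lex_far x : g \notin B -> x \in B -> fcircuit N B g x = None ->
  lex_circuit B x = fcircuit N B f x.
Proof.
move=> gB xB Gx; rewrite lex_circuit_in // /near_circuit (negPf gB) ffunE.
by rewrite Gx; case: ifP.
Qed.

Lemma lex_near x : g \notin B -> x \in B -> fcircuit N B g x != None ->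
  lex_circuit B x = fcircuit N B g x.
Proof.
move=> gB xB Gx; rewrite lex_circuit_in // /near_circuit (negPf gB) ffunE.
have -> : x == g = false by apply: contraNF gB => /eqP <-.
by case: (fcircuit N B g x) Gx.
Qed.

(** If Y vanishes at g, its products with the leading term take both signs as
    soon as one of them is nonzero. *)
Lemma lex_orth_near D Y : covector N Y -> Y g = None -> g \notin B ->
  (forall x, x \in B -> Y x != None -> D x = Y x) ->
  (exists x, [/\ x \in B, fcircuit N B g x != None & Y x != None]) ->
  orth (lex_circuit B) D.
Proof.
move=> cY Yg gB DY [x [xB Gx Yx]]; have [GC Gg sG] := fcircuitP bB gN gB.
have [y [yx Gy Yy E]] := orth_at (covector_orth cY GC) Gx Yx.
have yg : y != g by apply: contraNneq Yy => ->; rewrite Yg.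
have yB : y \in B by have [yg'|//] := sG y Gy; rewrite yg' eqxx in yg.
by apply: (@orth_witness _ _ x y); rewrite ?lex_near ?DY // E negbK.
Qed.

(** The value at f' of a linear form is its value at g, or, if that is zero,
    an infinitesimal with the sign of its value at f. *)
Lemma lex_orth1 D Y : covector N Y ->
  (forall x, x \in B -> D x = Y x) ->
  D f' = (if Y g is Some s then Some s else Y f) ->
  orth (lex_circuit B) D.
Proof.
move=> cY DY Df'; have [gB|gB] := boolP (g \in B).
  have [Yg|/negPn/eqP Yg] := boolP (Y g != None).
    apply: (@orth_witness _ _ f' g); rewrite ?lex_circuit_f' ?lex_circuit_g ?(DY g) //.
      by rewrite Df'; case: (Y g) Yg.
    by rewrite Df'; case: (Y g) Yg => [[]|].
  apply: (lex_orth_f cY DY); first by rewrite Df' Yg.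
  move=> x xB Yx; apply: lex_circuit_far => //.
  by apply: contraNneq Yx => ->; rewrite Yg.
have [GC Gg sG] := fcircuitP bB gN gB.
have [Yg|/negPn/eqP Yg] := boolP (Y g != None).
  have [|y [yg Gy Yy E]] := orth_at (covector_orth cY GC) _ Yg.
    by rewrite Gg.
  have yB : y \in B by have [yg'|//] := sG y Gy; rewrite yg' eqxx in yg.
  apply: (@orth_witness _ _ f' y);
    rewrite ?lex_circuit_f' ?(lex_near gB yB) ?(DY y) ?E ?Gg ?Df' //;
    by case: (Y g) Yg => [[]|].
have [/existsP[x /and3P[xB Gx Yx]]|/existsPn no] :=
  boolP [exists x, [&& x \in B, fcircuit N B g x != None & Y x != None]].
  by apply: (lex_orth_near cY Yg gB) => [y yB _|]; [apply: DY | exists x].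
apply: (lex_orth_f cY DY); first by rewrite Df' Yg.
move=> x xB Yx; apply: lex_far => //; apply/eqP.
by have := no x; rewrite xB Yx andbT negbK.
Qed.

(** Linear forms y + delta w with y zero at g and delta infinitesimal can
    vanish at f', namely when delta w(g) cancels epsilon y(f). *)
Lemma lex_orth2 D Y W : covector N Y -> covector N W ->
  Y g = None -> W g != None -> Y f = omap negb (W g) ->
  (forall x, x \in B -> D x = if Y x is Some s then Some s else W x) ->
  orth (lex_circuit B) D.
Proof.
move=> cY cW Yg Wg Yf DE; have [CC Cf sC] := fcircuitP bB fN fB.
have nYf : Y f != None by rewrite Yf; case: (W g) Wg.
have DY x : x \in B -> Y x != None -> D x = Y x.
  by move=> xB Yx; rewrite DE //; case: (Y x) Yx.
have [|z [zf Cz Yz Ez]] := orth_at (covector_orth cY CC) _ nYf.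
  by rewrite Cf.
have zB : z \in B by have [zf'|//] := sC z Cz; rewrite zf' eqxx in zf.
have [gB|gB] := boolP (g \in B).
  have Dg : D g = W g by rewrite DE // Yg.
  have zg : z != g by apply: contraNneq Yz => ->; rewrite Yg.
  apply: (@orth_witness _ _ g z); rewrite ?lex_circuit_g ?Dg ?(DY z) //.
    by rewrite lex_circuit_far.
  by rewrite lex_circuit_far // Ez Cf Yf; case: (W g) Wg => [[]|].
have [GC Gg sG] := fcircuitP bB gN gB.
have [/existsP[x /and3P[xB Gx Yx]]|/existsPn no] :=
  boolP [exists x, [&& x \in B, fcircuit N B g x != None & Y x != None]].
  by apply: (lex_orth_near cY Yg gB DY); exists x.
have [|y [yg Gy Wy Ey]] := orth_at (covector_orth cW GC) _ Wg.
  by rewrite Gg.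
have yB : y \in B by have [yg'|//] := sG y Gy; rewrite yg' eqxx in yg.
have Yy : Y y = None by apply/eqP; have := no y; rewrite yB Gy /= negbK.
have Gz : fcircuit N B g z = None.
  by apply/eqP; have := no z; rewrite zB Yz andbT /= negbK.
apply: (@orth_witness _ _ y z);
  rewrite ?(lex_near gB yB Gy) ?(lex_far gB zB Gz) ?(DY z) // ?DE // Yy //.
by rewrite Ey Ez Gg Cf Yf; case: (W g) Wg => [[]|].
Qed.

End OneBasis.

Lemma orth_ext (X Y Z : signed T) :
  (forall x, X x != None -> Y x = Z x) -> orth X Y = orth X Z.
Proof.
move=> E; rewrite /orth; congr (_ == _); apply: eq_existsb => x;
  by rewrite in_supp; case Xx: (X x) => [s|] //=; rewrite E ?Xx.
Qed.

Lemma orth_soppl (X Y : signed T) : orth X Y -> orth (sopp X) Y.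
Proof.
rewrite /orth => /eqP E; have h (u v : option bool) :
    [/\ (omap negb u != None) = (u != None),
        (omap negb u == v) = (u == omap negb v) &
        (omap negb u == omap negb v) = (u == v)].
  by case: u => [[]|]; case: v => [[]|].
apply/eqP; transitivity [exists x, (x \in supp X) && (X x == omap negb (Y x))].
  apply: eq_existsb => x; rewrite !in_supp ffunE.
  by have [-> -> _] := h (X x) (Y x).
rewrite -E; apply: eq_existsb => x; rewrite !in_supp ffunE.
by have [-> _ ->] := h (X x) (Y x).
Qed.

Lemma lex_orth_all D :
  (forall C, C \in circuits N -> C f = None -> orth C D) ->
  (forall B, basis N B -> f \notin B -> orth (lex_circuit B) D) ->
  orth_all lex_circuits D.
Proof.
move=> h1 h2 C /lex_circuitsP[[CC Cf]|[B [bB fB [->|->]]]]; first exact: h1.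
  exact: h2.
exact/orth_soppl/h2.
Qed.

Lemma lex_sopp C : C \in lex_circuits -> sopp C \in lex_circuits.
Proof.
case/lex_circuitsP=> [[CC Cf]|[B [bB fB CE]]]; apply/lex_circuitsP.
  by left; rewrite circuit_sopp // ffunE Cf.
by right; exists B; split=> //; case: CE => ->; [right|left]; rewrite ?soppK.
Qed.

Lemma lex_old C x : C \in circuits N -> C f = None -> C x != None ->
  x != f /\ x != f'.
Proof.
move=> CC Cf Cx; have xf : x != f by apply: contraNneq Cx => ->; rewrite Cf.
by split=> //; apply: lex_f'x xf; apply: circuit_ground CC Cx.
Qed.

Lemma lex_basis B x : basis N B -> f \notin B -> x \in B -> x != f /\ x != f'.
Proof.
move=> bB fB xB; split; first by apply: contraNneq fB => <-.
by apply: contraNneq (lex_f'B bB fB) => <-.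
Qed.

(** The entry at f is erased so that the vector also vanishes on sets that
    contain f, which is no longer an element of the new matroid. *)
Definition lex_covector Y : signed T :=
  [ffun x => if x == f' then (if Y g is Some s then Some s else Y f) else
     if x == f then None else Y x].

Lemma lex_covector_orth Y : covector N Y -> orth_all lex_circuits (lex_covector Y).
Proof.
move=> cY; have YE x : x != f -> x != f' -> lex_covector Y x = Y x.
  by move=> xf xf'; rewrite ffunE (negPf xf) (negPf xf').
apply: lex_orth_all => [C CC Cf|B bB fB].
  rewrite (orth_ext (Z := Y)) ?(covector_orth cY CC) // => x Cx.
  by have [xf xf'] := lex_old CC Cf Cx; apply: YE.
apply: (lex_orth1 bB fB cY) => [x xB|]; last by rewrite ffunE eqxx.
by have [xf xf'] := lex_basis bB fB xB; apply: YE.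
Qed.

Definition lex_covector2 Y W : signed T :=
  [ffun x => if (x == f') || (x == f) then None else
     if Y x is Some s then Some s else W x].

Lemma lex_covector2_orth Y W : covector N Y -> covector N W ->
  Y g = None -> W g != None -> Y f = omap negb (W g) ->
  orth_all lex_circuits (lex_covector2 Y W).
Proof.
move=> cY cW Yg Wg Yf; have DE x : x != f -> x != f' ->
    lex_covector2 Y W x = if Y x is Some s then Some s else W x.
  by move=> xf xf'; rewrite ffunE (negPf xf) (negPf xf').
apply: lex_orth_all => [C CC Cf|B bB fB]; last first.
  apply: (lex_orth2 bB fB cY cW) => // x xB.
  by have [xf xf'] := lex_basis bB fB xB; apply: DE.
rewrite (orth_ext (Z := [ffun x => if Y x is Some s then Some s else W x])).
  have [/existsP[x /andP[Cx Yx]]|/existsPn no] :=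
    boolP [exists x, (C x != None) && (Y x != None)].
    have [y [_ Cy Yy E]] := orth_at (covector_orth cY CC) Cx Yx.
    have YE z : Y z != None -> [ffun x => if Y x is Some s then Some s else W x] z = Y z.
      by rewrite ffunE; case: (Y z).
    by apply: (@orth_witness _ _ x y); rewrite ?YE // E negbK.
  rewrite (orth_ext (Z := W)) ?(covector_orth cW CC) // => x Cx.
  by rewrite ffunE; have := no x; rewrite Cx /= negbK => /eqP->.
by move=> x Cx; have [xf xf'] := lex_old CC Cf Cx; rewrite DE // ffunE.
Qed.

(** A separating covector for K without f' comes directly from N. If f' is in
    K and no circuit works, then a covector W of N separates a from f and the
    rest of K. If W vanishes at g it vanishes at f' as well. If not, the rest
    of K together with g does not span f, and a covector Y positive at f and
    zero there cancels W at f', as in [lex_orth2]. *)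
Lemma lex_dichotomy a K : a \notin K ->
  (exists2 C, C \in lex_circuits &
     C a != None /\ forall x, C x != None -> x = a \/ x \in K) \/
  (exists2 D, orth_all lex_circuits D &
     D a != None /\ forall x, x \in K -> D x = None).
Proof.
move=> aK; have [af'|af'] := eqVneq a f'.
  subst a; have [[C CC [Cf sC]]|[Y cY [Yf YK]]] := circuit_or_covector N (K :\ f) f.
    have [B [bB fB CE]] := generic_point_circuit gf CC Cf.
    left; exists (lex_circuit B); first by apply/lex_circuitsP; right; exists B;
      split=> //; left.
    split=> [|x]; first by rewrite lex_circuit_f'.
    rewrite lex_circuit_supp // => /orP[/eqP|xB]; [by left | right].
    have [||] := sC x; first by rewrite CE xB orbT.
      by move=> xf; rewrite xf (negPf fB) in xB.
    by rewrite inE => /andP[].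
  right; exists (lex_covector Y); first exact: lex_covector_orth.
  split=> [|x xK]; first by rewrite ffunE eqxx Yf; case: (Y g).
  rewrite ffunE; case: eqP => [xf'|_]; first by rewrite -xf' xK in aK.
  by have [//|xf] := eqVneq x f; rewrite YK // !inE xf.
have [af|af] := eqVneq a f.
  subst a; right; exists [ffun x => if x == f then Some true else None].
    have lexf C : C \in lex_circuits -> C f = None.
      case/lex_circuitsP=> [[]//|[B [bB fB CE]]].
      have := lex_circuit_supp bB fB f; rewrite (negPf af') (negPf fB) /=.
      by move/negbFE/eqP=> E; case: CE => ->; last rewrite ffunE; rewrite E.
    by move=> C /lexf Cf; apply: orthI => x Cx; rewrite ffunE;
      (have [xf|_] := eqVneq x f; first by rewrite xf Cf in Cx);
      move=> E; rewrite E in Cx.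
  split=> [|x xK]; rewrite ffunE ?eqxx //.
  by case: eqP => // xf; rewrite -xf xK in aK.
have [f'K|f'K] := boolP (f' \in K); last first.
  have [[C CC [Ca sC]]|[Y cY [Ya YK]]] := circuit_or_covector N (K :\ f) a.
    left; exists C.
      apply/lex_circuitsP; left; split=> //; apply/eqP/negPn/negP=> /sC[fa|].
        by rewrite fa eqxx in af.
      by rewrite !inE eqxx.
    by split=> // x /sC[]; [left | rewrite inE => /andP[]; right].
  right; exists (lex_covector Y); first exact: lex_covector_orth.
  split=> [|x xK]; first by rewrite ffunE (negPf af') (negPf af) Ya.
  rewrite ffunE; case: eqP => [xf'|_]; first by rewrite -xf' xK in f'K.
  have [//|xf] := eqVneq x f; rewrite YK // ?inE ?xf //.
  by apply: contraNneq aK => <-.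
pose K0 := K :\ f :\ f'.
have K0K x : x \in K0 -> [/\ x \in K, x != f, x != f' & x != a].
  rewrite !inE => /and3P[xf' xf xK]; split=> //.
  by apply: contraNneq aK => <-.
have KK0 x : x \in K -> x != f -> x != f' -> x \in K0.
  by move=> xK xf xf'; rewrite !inE xf xf'.
have [[C CC [Ca sC]]|[W cW [Wa WK]]] := circuit_or_covector N (f |: K0) a.
  left; have [Cf|/negPn/eqP Cf] := boolP (C f != None); last first.
    exists C; first by apply/lex_circuitsP; left.
    split=> // x Cx; have [->|] := sC x Cx; first by left.
    by rewrite in_setU1 => /orP[/eqP xf|/K0K[]]; [rewrite xf Cf in Cx | right].
  have [B [bB fB CE]] := generic_point_circuit gf CC Cf.
  exists (lex_circuit B); first by apply/lex_circuitsP; right; exists B;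
    split=> //; left.
  split.
    by rewrite lex_circuit_supp //; move: Ca; rewrite CE (negPf af) => /= ->; rewrite orbT.
  move=> x; rewrite lex_circuit_supp // => /orP[/eqP->|xB]; first by right.
  have [||] := sC x; first by rewrite CE xB orbT.
    by left.
  rewrite in_setU1 => /orP[/eqP xf|/K0K[]]; last by right.
  by rewrite xf (negPf fB) in xB.
have Wf : W f = None by apply: WK; rewrite ?setU11 // eq_sym.
have WK0 x : x \in K0 -> W x = None.
  by move=> xK; have [_ _ _ xa] := K0K x xK; apply: WK; rewrite // in_setU1 xK orbT.
right; have [Wg|/negPn/eqP Wg] := boolP (W g != None); last first.
  exists (lex_covector W); first exact: lex_covector_orth.
  split=> [|x xK]; first by rewrite ffunE (negPf af') (negPf af) Wa.
  rewrite ffunE Wg Wf; have [//|xf'] := eqVneq x f'.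
  by have [//|xf] := eqVneq x f; apply/WK0/KK0.
have [[C CC [Cf sC]]|[Y cY [Yf YK]]] := circuit_or_covector N (g |: K0) f.
  have [B [bB fB CE]] := generic_point_circuit gf CC Cf.
  have BK x : x \in B -> x = g \/ x \in K0.
    move=> xB; have [||] := sC x; first by rewrite CE xB orbT.
      by move=> xf; rewrite xf (negPf fB) in xB.
    by rewrite in_setU1 => /orP[/eqP|]; [left|right].
  have gWg : W g = None; last by rewrite gWg in Wg.
  have [gB|gB] := boolP (g \in B).
    apply: (orth_one (covector_orth cW CC)); first by rewrite CE gB orbT.
    move=> z; rewrite CE => /orP[/eqP->|/BK[//|/WK0->//]].
    by rewrite Wf.
  apply: (covector_basis0 bB cW) => // x xB; apply: WK0.
  by have [xg|//] := BK x xB; rewrite xg (negPf gB) in xB.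
have Yg : Y g = None by apply: YK; rewrite ?setU11 // eq_sym.
have YK0 x : x \in K0 -> Y x = None.
  by move=> xK; have [_ xf _ _] := K0K x xK; apply: YK; rewrite // in_setU1 xK orbT.
have [W' [cW' W'g W'a W'K0]] : exists W', [/\ covector N W',
    W' g = Some false, W' a != None & forall x, x \in K0 -> W' x = None].
  have [E|nE] := eqVneq (W g) (Some false); first by exists W; rewrite Wa.
  exists (sopp W); split; rewrite ?ffunE ?Wa //; first exact: covector_sopp.
    by move: Wg nE; case: (W g) => [[]|].
  by move=> x xK; rewrite ffunE WK0.
exists (lex_covector2 Y W').
  by apply: lex_covector2_orth => //; rewrite W'g.
split=> [|x xK]; first by rewrite ffunE (negPf af') (negPf af) /=; case: (Y a).
rewrite ffunE; have [//|xf'] := eqVneq x f'; have [//|xf] /= := eqVneq x f.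
by rewrite YK0 ?W'K0 //; apply: KK0.
Qed.

Lemma lex_axioms : circuit_axioms (f' |: ground N :\ f) lex_circuits.
Proof.
have suppE B X x : basis N B -> f \notin B ->
    X = lex_circuit B \/ X = sopp (lex_circuit B) ->
    (X x != None) = (x == f') || (x \in B).
  move=> bB fB XE; rewrite -lex_circuit_supp //.
  by case: XE => -> //; rewrite ffunE; case: (lex_circuit B x).
apply/circuit_axiomsP; split.
- move=> X /lex_circuitsP[[XC Xf] x Xx|[B [bB fB XE]] x].
    have [xf _] := lex_old XC Xf Xx.
    by rewrite !inE xf (circuit_ground XC Xx) orbT.
  rewrite (suppE B) // => /orP[/eqP->|xB]; first by rewrite setU11.
  have [xf _] := lex_basis bB fB xB.
  by rewrite !inE xf (basis_ground bB xB) orbT.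
- move=> X /lex_circuitsP[[XC _]|[B [bB fB XE]]]; first exact: circuit_neq0 XC.
  by exists f'; rewrite (suppE B) ?eqxx.
- exact: lex_sopp.
- move=> X Y /lex_circuitsP[[XC Xf]|[B [bB fB XE]]]
    /lex_circuitsP[[YC Yf]|[B' [bB' fB' YE]]] sXY.
  + exact: (circuit_min XC YC).
  + case: (circuit_notin_indep (basis_indep bB') XC) => x Xx.
    have [_ xf'] := lex_old XC Xf Xx.
    by have := sXY x Xx; rewrite (suppE B') // (negPf xf').
  + have Yf' : Y f' != None by apply: sXY; rewrite (suppE B) ?eqxx.
    by have [_] := lex_old YC Yf Yf'; rewrite eqxx.
  + have E : B = B'.
      apply: (basis_sub_eq bB bB'); apply/subsetP=> x xB.
      have [_ xf'] := lex_basis bB fB xB.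
      have := sXY x; rewrite (suppE B X x bB fB XE) (suppE B' Y x bB' fB' YE).
      by rewrite xB orbT (negPf xf') => /(_ isT).
    subst B'; case: XE YE => -> [] ->; rewrite ?soppK; by [left|right].
- move=> X Y e XC YC nXY Xe Ye.
  apply: (painting_elim lex_sopp lex_dichotomy) => //; first by rewrite Xe.
  by rewrite Xe Ye.
Qed.

Definition lex_matroid : omatroid T := OMatroid lex_axioms.

End Lexicographic.

(** * Genericity and transport of structure *)

Section Genericity.
Variable T : finType.
Implicit Types (N M : omatroid T) (C D X Y Z : signed T) (A B : {set T}).
Implicit Types (e f g x y : T).

Lemma indep_delete N f A :
  independent (delete N f) A = (f \notin A) && independent N A.
Proof.
apply/indepP/andP => [[sA iA]|[fA /indepP[sA iA]]].
  have fA : f \notin A by apply/negP=> /(subsetP sA); rewrite !inE eqxx.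
  split=> //; apply/indepP; split.
    by apply/subsetP=> x /(subsetP sA); rewrite !inE => /andP[].
  move=> C CC; have [Cf|/negPn/eqP Cf] := boolP (C f != None); first by exists f.
  by apply: iA; rewrite deleteP CC Cf.
split; last by move=> C; rewrite deleteP => /andP[CC _]; apply: iA.
apply/subsetP=> x xA; rewrite !inE (subsetP sA) // andbT.
by apply: contraNneq fA => <-.
Qed.

Lemma basis_delete_sub N f B : basis N B -> f \notin B -> basis (delete N f) B.
Proof.
move=> bB fB; apply/maxsetP; split; first by rewrite indep_delete fB basis_indep.
move=> A; rewrite indep_delete => /andP[_ iA] sBA.
by case/maxsetP: bB => _; apply.
Qed.

Lemma generic_extension_basis N f B : generic_extension (delete N f) f N ->
  basis (delete N f) B = (f \notin B) && basis N B.
Proof.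
case=> _ /setP gE; apply/idP/andP => [bB|[fB bB]]; last exact: basis_delete_sub.
have := basis_indep bB; rewrite indep_delete => /andP[fB iB]; split=> //.
apply/basisP; split=> // e eN eB.
have [ef|ef] := eqVneq e f; last first.
  have [_ hB] := basisP _ _ bB.
  have [|C [CC Ce sC]] := hB e _ eB; first by rewrite !inE ef.
  by exists C; move: CC; rewrite deleteP => /andP[].
subst e; have := gE (f |: B).
have -> : f |: B \in [set f |: B0 | B0 in bases (delete N f)].
  by apply: imset_f; rewrite inE.
case/imsetP=> C; rewrite inE => /andP[CC fC] CE.
rewrite in_supp in fC; have [Y [YC Yf YE]] := circuit_positive_at CC fC.
exists Y; split=> // x; rewrite YE -in_supp -CE !inE => /orP[/eqP|]; auto.
Qed.

Lemma generic_extension_point N f :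
  generic_extension (delete N f) f N -> generic_point N f.
Proof.
move=> ge B C bB fB CC Cf sC; case: (ge) => _ /setP/(_ (supp C)).
have -> : supp C \in [set supp C | C in circuits N & f \in supp C].
  by apply/imsetP; exists C; rewrite // inE CC in_supp.
move/esym/imsetP=> [B']; rewrite inE => bB' CE.
suff -> : B = B'.
  by move=> x xB; rewrite -in_supp CE !inE xB orbT.
have := bB'; rewrite generic_extension_basis // => /andP[fB' bN'].
apply/esym/(basis_sub_eq bN' bB)/subsetP=> x xB'.
have [|xf|//] := sC x; first by rewrite -in_supp CE !inE xB' orbT.
by rewrite -xf xB' in fB'.
Qed.

Lemma generic_lifting_copoint N g : g \in ground N -> ~~ loop N g ->
  ([set supp D | D in cocircuits N & g \in supp D] =
   [set g |: (ground (contract N g) :\: B) | B in bases (contract N g)]) <->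
  generic_copoint N g.
Proof.
move=> gN nl; split=> [/setP gE B e C bB gB eB CC Ce sC|gg].
  have bB0 : B :\ g \in bases (contract N g).
    by rewrite inE basis_contract // setD11 setD1K.
  have /imsetP[D] : g |: (ground (contract N g) :\: (B :\ g)) \in
      [set supp D | D in cocircuits N & g \in supp D].
    by rewrite gE; apply/imsetP; exists (B :\ g).
  rewrite inE => /andP[DD gD] DE.
  have DE' x : (D x != None) = (x == g) || (x \notin B) && (x \in ground N).
    by rewrite -in_supp -DE !inE; case: (x == g).
  have [|z Cz Dz|] // := @orth_two _ C D e g
    (covector_orth (cocircuit_covector DD) CC) Ce.
    by rewrite DE' eB (circuit_ground CC Ce) orbT.
  have [->|zB] := sC z Cz; [by left | right].
  by move: Dz; rewrite DE' zB orbF => /eqP.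
apply/setP=> S; apply/imsetP/imsetP => [[D]|[B]].
  rewrite inE in_supp => /andP[DD Dg] ->.
  have [B [bB gB DB]] := cocircuit_basis DD Dg.
  exists (B :\ g); first by rewrite inE basis_contract // setD11 setD1K.
  apply/setP=> x; rewrite in_supp (generic_cocircuit_supp gg bB gB DD Dg DB).
  by rewrite !inE; have [->|] := eqVneq x g; rewrite ?gN //= andbC.
rewrite inE basis_contract // => /andP[gB bB] ->.
have gB' : g \in g |: B by rewrite setU11.
have [DD Dg DB _] := fcocircuitP bB gB'.
exists (fcocircuit N (g |: B) g); first by rewrite inE in_supp DD Dg.
apply/setP=> x; rewrite in_supp (generic_cocircuit_supp gg bB gB' DD) ?Dg //.
by rewrite !inE; have [->|] := eqVneq x g; rewrite ?gN //= andbC.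
Qed.

Lemma extension_liftingP M N f g : generic_extension_lifting M f g N ->
  [/\ generic_point N f, generic_copoint N g, f \in ground N /\ g \in ground N,
      f != g & ~~ loop N g].
Proof.
case=> [[fg _ _] [gr _] ge [_ gl] [_ _ nl _]].
have fN : f \in ground N by rewrite gr setU11.
have gN : g \in ground N by rewrite gr !inE eqxx orbT.
split=> //; first exact: generic_extension_point.
exact/generic_lifting_copoint.
Qed.

Lemma extension_lifting_ground M N f g : generic_extension_lifting M f g N ->
  ground N :\: [set f; g] = ground M.
Proof.
case=> [[fg fM gM] [-> _] _ _ _]; apply/setP=> x; rewrite !inE.
have [->|xf] /= := eqVneq x f; first by rewrite (negPf fM).
by have [->|xg] /= := eqVneq x g; first by rewrite (negPf gM).
Qed.

(** An isomorphism of underlying matroids, for an involution s; the signs may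
    differ. *)
Definition support_iso (s : T -> T) N N' := [/\
  forall x, (x \in ground N') = (s x \in ground N),
  forall X', X' \in circuits N' -> exists2 X, X \in circuits N &
    forall x, (X' x != None) = (X (s x) != None) &
  forall X, X \in circuits N -> exists2 X', X' \in circuits N' &
    forall x, (X' x != None) = (X (s x) != None)].

Section Iso.
Variable s : T -> T.
Hypothesis sK : involutive s.

Lemma iso_sym N N' : support_iso s N N' -> support_iso s N' N.
Proof.
case=> gE h1 h2; split=> [x|X /h2[X' X'C E]|X' /h1[X XC E]].
- by rewrite gE sK.
- by exists X' => // x; rewrite E sK.
- by exists X => // x; rewrite E sK.
Qed.

Lemma iso_indep N N' A : support_iso s N N' -> independent N A ->
  independent N' (s @^-1: A).
Proof.
case=> gE h1 h2 /indepP[/subsetP sA iA]; apply/indepP; split.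
  by apply/subsetP=> x; rewrite inE gE => /sA.
move=> X' /h1[X XC E]; have [x Xx xA] := iA X XC.
by exists (s x); rewrite ?E ?inE sK.
Qed.

Lemma preimsK A : s @^-1: (s @^-1: A) = A.
Proof. by apply/setP=> x; rewrite !inE sK. Qed.

Lemma iso_basis N N' B : support_iso s N N' -> basis N B ->
  basis N' (s @^-1: B).
Proof.
move=> iso /maxsetP[iB mB]; apply/maxsetP; split; first exact: (iso_indep iso iB).
move=> A iA sBA; have <- : s @^-1: A = B; last by rewrite preimsK.
apply: mB; first exact: (iso_indep (iso_sym iso) iA).
by rewrite -[B]preimsK; apply: preimsetS.
Qed.

Lemma iso_loop N N' e : support_iso s N N' -> loop N' e -> loop N (s e).
Proof.
move=> [_ h1 _] /exists_inP[X' /h1[X XC E] /eqP/setP XE].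
apply/exists_inP; exists X => //; apply/eqP/setP=> x.
by have := XE (s x); rewrite !in_supp !in_set1 E sK => ->; apply: inv_eq.
Qed.

Lemma iso_coloop N N' e : support_iso s N N' -> coloop N' e -> coloop N (s e).
Proof.
move=> iso /forall_inP h; apply/forall_inP=> B; rewrite inE => bB.
have := h (s @^-1: B); rewrite !inE; apply; exact: iso_basis bB.
Qed.

Lemma iso_generic_copoint N N' g : support_iso s N N' -> s g = g ->
  generic_copoint N g -> generic_copoint N' g.
Proof.
move=> iso sg gg B' e C' bB' gB' eB' C'C C'e sC'.
have [_ h1 _] := iso; have [C CC E] := h1 _ C'C.
rewrite E sg; apply: (gg (s @^-1: B') (s e)); rewrite ?inE ?sK ?sg -?E //.
  exact: iso_basis (iso_sym iso) bB'.
by move=> y; rewrite -[y]sK -E => /sC'[->|]; rewrite inE !sK; auto.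
Qed.

Lemma iso_contract_mem N N' g X X' : support_iso s N N' -> s g = g ->
  X' \in circuits N' -> (forall x, (X' x != None) = (X (s x) != None)) ->
  (exists2 x, x != g & X x != None) ->
  (forall Z, Z \in circuits N -> (exists2 x, x != g & Z x != None) ->
     (forall x, x != g -> Z x != None -> X x != None) ->
     forall x, x != g -> X x != None -> Z x != None) ->
  sdel g X' \in circuits (contract N' g).
Proof.
move=> iso sg X'C E [x xg Xx] mX.
have sgE y : (s y == g) = (y == g) by rewrite -{1}sg (inj_eq (inv_inj sK)).
apply/contract_circuitP; exists X' => //; split=> //.
  by exists (s x); rewrite ?sgE // E sK.
move=> Z' Z'C [y yg Z'y] sZX z zg; rewrite E => Xz.
have [_ h1 _] := iso; have [Z ZC EZ] := h1 _ Z'C.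
rewrite EZ; apply: mX => //; rewrite ?sgE //.
  by exists (s y); rewrite ?sgE // -EZ.
by move=> u ug; rewrite -[u]sK -EZ -E; apply: sZX; rewrite sgE.
Qed.

Lemma iso_contract N N' g : support_iso s N N' -> s g = g ->
  support_iso s (contract N g) (contract N' g).
Proof.
move=> iso sg; have sgE y : (s y == g) = (y == g).
  by rewrite -{1}sg (inj_eq (inv_inj sK)).
have half N1 N2 : support_iso s N1 N2 -> forall Y, Y \in circuits (contract N1 g) ->
    exists2 Y', Y' \in circuits (contract N2 g) &
      forall x, (Y' x != None) = (Y (s x) != None).
  move=> i12 _ /contract_circuitP[X XC [nX -> mX]].
  have [_ _ h2] := i12; have [X' X'C E] := h2 X XC.
  exists (sdel g X'); first exact: (iso_contract_mem i12 sg X'C E nX mX).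
  by move=> x; rewrite !ffunE sgE; case: (x == g).
split; last exact: (half _ _ iso).
  by move=> x; have [gE _ _] := iso; rewrite !inE sgE gE.
move=> Y' /(half _ _ (iso_sym iso))[Y YC E]; exists Y => // x.
by rewrite E sK.
Qed.

End Iso.

(** Two circuits of an oriented matroid with the same support are equal up to
    sign, so equality of supports upgrades an inclusion. *)
Lemma eq_circuits_sub N1 N2 :
  (forall X, X \in circuits N1 -> X \in circuits N2) ->
  (forall Y, Y \in circuits N2 -> exists2 X, X \in circuits N1 &
     forall x, (X x != None) = (Y x != None)) ->
  circuits N1 = circuits N2.
Proof.
move=> h1 h2; apply/setP=> Y; apply/idP/idP=> [/h1//|YC].
have [X XC E] := h2 Y YC.
have [|->|->] // := circuit_min YC (h1 X XC); first by move=> x; rewrite E.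
exact: circuit_sopp.
Qed.

Lemma delete_relabel N f f' : f' \notin ground N :\ f ->
  delete (relabel N (tperm f f')) f' = delete N f.
Proof.
move=> f'N; have sv x : x \in ground N -> x != f -> tperm f f' x = x.
  move=> xN xf; rewrite tpermD // eq_sym //.
  by apply: contraNneq f'N => <-; rewrite !inE xf.
have fix_rel X : X \in circuits N -> X f = None -> srelabel (tperm f f') X = X.
  move=> XC Xf; have [ff'|ff'] := eqVneq f f'.
    by apply/ffunP=> x; rewrite ffunE -ff' tperm1 invg1 perm1.
  have Xf' : X f' = None.
    apply/eqP; apply: contraNT f'N => Xf'.
    by rewrite !inE eq_sym ff' (circuit_ground XC Xf').
  apply/ffunP=> x; rewrite ffunE tpermV.
  by case: tpermP => [->|->|]; rewrite ?Xf ?Xf'.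
apply: omatroid_inj.
  apply/setP=> x; rewrite !inE; apply/andP/andP => [[xf' /imsetP[y yN xE]]|[xf xN]].
    have yf : y != f by apply: contraNneq xf' => yf; rewrite xE yf tpermL.
    by rewrite xE sv.
  split; first by apply: contraNneq f'N => <-; rewrite !inE xf.
  by apply/imsetP; exists x; rewrite ?sv.
apply/setP=> Y; rewrite !deleteP; apply/andP/andP => [[/imsetP[X XC ->]]|[YC /eqP Yf]].
  rewrite ffunE tpermV tpermR => /eqP Xf.
  by rewrite fix_rel // XC Xf.
have YE := fix_rel Y YC Yf; split; first by rewrite -YE; apply: imset_f.
by rewrite -YE ffunE tpermV tpermR Yf.
Qed.

End Genericity.

(** * Replacing f by a point infinitely close to g *)

Section Replacement.
Variables (T : finType) (M N : omatroid T) (f g f' : T).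
Hypothesis gel : generic_extension_lifting M f g N.
Hypothesis f'M : f' \notin g |: ground M.

Let s := tperm f f'.

Lemma replacement_fresh : f' \notin ground N :\ f.
Proof.
case: gel => [_ [-> _] _ _ _]; apply: contra f'M.
by rewrite !inE => /andP[/negPf->].
Qed.

Let gf : generic_point N f. Proof. by case: (extension_liftingP gel). Qed.
Let gg : generic_copoint N g. Proof. by case: (extension_liftingP gel). Qed.
Let fN : f \in ground N. Proof. by case: (extension_liftingP gel) => _ _ []. Qed.
Let gN : g \in ground N. Proof. by case: (extension_liftingP gel) => _ _ []. Qed.
Let fg : f != g. Proof. by case: (extension_liftingP gel). Qed.
Let nlg : ~~ loop N g. Proof. by case: (extension_liftingP gel). Qed.

Let f'N := replacement_fresh.
Let L : omatroid T := lex_matroid gf fN gN fg f'N.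

Let sK : involutive s. Proof. exact: tpermK. Qed.

Let f'g : f' != g. Proof. exact: lex_f'g gN fg f'N. Qed.

Let sg : s g = g. Proof. by rewrite /s tpermD. Qed.

Let sN x : x != f -> x != f' -> s x = x.
Proof. by move=> xf xf'; rewrite /s tpermD // eq_sym. Qed.

Lemma old_fix X x : X \in circuits N -> X f = None -> X (s x) = X x.
Proof.
move=> XC Xf; have Xf' : X f' = None.
  by apply/eqP/negPn/negP=> /(lex_old f'N XC Xf)[_]; rewrite eqxx.
by rewrite /s; case: tpermP => [->|->|]; rewrite ?Xf ?Xf'.
Qed.

Lemma lex_basis_supp B x : basis N B -> f \notin B ->
  (s x == f) || (s x \in B) = (x == f') || (x \in B).
Proof.
move=> bB fB; have f'B := lex_f'B f'N bB fB.
have [->|xf'] := eqVneq x f'; first by rewrite /s tpermR eqxx.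
have [xf|xf] := eqVneq x f; last by rewrite sN // (negPf xf).
by rewrite xf /s tpermL (negPf fB) (negPf f'B) orbF eq_sym -xf (negPf xf').
Qed.

Lemma lex_supp B X x : basis N B -> f \notin B ->
  X = lex_circuit N f g f' B \/ X = sopp (lex_circuit N f g f' B) ->
  (X x != None) = (x == f') || (x \in B).
Proof.
move=> bB fB XE; rewrite -(lex_circuit_supp g gf fN f'N bB fB).
by case: XE => -> //; rewrite [sopp _ _]ffunE; case: (lex_circuit _ _ _ _ _ x).
Qed.

Lemma lex_iso : support_iso s N L.
Proof.
split=> [x|X|X XC].
- rewrite inE in_set1 in_setD1; have [->|xf'] := eqVneq x f'.
    by rewrite /s tpermR fN.
  have [xf|xf] := eqVneq x f; last by rewrite sN.
  rewrite xf /s tpermL; apply/esym/negbTE; apply: contra f'N => f'N'.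
  by rewrite !inE f'N' eq_sym -xf xf'.
- case/lex_circuitsP=> [[XC Xf]|[B [bB fB XE]]].
    by exists X => // x; rewrite old_fix.
  have [CC Cf sC] := fcircuitP bB fN fB.
  exists (fcircuit N B f) => // x; rewrite (lex_supp x bB fB XE).
  rewrite -lex_basis_supp //; apply/orP/idP => [[/eqP->|xB]|/sC[->|->]].
  + by rewrite Cf.
  + by apply: (gf bB fB CC); rewrite ?Cf.
  + by rewrite eqxx; left.
  + by right.
- have [Xf|/negPn/eqP Xf] := boolP (X f != None); last first.
    by exists X => [|x]; [apply/lex_circuitsP; left | rewrite old_fix].
  have [B [bB fB XE]] := generic_point_circuit gf XC Xf.
  exists (lex_circuit N f g f' B).
    by apply/lex_circuitsP; right; exists B; split=> //; left.
  by move=> x; rewrite XE lex_basis_supp // (lex_circuit_supp g gf fN f'N bB fB).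
Qed.

Lemma lex_delete : delete L f' = delete N f.
Proof.
apply: omatroid_inj; first by rewrite /= setU1K.
apply/setP=> X; rewrite !deleteP; apply/andP/andP => -[].
  case/lex_circuitsP=> [[XC ->]//|[B [bB fB XE]]].
  by have := lex_supp f' bB fB XE; rewrite eqxx /= => /negPf->.
move=> XC /eqP Xf; split; first by apply/lex_circuitsP; left.
by have := old_fix f XC Xf; rewrite /s tpermL Xf => ->.
Qed.

(** Contracting g, the point g + epsilon f becomes a positive multiple of f.
    On circuits: one through f that is minimal off g comes from a basis
    containing g, and there [lex_circuit] differs from C(B;f) only at g. *)
Lemma lex_contract : contract L g = relabel (contract N g) s.
Proof.
have sV : (s^-1)%g = s by rewrite /s tpermV.
have sgE y : (s y == g) = (y == g) by rewrite -{1}sg (inj_eq perm_inj).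
apply: omatroid_inj.
  apply/setP=> x; have [gE _ _] := iso_contract sK lex_iso sg; rewrite gE.
  by rewrite -{2}[x]sK mem_imset //; apply: perm_inj.
apply/esym/eq_circuits_sub => [_ /imsetP[Y YC ->]|Y'].
  have [X XC [nX YE mX]] := contract_circuitP _ _ _ YC.
  have [Xf|/negPn/eqP Xf] := boolP (X f != None); last first.
    have -> : srelabel s Y = sdel g X.
      by apply/ffunP=> x; rewrite YE !ffunE sV sgE old_fix.
    apply: (iso_contract_mem sK lex_iso sg _ _ nX mX).
      by apply/lex_circuitsP; left.
    by move=> x; rewrite old_fix.
  have [B [bB fB XE]] := generic_point_circuit gf XC Xf.
  have [CC Cf sC] := fcircuitP bB fN fB.
  (* Otherwise exchange g for some b in B: the circuit of f on the new basis
     has, off g, a smaller trace than X. *)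
  have gB : g \in B.
    apply/negPn/negP=> gB.
    have [b [B' [bB1 bB' gB' sB']]] := basis_exchange_in bB gB gN nlg.
    have fB' : f \notin B'.
      by apply/negP=> /sB'[/eqP|[]]; rewrite ?(negPf fg) ?(negPf fB).
    have [ZC Zf sZ] := fcircuitP bB' fN fB'.
    have : fcircuit N B' f b != None.
      apply: (mX (fcircuit N B' f) ZC _ _ b).
      - by exists f => //; rewrite Zf.
      - move=> x xg /sZ[->//|/sB'[xg'|[xB _]]].
          by rewrite xg' eqxx in xg.
        by rewrite XE xB orbT.
      - by apply: contraNneq gB => <-.
      - by rewrite XE bB1 orbT.
    case/sZ=> [bf|/sB'[bg|[_]]]; last by rewrite eqxx.
      by rewrite -bf bB1 in fB.
    by rewrite -bg bB1 in gB.
  have [u XU] : exists u : bool,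
      X = if u then fcircuit N B f else sopp (fcircuit N B f).
    have sX x : X x != None -> x = f \/ x \in B.
      by rewrite XE => /orP[/eqP|]; auto.
    case Xf': (X f) Xf => [[]|] // _.
      by exists true; apply: fcircuit_eq.
    exists false; rewrite -[X]soppK; congr (sopp _); apply: fcircuit_eq => //.
    - exact: circuit_sopp.
    - by rewrite ffunE Xf'.
    - by move=> x; rewrite ffunE => Xx; apply: sX; case: (X x) Xx.
  pose X' := if u then lex_circuit N f g f' B else sopp (lex_circuit N f g f' B).
  have X'E : X' = lex_circuit N f g f' B \/ X' = sopp (lex_circuit N f g f' B).
    by rewrite /X'; case: u {XU X'}; [left | right].
  have farE x : x != g -> lex_circuit N f g f' B x = fcircuit N B f (s x).
    move=> xg; have := lex_basis_supp x bB fB.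
    have [->|xf'] := eqVneq x f'.
      by rewrite lex_circuit_f' /s tpermR Cf.
    have [xB|xB] /= := boolP (x \in B).
      have [xf _] := lex_basis f'N bB fB xB.
      by rewrite sN // lex_circuit_far.
    move=> h; transitivity (None : option bool).
      by rewrite ffunE (negPf xf') (negPf xB).
    apply/esym/eqP/negPn/negP=> /sC hs; move: h.
    by case: hs => ->; rewrite ?eqxx ?orbT.
  have -> : srelabel s Y = sdel g X'.
    apply/ffunP=> x; rewrite YE ffunE sV [RHS]ffunE ffunE sgE.
    case: eqVneq => // xg; rewrite XU /X'; case: u {XU X' X'E}; first by rewrite farE.
    by rewrite !(ffunE (fun x => omap _ _)) farE.
  apply: (iso_contract_mem sK lex_iso sg _ _ nX mX).
    by apply/lex_circuitsP; right; exists B.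
  by move=> x; rewrite (lex_supp x bB fB X'E) XE lex_basis_supp.
move=> Y'C; have [_ h1 _] := iso_contract sK lex_iso sg.
have [Y YC E] := h1 Y' Y'C; exists (srelabel s Y); first exact: imset_f.
by move=> x; rewrite ffunE sV E.
Qed.

Lemma lex_generic : generic_extension_lifting M f' g L.
Proof.
have [[_ fM gM] [gr dM] ge _ [nlf ncf _ ncg]] := gel.
have nlL : ~~ loop L g.
  by apply/negP=> /(iso_loop sK lex_iso); rewrite sg (negPf nlg).
have grL : ground L = f' |: (g |: ground M).
  by rewrite /= gr setU1K // !inE negb_or fg.
have gL : g \in ground L by rewrite grL !inE eqxx orbT.
split.
- by split=> //; apply: contra f'M => h; rewrite !inE h orbT.
- split=> //; rewrite lex_contract delete_relabel //.
  by apply: contra f'N; rewrite !inE => /and3P[-> _ ->].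
- split; first by split; rewrite // /= ?inE ?eqxx // setU1K // ?setU1K.
  rewrite lex_delete; apply/setP=> S; apply/imsetP/imsetP => [[X]|[B]].
    rewrite inE in_supp => /andP[/lex_circuitsP[[XC Xf]|[B [bB fB XE]]] Xf'] ->.
      by have [_] := lex_old f'N XC Xf Xf'; rewrite eqxx.
    exists B; first by rewrite inE basis_delete_sub.
    by apply/setP=> x; rewrite in_supp (lex_supp x bB fB XE) !inE.
  rewrite inE generic_extension_basis // => /andP[fB bB] ->.
  exists (lex_circuit N f g f' B).
    rewrite inE in_supp lex_circuit_f' andbT; apply/lex_circuitsP; right.
    by exists B; split=> //; left.
  apply/setP=> x; rewrite in_supp.
  by rewrite (lex_supp x bB fB (or_introl erefl)) !inE.
- split; first by split; rewrite // /= ?inE ?eqxx // setD1K.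
  apply/generic_lifting_copoint => //.
  exact: (iso_generic_copoint sK lex_iso sg gg).
- split=> //.
  + by apply/negP=> /(iso_loop sK lex_iso); rewrite /s tpermR (negPf nlf).
  + by apply/negP=> /(iso_coloop sK lex_iso); rewrite /s tpermR (negPf ncf).
  + by apply/negP=> /(iso_coloop sK lex_iso); rewrite sg (negPf ncg).
Qed.

(** A cocircuit through g and f' meets the circuit of f' on a basis
    containing g exactly in these two points, where that circuit has opposite
    signs. *)
Lemma lex_compliant : compliant L f' g.
Proof.
apply/forall_inP=> D DD; apply/negP=> /andP[/eqP Dg /eqP Df'].
have [|B [bB gB DB]] := cocircuit_basis DD (a := g); first by rewrite Dg.
have f'B : f' \notin B by apply/negP=> f'B; rewrite DB in Df'.
have fL : f \notin B.
  have [->//|ff'] := eqVneq f f'; apply/negP=> /(basis_ground bB).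
  by rewrite !inE (negPf ff') eqxx.
have bN : basis N B.
  have := basis_delete_sub bB f'B; rewrite lex_delete generic_extension_basis.
    by case/andP.
  by case: gel.
have CL : lex_circuit N f g f' B \in circuits L.
  by apply/lex_circuitsP; right; exists B; split=> //; left.
have := lex_circuit_g f'N bN fL gB.
have [||z|_ _] := orth_two (x := f') (y := g)
  (covector_orth (cocircuit_covector DD) CL).
- by rewrite lex_circuit_f'.
- by rewrite Df'.
- rewrite (lex_supp z bN fL (or_introl erefl)) => /orP[/eqP|zB] Dz; first by left.
  by right; apply/eqP/negPn/negP=> zg; rewrite DB in Dz.
by rewrite lex_circuit_f' Df' Dg => E Cg; rewrite Cg in E.
Qed.

Lemma lex_replacement : compliant_replacement M N f g f' L.
Proof.
split; [exact: lex_generic | exact: lex_compliant | exact: lex_delete |].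
exact: lex_contract.
Qed.

End Replacement.

Section ReplacementInvariance.
Variable T : finType.
Implicit Types (M N : omatroid T) (A B : {set T}) (f g x : T).

Lemma region_associatedP M N f g A : generic_extension_lifting M f g N ->
  reflect (A \subset ground M /\
           exists2 B, B \in bases_with_without N g f & associated N f g A B)
          (A \in bounded_regions N f g).
Proof.
move=> gel; have [gf gg [fN gN] fg nl] := extension_liftingP gel.
rewrite -(extension_lifting_ground gel).
apply: (iffP (bounded_regionsP gf gg fN gN fg nl A)) =>
    [[[/subsetP sA fA gA] [B oB]]|[/subsetP sA [B BG /(associated_optimal _ BG) oB]]].
  split; last first.
    by have BG := optimal_gbases oB; exists B => //; apply/associated_optimal.
  apply/subsetP=> x xA; rewrite !inE negb_or sA // andbT.
  by apply/andP; split; [apply: contraNneq fA => <- | apply: contraNneq gA => <-].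
split; last by exists B.
split.
- by apply/subsetP=> x /sA; rewrite inE => /andP[].
- by apply/negP=> /sA; rewrite !inE eqxx.
- by apply/negP=> /sA; rewrite !inE eqxx orbT.
Qed.

Variables (M N N' : omatroid T) (f g f' : T).
Hypothesis gel : generic_extension_lifting M f g N.
Hypothesis rep : compliant_replacement M N f g f' N'.

Let gel' : generic_extension_lifting M f' g N'. Proof. by case: rep. Qed.
Let del : delete N' f' = delete N f. Proof. by case: rep. Qed.

Lemma replacement_basis B :
  (f' \notin B) && basis N' B = (f \notin B) && basis N B.
Proof.
have [_ _ ge _ _] := gel; have [_ _ ge' _ _] := gel'.
by rewrite -(generic_extension_basis B ge) -(generic_extension_basis B ge') del.
Qed.

Lemma replacement_gbases :
  bases_with_without N' g f' = bases_with_without N g f.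
Proof.
apply/setP=> B; have := replacement_basis B; rewrite !inE => E.
by case: (g \in B); rewrite ?andbF //= andbC E andbC.
Qed.

(** On B the sign is read off in the contraction of g, outside B in the
    deletion of the extension point; the replacement shares both with N. *)
Lemma replacement_sign B x : B \in bases_with_without N g f -> x \in ground M ->
  basis_sign N' f' g B x = basis_sign N f g B x.
Proof.
move=> BG xM; have [bB gB fB] := gbasesP _ _ _ _ BG.
have BG' : B \in bases_with_without N' g f' by rewrite replacement_gbases.
have [bB' _ fB'] := gbasesP _ _ _ _ BG'.
have [gf gg [fN gN] fg nl] := extension_liftingP gel.
have [gf' gg' [fN' gN'] fg' nl'] := extension_liftingP gel'.
have := xM; rewrite -(extension_lifting_ground gel) !inE negb_or.
case/andP=> /andP[xf xg] xN.
have := xM; rewrite -(extension_lifting_ground gel') !inE negb_or.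
case/andP=> /andP[xf' _] xN'.
rewrite /basis_sign; case: ifPn => xB; last first.
  have [DD Dg DB _] := fcocircuitP bB gB.
  have [DD' Dg' DB' _] := fcocircuitP bB' gB.
  rewrite (covector_fcircuit bB gB (cocircuit_covector DD)) //.
  rewrite (covector_fcircuit bB' gB (cocircuit_covector DD')) //.
  have [CC Cx sC] := fcircuitP bB xN xB.
  suff <- : fcircuit N B x = fcircuit N' B x by [].
  apply: fcircuit_eq => //.
  have Cf : fcircuit N B x f = None.
    apply/eqP/negPn/negP=> /sC[fx|]; last exact/negP.
    by rewrite fx eqxx in xf.
  have : fcircuit N B x \in circuits (delete N' f') by rewrite del deleteP CC Cf.
  by rewrite deleteP => /andP[].
have [CC Cf sC] := fcircuitP bB fN fB.
have Cg : fcircuit N B f g != None by apply: (gf B) => //; rewrite Cf.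
have sV : ((tperm f f')^-1)%g = tperm f f' by rewrite tpermV.
have : srelabel (tperm f f') (sdel g (fcircuit N B f)) \in circuits (contract N' g).
  case: rep => _ _ _ ->; apply: imset_f; apply: contract_mem => //.
  by exists f => //; rewrite Cf.
case/contract_circuitP=> X XC [_ /ffunP XE _].
have XE' y : y != g -> X y = fcircuit N B f (tperm f f' y).
  move=> yg; have := XE y; rewrite !ffunE sV (negPf yg) => <-.
  case: tpermP => [yf|yf|_ _]; rewrite ?(negPf yg) ?(negPf fg) //.
  have [f'E|//] := eqVneq f' g; by rewrite f'E eqxx in fg'.
have Xf' : X f' = Some true by rewrite XE' // tpermR Cf.
suff <- : X = fcircuit N' B f'.
  by rewrite XE' // tpermD // eq_sym.
apply: fcircuit_eq => // y Xy; have [->|yg] := eqVneq y g; first by right.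
move: Xy; rewrite XE' //; case: tpermP => [->|->|/eqP yf _ /sC[yf'|]].
- have [<-|ff'] := eqVneq f f'; first by left.
  by case/sC=> [f'f|]; [rewrite f'f eqxx in ff' | rewrite (negPf fB')].
- by left.
- by rewrite yf' eqxx in yf.
- by right.
Qed.

Lemma replacement_associated A B : A \subset ground M ->
  B \in bases_with_without N g f ->
  associated N' f' g A B = associated N f g A B.
Proof.
move=> /subsetP sA BG.
have BG' : B \in bases_with_without N' g f' by rewrite replacement_gbases.
have [gf gg [fN gN] fg nl] := extension_liftingP gel.
have [gf' gg' [fN' gN'] fg' nl'] := extension_liftingP gel'.
have [[_ fM gM] _ _ _ _] := gel; have [[_ fM' _] _ _ _ _] := gel'.
have gr x : x \in ground M <-> [/\ x \in ground N, x != f & x != g].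
  rewrite -(extension_lifting_ground gel) !inE negb_or; split.
    by case/andP=> /andP[].
  by case=> -> -> ->.
have gr' x : x \in ground M <-> [/\ x \in ground N', x != f' & x != g].
  rewrite -(extension_lifting_ground gel') !inE negb_or; split.
    by case/andP=> /andP[].
  by case=> -> -> ->.
have nA y : y \notin ground M -> y \notin A by apply: contra; apply: sA.
have P := associatedP gf gg fN BG (nA _ fM) (nA _ gM).
have P' := associatedP gf' gg' fN' BG' (nA _ fM') (nA _ gM).
apply/idP/idP=> [/P' h|/P h]; [apply/P | apply/P'] => x xN xf xg.
  have xM : x \in ground M by apply/gr.
  by have /gr'[xN' xf' _] := xM; rewrite -replacement_sign // h.
have xM : x \in ground M by apply/gr'.
by have /gr[xN' xf' _] := xM; rewrite replacement_sign // h.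
Qed.

Lemma replacement_regions : bounded_regions N' f' g = bounded_regions N f g.
Proof.
apply/setP=> A; apply/(region_associatedP A gel')/(region_associatedP A gel);
  move=> [sA [B BG aB]]; split=> //; exists B;
  rewrite ?replacement_gbases // in BG *.
- by rewrite -replacement_associated.
- by rewrite replacement_associated.
Qed.

Lemma replacement_region_basis A : A \in bounded_regions N f g ->
  region_basis N' f' g A = region_basis N f g A.
Proof.
move=> AR; have [gf gg [fN gN] fg nl] := extension_liftingP gel.
have [gf' gg' [fN' gN'] fg' nl'] := extension_liftingP gel'.
have AR' : A \in bounded_regions N' f' g by rewrite replacement_regions.
have [sA _] := region_associatedP A gel AR.
have [BG aB] := region_basisP gf gg fN gN fg nl AR.
apply/esym/(region_basis_eq gf' gg' fN' gN' fg' nl' _ AR').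
have BG' := BG; rewrite -replacement_gbases in BG'.
by apply/(associated_optimal _ BG'); rewrite replacement_associated.
Qed.

End ReplacementInvariance.

Theorem proposition6 (T : finType) (M Mbar : omatroid T) (f g : T)
    (hgen : generic_extension_lifting M f g Mbar) :
  let regions := bounded_regions Mbar f g in
  let gbases := bases_with_without Mbar g f in
  let phi := region_basis Mbar f g in
  (* (1) *)
  [/\ [/\ forall A : {set T}, A \in regions ->
            exists! B : {set T}, B \in gbases /\ associated Mbar f g A B,
          forall B : {set T}, B \in gbases ->
            exists! A : {set T},
              A \subset ground M /\ associated Mbar f g A B,
          forall A B : {set T}, B \in gbases -> A \subset ground M ->
            associated Mbar f g A B -> A \in regions,
          forall A : {set T}, A \in regions ->
            phi A \in gbases /\ associated Mbar f g A (phi A)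
        & {in regions &, injective phi} /\ phi @: regions = gbases],
  (* (2) *)
      forall A : {set T}, A \in regions ->
        forall B : {set T},
          optimal_basis (reorient Mbar A) g f B <-> B = phi A,
  (* (3) *)
      compliant Mbar f g ->
        forall r : rel T, linear_order_on (ground Mbar) r ->
          (forall e, e \in ground Mbar -> r g e) ->
          (forall e, e \in ground Mbar -> e != g -> r f e) ->
          [/\ forall A : {set T}, A \subset ground Mbar -> g \notin A ->
                (A \in regions <-> bounded (reorient Mbar A) g),
              forall A : {set T}, A \in regions ->
                forall B : {set T},
                  fully_optimal r g (reorient Mbar A) B <-> B = phi A
            & forall A : {set T}, A \in regions ->
                active_basis r g (reorient Mbar A) = phi A]
  (* (3), parenthetical remark *)
    & ~~ compliant Mbar f g ->
        forall f' : T, f' \notin g |: ground M ->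
          (exists Mbar', compliant_replacement M Mbar f g f' Mbar') /\
          (forall Mbar', compliant_replacement M Mbar f g f' Mbar' ->
             bounded_regions Mbar' f' g = regions /\
             forall A : {set T}, A \in regions ->
               region_basis Mbar' f' g A = phi A)].
Proof.
move=> regions gbases phi.
have [gf gg [fN gN] fg nl] := extension_liftingP hgen.
have phiP A : A \in regions -> phi A \in gbases /\ associated Mbar f g A (phi A).
  exact: region_basisP.
have phi_eq A B : A \in regions -> optimal (reorient Mbar A) f g B <-> B = phi A.
  exact: region_basis_eq.
have regP A := region_associatedP A hgen.
have subM A : A \in regions -> A \subset ground M by case/regP.
have exA B : B \in gbases -> exists! A : {set T},
    A \subset ground M /\ associated Mbar f g A B.
  by rewrite -(extension_lifting_ground hgen); apply: associated_exists.
split.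
- split=> //.
  + move=> A AR; exists (phi A); split=> [|B [BG aB]]; first exact: phiP.
    by apply/esym/phi_eq => //; apply/(associated_optimal _ BG).
  + by move=> A B BG sA aB; apply/regP; split=> //; exists B.
  + split=> [A A' AR AR' E|].
      have [BG aB] := phiP A AR; have [_ aB'] := phiP A' AR'.
      have [A0 [_ uA]] := exA _ BG.
      have EA : A0 = A by apply: uA; split=> //; apply: subM.
      have EA' : A0 = A' by apply: uA; rewrite E; split=> //; apply: subM.
      by rewrite -EA.
    apply/setP=> B; apply/imsetP/idP => [[A AR ->]|BG]; first by case: (phiP A AR).
    have [A [[sA aB] _]] := exA B BG.
    have AR : A \in regions by apply/regP; split=> //; exists B.
    by exists A => //; apply/phi_eq => //; apply/(associated_optimal _ BG).
- move=> A AR B; have P := phi_eq A B AR.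
  by split=> [/optimal_basisP/P//|/P oB]; apply/optimal_basisP.
- move=> cmp r lr rg rf.
  have foP A B : A \in regions ->
      fully_optimal r g (reorient Mbar A) B <-> B = phi A.
    move=> AR; have [[_ fA gA] _] := bounded_regionsP gf gg fN gN fg nl A AR.
    have P := fully_optimalP gf gg fN gN fg lr rg rf B gA fA.
    have Q := phi_eq A B AR; split=> [/P[/Q]//|/Q oB]; apply/P; split=> //.
    exact: (compliant_optimal gg fN cmp fA gA oB).
  split=> [A|A AR B|A AR]; [exact: compliant_bounded | exact: foP |].
  rewrite /active_basis; case: pickP => [B /(foP A B AR)//|/(_ (phi A))].
  by move=> /negP[]; apply/foP.
- move=> _ f' f'M; split; first by eexists; apply: (lex_replacement hgen f'M).
  move=> M' rep; split; first exact: (replacement_regions hgen rep).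
  by move=> A AR; apply: (replacement_region_basis hgen rep).
Qed.
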